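(* Let $f\in IV\cup III\cup II_a\cup II_b\cup II_c$ be either with real coefficients or in $II'_c$, let $s_f$ be the standard even Real structure on $H_f$, and let $Q_f=H_f/\langle s_f\rangle$. Identify the quotient $W/\langle c\rangle$ (respectively $W/\langle c'\rangle$ if $f\in II'_c$) with $\mathbb{R}^4\setminus\{0\}$ as described in the context, and let $\mathcal{F}$ be the contraction of $\mathbb{R}^4\setminus\{0\}$ induced by $f$. (1) The quotient $Q_f$ can be identified topologically with the quotient $\mathcal{Q}_f=(\mathbb{R}^4\setminus\{0\})/\langle\mathcal{F}\rangle$ of $\mathbb{R}^4\setminus\{0\}$ by the cyclic group generated by the contraction $\mathcal{F}$, which is orientation preserving. Therefore, in all cases, $Q_f$ is homeomorphic to $S^1\times S^3$. (2) $\mathcal{F}$ leaves invariant the punctured plane $(\mathbb{R}^2\setminus\{0\})\times\{0\}$ and, via the identification of $Q_f$ with $\mathcal{Q}_f=(\mathbb{R}^4\setminus\{0\})/\langle\mathcal{F}\rangle$ induced by the identification of $W/\langle c\rangle$ (respectively $W/\langle c'\rangle$ if $f\in II'_c$) with $\mathbb{R}^4\setminus\{0\}$, the fixed point locus $H_f^{s_f}$ corresponds to the quotient of $\mathbb{R}^2\setminus\{0\}$ by the contraction $\mathcal{F}_0$ induced by $\mathcal{F}$. (3) $\mathcal{F}_0$ is orientation preserving if and only if the diagonal coefficients of $f$ have the same sign (i.e. their product is positive). If this is the case, $(\mathbb{R}^2\setminus\{0\})/\langle\mathcal{F}_0\rangle$ is a $2$-torus. If the diagonal coefficients of $f$ have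 opposite signs, $(\mathbb{R}^2\setminus\{0\})/\langle\mathcal{F}_0\rangle$ is a Klein bottle.
   Context: $W=\mathbb{C}^2\setminus\{0\}$; $H_f=W/\langle f\rangle$. Classes of contractions of $W$: - $IV$: $f(z,w)=(\alpha z,\alpha w)$, $0<|\alpha|<1$; - $III$: $f(z,w)=(\delta^r z,\delta w)$, $r\in\mathbb{N}$, $r\ge 2$, $0<|\delta|<1$; - $II_a$: $f(z,w)=(\delta^r z+w^r,\delta w)$, $r\in\mathbb{N}$, $r\ge2$, $0<|\delta|<1$; - $II_b$: $f(z,w)=(\alpha z+w,\alpha w)$, $0<|\alpha|<1$; - $II_c$: $f(z,w)=(\alpha z,\delta w)$, $0<|\alpha|<1$, $0<|\delta|<1$, $\alpha\ne\delta^r$ for all $r\in\mathbb{N}$; - $II'_c\subset II_c$: $f(z,w)=(\alpha z,\bar\alpha w)$, $0<|\alpha|<1$, $\alpha\notin\mathbb{R}$. The diagonal coefficients of $f$ are the coefficient of $z$ in the first component and the coefficient of $w$ in the second component. The standard Real structure $s_f$ is the anti-holomorphic involution of $H_f$ induced by $c(z,w)=(\bar z,\bar w)$ if $f$ has real coefficients, and by $c'(z,w)=(\bar w,\bar z)$ if $f\in II'_c$; $c$ (respectively $c'$) commutes with $f$. Identification with $\mathbb{R}^4\setminus\{0\}$: write $\mathbb{C}^2=V_+\oplus V_-$ where $V_\pm$ are the real $2$-dimensional $(\pm1)$-eigenspaces of $c$ (respectively $c'$). Then $\mathbb{C}^2/\langle c\rangle$ (respectively $\mathbb{C}^2/\langle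 c'\rangle$) is $V_+\times(V_-/\langle-\mathrm{id}_{V_-}\rangle)\simeq\mathbb{R}^2\times\mathbb{R}^2=\mathbb{R}^4$, using linear isomorphisms $V_\pm\simeq\mathbb{R}^2$ and the homeomorphism $\mathbb{R}^2/\langle-\mathrm{id}\rangle\to\mathbb{R}^2$ induced by $\zeta\mapsto\zeta^2$ (with $\mathbb{R}^2=\mathbb{C}$). The image of $W/\langle c\rangle$ (respectively $W/\langle c'\rangle$) is $\mathbb{R}^4\setminus\{0\}$, and the image of the fixed point locus $W^c$ (respectively $W^{c'}$) is $(\mathbb{R}^2\setminus\{0\})\times\{0\}$. *)

(* Defs.v *)
From HB Require Import structures.
From mathcomp Require Import all_boot all_order all_algebra.
From mathcomp Require Import complex.
From mathcomp Require Import freeg.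
From mathcomp Require Import all_classical all_reals all_analysis.

Set Implicit Arguments.
Unset Strict Implicit.
Unset Printing Implicit Defensive.

Import numFieldNormedType.Exports.
Import Order.TTheory GRing.Theory Num.Theory.

Local Open Scope ring_scope.
Local Open Scope complex_scope.
Local Open Scope classical_set_scope.
Local Open Scope quotient_scope.

(* R[i] carries no topology of its own; its regular module R[i]^o has the
   topology of the complex norm. *)
Notation C2 R := (R[i]^o * R[i]^o)%type.
Notation R2 R := (R * R)%type.
Notation R4 R := ((R * R) * (R * R))%type.

Definition punctured (X : zmodType) : set X := [set x | x != 0].
Arguments punctured X : clear implicits.

Definition homeomorphism (X Y : topologicalType) (h : X -> Y) :=
  continuous h /\
  exists g : Y -> X, [/\ continuous g, cancel h g & cancel g h].

Definition homeomorphic (X Y : topologicalType) :=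
  exists h : X -> Y, homeomorphism h.

Section OrbitSpace.
Variables (U : topologicalType) (T : Type) (i : U -> T) (g : T -> T).

(* For i injective and g a bijection of T preserving the image of i, this is
   the orbit relation on U of the cyclic group generated by g:
   g^m (i x) = g^n (i y) iff i x = g^(n-m) (i y) with n - m an arbitrary
   integer.  This form is an equivalence relation for every g. *)
Definition orbit_rel : rel U :=
  fun x y => `[< exists m n : nat, iter m g (i x) = iter n g (i y) >].

Lemma orbit_rel_refl : reflexive orbit_rel.
Proof. by move=> x; apply/asboolP; exists 0%N, 0%N. Qed.

Lemma orbit_rel_sym : symmetric orbit_rel.
Proof.
by move=> x y; apply/asboolP/asboolP => -[m [n e]]; exists n, m; rewrite e.
Qed.

Lemma orbit_rel_trans : transitive orbit_rel.
Proof.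
move=> y x z /asboolP[m [n e]] /asboolP[p [q e']].
by apply/asboolP; exists (p + m)%N, (n + q)%N; rewrite !iterD e -e' -!iterD addnC.
Qed.

Canonical orbit_equiv :=
  EquivRel orbit_rel orbit_rel_refl orbit_rel_sym orbit_rel_trans.

Definition orbit_space : topologicalType :=
  quotient_topology {eq_quot orbit_rel}.

Definition orbit_class (x : U) : orbit_space :=
  \pi_(quotient_topology {eq_quot orbit_rel}) x.

Definition orbit_repr (h : orbit_space) : U :=
  repr (h : quotient_topology {eq_quot orbit_rel}).

Lemma orbit_reprK : cancel orbit_repr orbit_class.
Proof. by move=> h; rewrite /orbit_class /orbit_repr reprK. Qed.

Lemma orbit_classP (x y : U) :
  orbit_class x = orbit_class y <->
  exists m n : nat, iter m g (i x) = iter n g (i y).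
Proof.
rewrite /orbit_class; split.
  by move=> /eqmodP /asboolP.
by move=> e; apply/eqmodP/asboolP.
Qed.

End OrbitSpace.

(* (X \ 0) / <g>, for g a bijection of X fixing 0. *)
Definition punctured_quotient (K : numFieldType) (X : normedModType K)
    (g : X -> X) : topologicalType :=
  @orbit_space (punctured X) X \val g.

Definition punctured_class (K : numFieldType) (X : normedModType K)
    (g : X -> X) (x : punctured X) : punctured_quotient g :=
  @orbit_class (punctured X) X \val g x.

Definition punctured_repr (K : numFieldType) (X : normedModType K)
    (g : X -> X) (h : punctured_quotient g) : punctured X :=
  @orbit_repr (punctured X) X \val g h.

Lemma punctured_reprK (K : numFieldType) (X : normedModType K) (g : X -> X) :
  cancel (@punctured_repr K X g) (punctured_class g).
Proof. exact: orbit_reprK. Qed.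

Lemma punctured_classP (K : numFieldType) (X : normedModType K) (g : X -> X)
    (x y : punctured X) :
  punctured_class g x = punctured_class g y <->
  exists m n : nat, iter m g (\val x) = iter n g (\val y).
Proof. exact: orbit_classP. Qed.

Section Spaces.
Variable R : realType.

Definition circle : set (R2 R) := [set x | x.1 ^+ 2 + x.2 ^+ 2 = 1].

Definition sphere3 : set (R4 R) :=
  [set x | x.1.1 ^+ 2 + x.1.2 ^+ 2 + x.2.1 ^+ 2 + x.2.2 ^+ 2 = 1].

Definition torus : topologicalType := (circle * circle)%type.

(* The Klein bottle is the quotient of the plane by the group generated by
   (x, y) |-> (x + 1, - y) and (x, y) |-> (x, y + 1). *)
Definition klein_rel : rel (R2 R) := fun x y =>
  `[< exists m n : int,
        y = (x.1 + m%:~R, (-1) ^ m * x.2 + n%:~R) >].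

Lemma klein_signE (m : int) : exists s : int, (-1) ^ m = s%:~R :> R.
Proof.
case: m => n; first by exists ((-1) ^+ n); rewrite rmorph_sign.
by exists ((-1) ^+ n.+1); rewrite NegzE -exprnN -exprVn invrN1 rmorph_sign.
Qed.

Lemma klein_rel_refl : reflexive klein_rel.
Proof.
move=> [x y]; apply/asboolP; exists 0, 0.
by rewrite /= !addr0 expr0z mul1r.
Qed.

Lemma klein_rel_sym : symmetric klein_rel.
Proof.
suff H x y : klein_rel x y -> klein_rel y x.
  by move=> x y; apply/idP/idP; exact: H.
move=> /asboolP[m [n ->]]; apply/asboolP; have [s sE] := klein_signE (- m).
exists (- m), (- (s * n)); case: x => x1 x2 /=; congr pair.
  by rewrite mulrNz addrK.
rewrite mulrDr mulrA -expfzDr ?oppr_eq0 ?oner_eq0// addNr expr0z mul1r.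
by rewrite mulrNz intrM -sE addrK.
Qed.

Lemma klein_rel_trans : transitive klein_rel.
Proof.
move=> _ [x1 x2] _ /asboolP[m [n ->]] /asboolP[p [q ->]]; apply/asboolP.
have [s sE] := klein_signE p.
exists (m + p), (s * n + q) => /=; congr pair; first by rewrite intrD addrA.
rewrite mulrDr mulrA -expfzDr ?oppr_eq0 ?oner_eq0// intrD intrM -sE addrA.
by rewrite [p + m]addrC.
Qed.

Canonical klein_equiv :=
  EquivRel klein_rel klein_rel_refl klein_rel_sym klein_rel_trans.

Definition klein_bottle : topologicalType :=
  quotient_topology {eq_quot klein_rel}.

End Spaces.
Arguments circle R : clear implicits.
Arguments sphere3 R : clear implicits.

Section Simplex.
Variable R : realType.

Definition std_simplex (n : nat) : set 'rV[R]_n.+1 :=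
  [set t | (forall j, 0 <= t 0 j) /\ \sum_j t 0 j = 1].
Arguments std_simplex n : clear implicits.

Lemma face_subproof n (k : 'I_n.+2) (t : std_simplex n) :
  \row_j oapp (fun l => \val t 0 l) 0 (unlift k j) \in std_simplex n.+1.
Proof.
case: t => t /= /set_mem[t_ge0 t_sum]; apply/mem_set; split => [j|].
  by rewrite mxE; case: (unlift k j) => /=.
rewrite (bigD1_ord k)//= mxE unlift_none /= add0r -t_sum.
by apply: eq_bigr => j _; rewrite mxE liftK.
Qed.

Definition face n (k : 'I_n.+2) (t : std_simplex n) : std_simplex n.+1 :=
  exist _ (\row_j oapp (fun l => \val t 0 l) 0 (unlift k j)) (face_subproof k t).

End Simplex.
Arguments std_simplex R n : clear implicits.

(* Formal integral combinations of arbitrary maps from the n-simplex; continuity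
   is imposed by singular_in. *)
Notation chain R X n := {freeg (set_type (std_simplex R n) -> X) / int}.

Section Singular.
Variables (R : realType) (X : topologicalType).

Definition singular_boundary n (c : chain R X n.+1) : chain R X n :=
  fglift (fun s : std_simplex R n.+1 -> X =>
    \sum_(k < n.+2) << (-1) ^+ k *g s \o face k >> : chain R X n) c.

(* c is a singular chain of the subspace A. *)
Definition singular_in (A : set X) n (c : chain R X n) :=
  forall s, s \in dom c -> continuous s /\ forall t, A (s t).

End Singular.

Definition push (R : realType) (X Y : topologicalType) (g : X -> Y) n
    (c : chain R X n) : chain R Y n :=
  fglift (fun s : std_simplex R n -> X =>
    << g \o s >> : chain R Y n) c.

(* X is a real vector space of dimension n + 1 and F restricts to a
   homeomorphism of U = X \ 0.  For x in U, excision and translation identify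
   H_(n+1)(U, U \ x; Z) with H_(n+1)(X, X \ 0; Z) = Z; F is orientation
   preserving when the isomorphisms
   F_* : H_(n+1)(U, U \ x) -> H_(n+1)(U, U \ F x) become the identity. *)
Definition orientation_preserving (R : realType) (n : nat)
    (X : normedModType R) (F : X -> X) :=
  forall (x : X) (c : chain R X n.+1), x != 0 ->
    singular_in [set y | y != 0] c ->
    singular_in [set y | y != 0 /\ y != x] (singular_boundary c) ->
    exists d : chain R X n.+2,
      singular_in setT d /\
      singular_in [set y | y != 0]
        (push (fun y => F y - F x) c - push (fun y => y - x) c
         - singular_boundary d).

(* Contractions of X \ 0 are represented by their extension to X fixing 0. *)
Definition punctured_contraction (R : realType) (X : normedModType R)
    (F : X -> X) :=
  [/\ homeomorphism F, F 0 = 0 &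
      forall M e : R, 0 < e -> exists N : nat, forall (n : nat) (x : X),
        (N <= n)%N -> `|x| <= M -> `|iter n F x| < e].

Inductive normal_form (R : realType) : Type :=
| IV of R[i]
| III of nat & R[i]
| IIa of nat & R[i]
| IIb of R[i]
| IIc of R[i] & R[i].

Section Hopf.
Variable R : realType.
Implicit Types f : normal_form R.

Definition admissible f : Prop :=
  match f with
  | IV a => 0 < `|a| < 1
  | III r d => (2 <= r)%N /\ 0 < `|d| < 1
  | IIa r d => (2 <= r)%N /\ 0 < `|d| < 1
  | IIb a => 0 < `|a| < 1
  | IIc a d => [/\ 0 < `|a| < 1, 0 < `|d| < 1 & forall r : nat, a <> d ^+ r]
  end.

Definition map_of f (v : C2 R) : C2 R :=
  match f with
  | IV a => (a * v.1, a * v.2)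
  | III r d => (d ^+ r * v.1, d * v.2)
  | IIa r d => (d ^+ r * v.1 + v.2 ^+ r, d * v.2)
  | IIb a => (a * v.1 + v.2, a * v.2)
  | IIc a d => (a * v.1, d * v.2)
  end.

Definition diag_coefs f : R[i] * R[i] :=
  match f with
  | IV a => (a, a)
  | III r d => (d ^+ r, d)
  | IIa r d => (d ^+ r, d)
  | IIb a => (a, a)
  | IIc a d => (a, d)
  end.

(* The remaining coefficients are 0 or 1. *)
Definition real_coefs f : bool :=
  ((diag_coefs f).1 \is Num.real) && ((diag_coefs f).2 \is Num.real).

Definition is_IIc' f : bool :=
  if f is IIc a d then (d == conjc a) && (a \isn't Num.real) else false.

Definition real_struct f (v : C2 R) : C2 R :=
  if is_IIc' f then (conjc v.2, conjc v.1) else (conjc v.1, conjc v.2).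

Lemma real_struct_punctured f (v : punctured (C2 R)) :
  real_struct f (\val v) \in punctured (C2 R).
Proof.
case: v => -[z w] /= /set_mem /= /eqP v0; apply/mem_set; apply/eqP.
rewrite /real_struct; case: ifP => _ /= -[/eqP + /eqP];
  rewrite !conjc_eq0 => /eqP z0 /eqP w0; apply: v0; congr pair => //.
Qed.

Definition real_structW f (v : punctured (C2 R)) : punctured (C2 R) :=
  exist _ (real_struct f (\val v)) (real_struct_punctured f v).

Definition hopf f : topologicalType := punctured_quotient (map_of f).

Definition hopf_class f : punctured (C2 R) -> hopf f :=
  punctured_class (map_of f).

Definition standard_real_structure f (h : hopf f) : hopf f :=
  hopf_class f (real_structW f (punctured_repr h)).

Lemma real_struct_map f (v : C2 R) : real_coefs f \/ is_IIc' f ->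
  real_struct f (map_of f v) = map_of f (real_struct f v).
Proof.
have cM (a b : R[i]) : conjc (a * b) = conjc a * conjc b by exact: rmorphM.
have cD (a b : R[i]) : conjc (a + b) = conjc a + conjc b by exact: rmorphD.
have cX (a : R[i]) n : conjc (a ^+ n) = conjc a ^+ n by exact: rmorphXn.
have cK (a : R[i]) : conjc (conjc a) = a by exact: conjcK.
have cR (a : R[i]) : a \is Num.real -> conjc a = a.
  by move=> /complex_realP[k ->]; exact: conjc_real.
move=> hf; have [hc|hc] := boolP (is_IIc' f).
  rewrite /real_struct hc; move: hc; case: f {hf} => //= a d /andP[/eqP -> _].
  by rewrite !cM cK.
rewrite /real_struct (negbTE hc); case: hf => [|h]; last by rewrite h in hc.
case: f hc => [a|r d|r d|a|a d] _ /andP[/cR h1 /cR h2] /=;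
  by move: h1 h2; rewrite /= !(cM, cD, cX) => h1 h2; rewrite ?h1 ?h2.
Qed.

Lemma standard_real_structure_class f (v : punctured (C2 R)) :
  real_coefs f \/ is_IIc' f ->
  standard_real_structure (hopf_class f v) = hopf_class f (real_structW f v).
Proof.
move=> hf.
have [m [n e]] := (punctured_classP _ _ _).1 (punctured_reprK (hopf_class f v)).
have it k u : iter k (map_of f) (real_struct f u) =
    real_struct f (iter k (map_of f) u).
  by elim: k => //= k ->; rewrite real_struct_map.
apply: (punctured_classP _ _ _).2; exists m, n.
exact: etrans (it m _) (etrans (congr1 (real_struct f) e) (esym (it n _))).
Qed.

(* The real structure s is an involution, so this is the quotient by {id, s}. *)
Definition hopf_quotient f : topologicalType :=
  @orbit_space (hopf f) (hopf f) id (@standard_real_structure f).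

Definition hopf_quotient_class f : hopf f -> hopf_quotient f :=
  orbit_class id (@standard_real_structure f).

Definition fixed_locus f : set (hopf f) :=
  [set h | standard_real_structure h = h].

Definition eigen_plus f : set (C2 R) := [set v | real_struct f v = v].
Definition eigen_minus f : set (C2 R) := [set v | real_struct f v = - v].

(* phi restricts to an R-linear isomorphism from V onto R^2; its values outside
   V are irrelevant. *)
Definition linear_iso_on (V : set (C2 R)) (phi : C2 R -> R2 R) :=
  (forall (a : R) (u v : C2 R), V u -> V v ->
     phi (a%:C *: u + v) = a *: phi u + phi v) /\
  set_bij V setT phi.

Definition sqr_map (x : R2 R) : R2 R :=
  (x.1 ^+ 2 - x.2 ^+ 2, 2 * x.1 * x.2).

(* The quotient map C^2 -> C^2 / <c> = R^4 attached to the isomorphisms phip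
   and phim, composed with v |-> (v + c v) / 2 and v |-> (v - c v) / 2, the
   projections onto the eigenspaces of c. *)
Definition ident f (phip phim : C2 R -> R2 R) (v : C2 R) : R4 R :=
  (phip ((2^-1 : R[i]) *: (v + real_struct f v)),
   sqr_map (phim ((2^-1 : R[i]) *: (v - real_struct f v)))).

End Hopf.
Arguments fixed_locus {R} f.

(* Main.v *)
(* The map f is conjugate, by a homeomorphism of C^2 commuting with the real
   structure, to a linear map scaling the two real eigenplanes V_+ and V_- of the
   real structure and composing with a common rotation of both planes (diagonal
   coefficients of the same sign) or with a reflection in both (opposite signs);
   the non-diagonalizable forms are reached by a shear with a logarithmic
   coefficient.  Squaring V_-, F becomes conjugate to the time-one map of a
   contracting linear flow on R^4, also in the reflection case, where the
   reflections of the two planes together form a rotation of R^4.  The flow makes F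
   isotopic to the identity, hence orientation preserving by the prism operator,
   and its polar coordinates identify the quotient with S^1 x S^3.
   On the invariant plane one finds either the time-one map of a planar flow, with
   quotient a torus, or a contraction composed with a reflection: the quotient is
   then a Klein bottle, and the winding number of a loop, which is a homological
   invariant of the punctured plane, shows that F_0 reverses orientation. *)
Require Import Defs.
From HB Require Import structures.
From mathcomp Require Import all_boot all_order all_algebra.
From mathcomp Require Import complex.
From mathcomp Require Import freeg.
From mathcomp Require Import all_classical all_reals all_analysis.
From mathcomp Require Import ring lra zify.

Set Implicit Arguments.
Unset Strict Implicit.
Unset Printing Implicit Defensive.

Import numFieldNormedType.Exports.
Import Order.TTheory GRing.Theory Num.Theory.

Local Open Scope ring_scope.
Local Open Scope complex_scope.
Local Open Scope classical_set_scope.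

(** Orientation is defined on chains, by comparison after translations. It passes through isotopies
    and additive conjugations, but not evidently through the homeomorphisms that normalize [f].
    Reversal on the invariant plane therefore bypasses the normalized model: on real points [f] is
    triangular in linear coordinates, and is deformed to a diagonal matrix of signs. Squaring [V_-]
    squares its contraction rate and doubles its rotation angle, so the models contract [V_+] by
    exp(-1) and [V_-] by exp(-1/2); powers of the radius bring all moduli to these rates. The
    logarithm enters because ln |d w|^2 - ln |w|^2 = ln d^2 is constant: adding a multiple of w^r ln
    |w|^2 to z absorbs the term w^r. The shear is continuous at w = 0, and commutes with conjugation
    since its coefficient is real. A class fixed by the real structure satisfies f^m (c v) = f^n v.
    Modulo c this would make v periodic if m and n differed, which a contraction excludes; so m = n
    and v lies in [V_+]. *)

Section ContinuousOperations.
Variable T : topologicalType.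

Lemma continuous_compose (A B : topologicalType) (f : T -> A) (g : A -> B) :
  continuous f -> continuous g -> continuous (fun t => g (f t)).
Proof. by move=> cf cg t; apply: continuous_comp; [exact: cf|exact: cg]. Qed.

Lemma continuous_pair (A B : topologicalType) (f : T -> A) (g : T -> B) :
  continuous f -> continuous g -> continuous (fun t => (f t, g t)).
Proof. by move=> cf cg t; apply: (cvg_pair (cf t) (cg t)). Qed.

Lemma continuous_cst (A : topologicalType) (a : A) : continuous (fun _ : T => a).
Proof. by move=> t; exact: cvg_cst. Qed.

Section Module.
Variables (K : numFieldType) (V : normedModType K).
Implicit Types (f g : T -> V) (k : T -> K^o).

Lemma continuous_add f g :
  continuous f -> continuous g -> continuous (fun t => f t + g t).
Proof. by move=> cf cg t; apply: cvgD; [exact: cf|exact: cg]. Qed.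

Lemma continuous_opp f : continuous f -> continuous (fun t => - f t).
Proof. by move=> cf t; apply: cvgN; exact: cf. Qed.

Lemma continuous_sub f g :
  continuous f -> continuous g -> continuous (fun t => f t - g t).
Proof. by move=> cf cg; apply: continuous_add => //; exact: continuous_opp. Qed.

Lemma continuous_scale k f :
  continuous k -> continuous f -> continuous (fun t => k t *: f t).
Proof. by move=> ck cf t; apply: cvgZ; [exact: ck|exact: cf]. Qed.

Lemma continuous_sum (I : Type) (r : seq I) (P : pred I) (f : I -> T -> V) :
  (forall i, P i -> continuous (f i)) ->
  continuous (fun t => \sum_(i <- r | P i) f i t).
Proof.
by move=> cf t; apply: cvg_big => [|i Pi]; [exact: add_continuous|exact: cf].
Qed.

End Module.

Section Field.
Variable K : numFieldType.
Implicit Types f g : T -> K^o.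

Lemma continuous_mul f g :
  continuous f -> continuous g -> continuous (fun t => f t * g t : K^o).
Proof. by move=> cf cg t; apply: cvgM; [exact: cf|exact: cg]. Qed.

Lemma continuous_exp n f : continuous f -> continuous (fun t => f t ^+ n : K^o).
Proof.
move=> cf; elim: n => [|n IH]; first exact: continuous_cst.
under eq_fun do rewrite exprS.
exact: continuous_mul.
Qed.

End Field.

Lemma continuous_val (X : topologicalType) (A : set X) (g : T -> A) :
  continuous (fun t => \val (g t)) -> continuous g.
Proof. by move=> cg; exact: continuous_comp_initial. Qed.

End ContinuousOperations.

Lemma val_continuous (X : topologicalType) (A : set X) :
  continuous (\val : A -> X).
Proof. exact: initial_continuous. Qed.

Lemma continuous_fst (A B : topologicalType) : continuous (@fst A B).
Proof. by move=> t; exact: cvg_fst. Qed.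

Lemma continuous_snd (A B : topologicalType) : continuous (@snd A B).
Proof. by move=> t; exact: cvg_snd. Qed.

(** * Singular chains and the prism operator *)

Section FreeLift.
Variables (K : choiceType) (M : lmodType int) (f : K -> M).

HB.instance Definition _ :=
  GRing.isZmodMorphism.Build {freeg K / int} M (fglift f) (lift_is_additive f).

Lemma fgliftB : zmod_morphism (fglift f).
Proof. exact: raddfB. Qed.

Lemma fglift0 : fglift f 0 = 0.
Proof. exact: raddf0. Qed.

Lemma fgliftU x : fglift f << x >> = f x.
Proof. by rewrite liftU scale1r. Qed.

End FreeLift.

Lemma fglift_mapU (K L : choiceType) (g : K -> L) k x :
  fglift (fun y => << g y >> : {freeg L / int}) << k *g x >> =
  << k *g g x >>.
Proof. by rewrite liftU -{1}[k]intz scaler_int freegU_mulz intz. Qed.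

Lemma fglift_sum_dom (K : choiceType) (M : lmodType int) (f : K -> M)
    (c : {freeg K / int}) :
  fglift f c = \sum_(x <- dom c) coeff x c *: f x.
Proof.
rewrite -{1}[c]freeg_sumE raddf_sum /=; apply: eq_bigr => x _.
by rewrite liftU.
Qed.

Definition supported (K : choiceType) (P : K -> Prop) (c : {freeg K / int}) :=
  forall x, x \in dom c -> P x.

(** The morphisms are unbundled, so that composites of boundaries, push-forwards and prisms can be
    compared on generators without being declared additive one by one. *)
Lemma freeg_additive_ext_in (K : choiceType) (M : zmodType) (P : K -> Prop)
    (f g : {freeg K / int} -> M) :
  zmod_morphism f -> zmod_morphism g ->
  (forall x, P x -> f << x >> = g << x >>) ->
  forall c, supported P c -> f c = g c.
Proof.
move=> fB gB fg c cP.
pose F := GRing.isZmodMorphism.Build _ _ f fB.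
pose f' : {additive {freeg K / int} -> M} := HB.pack f F.
pose G := GRing.isZmodMorphism.Build _ _ g gB.
pose g' : {additive {freeg K / int} -> M} := HB.pack g G.
rewrite -[f]/(f' : _ -> _) -[g]/(g' : _ -> _).
rewrite -[c]freeg_sumE !raddf_sum big_seq [RHS]big_seq.
apply: eq_bigr => x /cP Px.
have -> : << coeff x c *g x >> = << x >> *~ coeff x c :> {freeg K / int}.
  by rewrite freegU_mulz intz.
by rewrite !raddfMz [f' _]fg.
Qed.

Lemma freeg_additive_ext (K : choiceType) (M : zmodType)
    (f g : {freeg K / int} -> M) :
  zmod_morphism f -> zmod_morphism g ->
  (forall x, f << x >> = g << x >>) -> f =1 g.
Proof.
move=> fB gB fg c.
by apply: (freeg_additive_ext_in (P := fun=> True)) => // x _; exact: fg.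
Qed.

Section Supported.
Variables (K : choiceType) (P : K -> Prop).
Implicit Types c d : {freeg K / int}.

Lemma supported0 : supported P 0.
Proof. by move=> x; rewrite dom0. Qed.

Lemma supportedD c d : supported P c -> supported P d -> supported P (c + d).
Proof.
by move=> cP dP x /domD_subset; rewrite mem_cat => /orP[/cP|/dP].
Qed.

Lemma supportedN c : supported P c -> supported P (- c).
Proof. by move=> cP x; rewrite domN => /cP. Qed.

Lemma supportedB c d : supported P c -> supported P d -> supported P (c - d).
Proof. by move=> cP dP; apply: supportedD => //; exact: supportedN. Qed.

Lemma supportedU k x : P x -> supported P << k *g x >>.
Proof.
move=> Px y; have [->|k0] := eqVneq k 0; first by rewrite freegU0 dom0.
by rewrite domU// inE => /eqP ->.
Qed.

Lemma supportedZ k c : supported P c -> supported P (k *: c).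
Proof. by move=> cP x /domZ_subset /cP. Qed.

Lemma supported_sum (I : Type) (r : seq I) (Q : pred I)
    (F : I -> {freeg K / int}) :
  (forall i, Q i -> supported P (F i)) -> supported P (\sum_(i <- r | Q i) F i).
Proof.
by move=> FP; elim/big_ind: _ => //; [exact: supported0|exact: supportedD].
Qed.

End Supported.

Lemma supported_fglift (K L : choiceType) (P : K -> Prop) (Q : L -> Prop)
    (f : K -> {freeg L / int}) c :
  (forall x, P x -> supported Q (f x)) ->
  supported P c -> supported Q (fglift f c).
Proof.
move=> fPQ cP; rewrite fglift_sum_dom big_seq; apply: supported_sum => x /cP.
by move=> /fPQ/supportedZ.
Qed.

Section Singular.
Variable R : realType.

Section Push.
Variables (X Y : topologicalType) (g : X -> Y) (n : nat).

HB.instance Definition _ := GRing.isZmodMorphism.Build (chain R X n) (chain R Y n)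
  (@push R X Y g n) (lift_is_additive _).

Lemma pushB : zmod_morphism (@push R X Y g n).
Proof. exact: raddfB. Qed.

Lemma pushU s : push g << s >> = << g \o s >> :> chain R Y n.
Proof. exact: fgliftU. Qed.

End Push.

HB.instance Definition _ (X : topologicalType) n :=
  GRing.isZmodMorphism.Build (chain R X n.+1) (chain R X n)
  (@singular_boundary R X n) (lift_is_additive _).

Lemma singular_boundaryB (X : topologicalType) n :
  zmod_morphism (@singular_boundary R X n).
Proof. exact: raddfB. Qed.

Lemma singular_boundaryU (X : topologicalType) n (s : std_simplex R n.+1 -> X) :
  singular_boundary << s >> = \sum_(k < n.+2) << (-1) ^+ k *g s \o face k >>.
Proof. exact: fgliftU. Qed.

Lemma pushUk (X Y : topologicalType) (g : X -> Y) n k (s : std_simplex R n -> X) :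
  push g << k *g s >> = << k *g g \o s >>.
Proof. exact: fglift_mapU. Qed.

Lemma push_boundary (X Y : topologicalType) (g : X -> Y) n (c : chain R X n.+1) :
  push g (singular_boundary c) = singular_boundary (push g c).
Proof.
move: c; apply: freeg_additive_ext => [c d|c d|s]; rewrite ?raddfB//.
rewrite pushU !singular_boundaryU raddf_sum; apply: eq_bigr => k _.
exact: pushUk.
Qed.
End Singular.

Lemma subr_ACA (M : zmodType) (x y z t : M) :
  (x - y) - (z - t) = (x - z) - (y - t).
Proof. by rewrite !opprB addrACA [RHS]addrACA [- z - y]addrC. Qed.

(** * The prism operator on ordered lists of vertices *)

Section ListComplex.
Variable V : choiceType.
Implicit Types (s : seq V) (c : {freeg (seq V) / int}).

Definition list_cone (a : V) c : {freeg (seq V) / int} :=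
  fglift (fun s => << a :: s >> : {freeg (seq V) / int}) c.

HB.instance Definition _ a :=
  GRing.isZmodMorphism.Build _ _ (list_cone a) (lift_is_additive _).

Lemma list_coneB a : zmod_morphism (list_cone a).
Proof. exact: raddfB. Qed.

Lemma list_coneU a s : list_cone a << s >> = << a :: s >>.
Proof. exact: fgliftU. Qed.

(** The cone formula d(a s) = s - a d(s) replaces the alternating sum, so that identities follow by
    induction on the list rather than by reindexing double sums; [list_faceE] recovers the sum. The
    complex is augmented: a single vertex has the empty list as its face. *)
Fixpoint list_face s : {freeg (seq V) / int} :=
  if s is a :: s' then << s' >> - list_cone a (list_face s') else 0.

Definition list_boundary c : {freeg (seq V) / int} := fglift list_face c.

HB.instance Definition _ :=
  GRing.isZmodMorphism.Build _ _ list_boundary (lift_is_additive _).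

Lemma list_boundaryB : zmod_morphism list_boundary.
Proof. exact: raddfB. Qed.

Lemma list_boundaryU s : list_boundary << s >> = list_face s.
Proof. exact: fgliftU. Qed.

Lemma list_boundary_cone a c :
  list_boundary (list_cone a c) = c - list_cone a (list_boundary c).
Proof.
move: c; apply: freeg_additive_ext => [c d|c d|s].
- by rewrite list_coneB list_boundaryB.
- by rewrite list_boundaryB list_coneB subr_ACA.
- by rewrite list_coneU !list_boundaryU.
Qed.

Lemma list_boundaryK c : list_boundary (list_boundary c) = 0.
Proof.
move: c; apply: freeg_additive_ext => [c d|c d|s].
- by rewrite !list_boundaryB.
- by rewrite subrr.
elim: s => [|a s IH]; first by rewrite !list_boundaryU /= raddf0.
rewrite list_boundaryU /= list_boundaryB list_boundary_cone.
by move: IH; rewrite !list_boundaryU => ->; rewrite raddf0 subr0 subrr.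
Qed.

Definition omit (k : nat) s := take k s ++ drop k.+1 s.

Lemma list_faceE s :
  list_face s = \sum_(k < size s) << (-1) ^+ k *g omit k s >>.
Proof.
elim: s => [|a s IH]; first by rewrite big_ord0.
rewrite /= big_ord_recl expr0 {1}/omit /= drop0 IH raddf_sum -sumrN.
congr (_ + _); apply: eq_bigr => k _.
rewrite /= [list_cone _ _]fglift_mapU freegUN exprS mulN1r; congr << _ *g _ >>.
Qed.

Lemma nth_omit x0 k s j : nth x0 (omit k s) j = nth x0 s (bump k j).
Proof.
rewrite /omit nth_cat size_take /bump.
have [ks|sk] := ltnP k (size s).
  case: leqP => [kj|jk]; last by rewrite nth_take ?add0n.
  by rewrite nth_drop add1n addSn subnKC.
rewrite take_oversize// drop_oversize ?nth_nil; last by rewrite ltnW.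
case: (ltnP j (size s)) => js.
  by rewrite leqNgt (leq_trans js sk).
rewrite nth_default//; case: (k <= j)%N => //.
by rewrite (leq_trans js) ?leq_addl.
Qed.

Lemma size_omit k s : (k < size s)%N -> size (omit k s) = (size s).-1.
Proof.
move=> ks; rewrite /omit size_cat size_take ks size_drop.
by case: (size s) ks => // m; rewrite ltnS subSS /= => /subnKC.
Qed.

End ListComplex.

Lemma map_omit (V W : choiceType) (f : V -> W) k s :
  map f (omit k s) = omit k (map f s).
Proof. by rewrite /omit map_cat map_take map_drop. Qed.

Section ListPrism.
Variable V : choiceType.
Implicit Types (s : seq V) (c : {freeg (seq V) / int}).

Definition level (b : bool) s := [seq (a, b) | a <- s].

(** Recursive form of the usual triangulation of the prism by the simplices v_0 ... v_i v'_i ...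
    v'_n with signs (-1)^i, where the boolean [true] marks the primed copy of a vertex. *)
Fixpoint list_prism s : {freeg (seq (V * bool)) / int} :=
  if s is a :: s' then
    << (a, false) :: (a, true) :: level true s' >>
      - list_cone (a, false) (list_prism s')
  else 0.

Definition chain_prism c : {freeg (seq (V * bool)) / int} := fglift list_prism c.

HB.instance Definition _ :=
  GRing.isZmodMorphism.Build _ _ chain_prism (lift_is_additive _).

Lemma chain_prismB : zmod_morphism chain_prism.
Proof. exact: raddfB. Qed.

Lemma chain_prismU s : chain_prism << s >> = list_prism s.
Proof. exact: fgliftU. Qed.

Lemma chain_prism_cone a c :
  chain_prism (list_cone a c) =
    list_cone (a, false) (list_cone (a, true)
      (fglift (fun s => << level true s >> : {freeg (seq (V * bool)) / int}) c))
    - list_cone (a, false) (chain_prism c).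
Proof.
move: c; apply: freeg_additive_ext => [c d|c d|s].
- by rewrite list_coneB chain_prismB.
- by rewrite raddfB chain_prismB !list_coneB subr_ACA.
- by rewrite list_coneU !chain_prismU fgliftU !list_coneU.
Qed.

Lemma level_face b s :
  fglift (fun s => << level b s >> : {freeg (seq (V * bool)) / int}) (list_face s)
  = list_face (level b s).
Proof.
rewrite !list_faceE raddf_sum /= size_map; apply: eq_bigr => k _ /=.
by rewrite [LHS]fglift_mapU /level map_omit.
Qed.

Lemma list_prism_boundary s :
  list_boundary (list_prism s) =
    << level true s >> - << level false s >> - chain_prism (list_face s).
Proof.
elim: s => [|a s IH] /=; first by rewrite subrr raddf0 sub0r raddf0 oppr0.
rewrite list_boundaryB !list_boundaryU list_boundary_cone IH /=.
rewrite chain_prismB chain_prism_cone level_face chain_prismU /=.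
rewrite -!/(level _ _) !list_coneB !list_coneU.
set A := << _ :: level true s >>; set B := list_prism s.
set C := << _ :: level false s >>; set D := list_cone _ (list_cone _ _).
set E := list_cone _ (chain_prism _).
(* [subrK] cancels the two copies of [(a, false) :: level true s], the wall between the first
   simplex of the prism and the cone over the others. *)
by rewrite !opprB !addrA subrK [A + D - C]addrAC.
Qed.

Lemma size_list_prism s :
  supported (fun l => size l = (size s).+1) (list_prism s).
Proof.
elim: s => [|a s IH] /=; first exact: supported0.
apply: supportedB; first by apply: supportedU; rewrite /= size_map.
by apply: supported_fglift IH => l ls; apply: supportedU; rewrite /= ls.
Qed.

End ListPrism.

Lemma list_prism_map (V W : choiceType) (f : V -> W) s :
  list_prism (map f s) =
  fglift (fun l => << [seq (f x.1, x.2) | x <- l] >>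
     : {freeg (seq (W * bool)) / int}) (list_prism s).
Proof.
elim: s => [|a s IH] /=; first by rewrite fglift0.
rewrite fgliftB fgliftU /= /level -!map_comp IH; congr (_ - _).
move: (list_prism s); apply: freeg_additive_ext => [c d|c d|l].
- by rewrite fgliftB list_coneB.
- by rewrite list_coneB fgliftB.
- by rewrite list_coneU !fgliftU list_coneU.
Qed.

(** * Realization by singular simplices and the homotopy formula *)

Section Prism.
Variable R : realType.
Local Notation simplex n := (std_simplex R n).

Lemma continuous_rV (T : topologicalType) n (g : T -> 'rV[R]_n) :
  (forall j, continuous (fun t => g t 0 j)) -> continuous g.
Proof.
move=> cg; rewrite (_ : g = fun t => \sum_j g t 0 j *: delta_mx 0 j).
  apply: continuous_sum => j _.
  by apply: continuous_scale; [exact: cg|exact: continuous_cst].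
by apply/funext => u; rewrite [LHS]row_sum_delta.
Qed.

Lemma continuous_coord n (j : 'I_n.+1) : continuous (fun t : simplex n => \val t 0 j).
Proof.
exact: (continuous_compose (@val_continuous _ _) (@coord_continuous R 1 n.+1 0 j)).
Qed.

Lemma simplex_ge0 n (t : simplex n) j : 0 <= \val t 0 j.
Proof. by case: t => t /= /set_mem[]. Qed.

Lemma simplex_sum n (t : simplex n) : \sum_j \val t 0 j = 1.
Proof. by case: t => t /= /set_mem[]. Qed.

Lemma simplex_map_subproof m n (v : 'I_m.+1 -> 'I_n.+1) (t : simplex m) :
  \row_i (\sum_(j | v j == i) \val t 0 j) \in std_simplex R n.
Proof.
apply/mem_set; split => [i|]; first by rewrite mxE sumr_ge0 => // j _; exact: simplex_ge0.
rewrite -[RHS](simplex_sum t) (partition_big v xpredT)//=.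
by apply: eq_bigr => i _; rewrite mxE.
Qed.

(** The affine map given by a map of vertices pushes barycentric coordinates forward like weights;
    functoriality is then a partition of a sum according to the intermediate vertex. *)
Definition simplex_map m n (v : 'I_m.+1 -> 'I_n.+1) (t : simplex m) : simplex n :=
  exist _ (\row_i (\sum_(j | v j == i) \val t 0 j)) (simplex_map_subproof v t).

Lemma simplex_map_continuous m n (v : 'I_m.+1 -> 'I_n.+1) :
  continuous (simplex_map v).
Proof.
apply: continuous_val; apply: continuous_rV => i /=.
rewrite (_ : (fun _ => _) = fun t : simplex m => \sum_(j | v j == i) \val t 0 j).
  by apply: continuous_sum => j _; exact: continuous_coord.
by apply/funext => u; rewrite mxE.
Qed.

Lemma faceE n (k : 'I_n.+2) : face k = @simplex_map n n.+1 (fintype.lift k).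
Proof.
apply/funext => t; apply/val_inj/rowP => i; rewrite !mxE /=.
case: (unliftP k i) => [j ->|->].
  by rewrite (big_pred1 j)// => l; rewrite /= (inj_eq lift_inj).
by rewrite big_pred0// => l; rewrite eq_sym (negbTE (neq_lift _ _)).
Qed.

Lemma face_continuous n (k : 'I_n.+2) : continuous (@face R n k).
Proof. by rewrite faceE; exact: simplex_map_continuous. Qed.

Lemma simplex_map_comp l m n (v : 'I_m.+1 -> 'I_n.+1) (w : 'I_l.+1 -> 'I_m.+1) :
  simplex_map v \o simplex_map w = simplex_map (v \o w).
Proof.
apply/funext => t; apply/val_inj/rowP => i; rewrite !mxE /=.
under eq_bigr do rewrite mxE.
rewrite [RHS](partition_big w (fun j => v j == i))//=.
apply: eq_bigr => j /eqP vj; apply: eq_bigl => k.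
by have [->|] := eqVneq (w k) j; rewrite ?andbF// vj eqxx.
Qed.

Lemma simplex_map_id n : simplex_map id = id :> (simplex n -> simplex n).
Proof. by apply/funext => t; apply/val_inj/rowP => i; rewrite mxE big_pred1_eq. Qed.

Lemma sum_face n (k : 'I_n.+2) (t : simplex n) (a : 'I_n.+2 -> R) :
  \sum_j \val (face k t) 0 j * a j = \sum_j \val t 0 j * a (fintype.lift k j).
Proof.
rewrite (bigD1_ord k)//= mxE unlift_none mul0r add0r.
by apply: eq_bigr => j _; rewrite mxE liftK.
Qed.

Variables (X Y : topologicalType) (H : R -> X -> Y).

Definition vertex n (l : seq ('I_n.+1 * bool)) (j : nat) := nth (ord0, false) l j.

(* The singular simplex of Y given by H o (id x s), precomposed with the affine
   map sending the vertices of the m-simplex to those of [0, 1] x Delta^n listed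
   by l. *)
Definition prism_simplex n (s : simplex n -> X) m (l : seq ('I_n.+1 * bool))
    (t : simplex m) : Y :=
  H (\sum_j \val t 0 j * (vertex l j).2%:R)
    (s (simplex_map (fun j : 'I_m.+1 => (vertex l j).1) t)).

Lemma prism_simplex_face n (s : simplex n -> X) m l (k : 'I_m.+2) :
  prism_simplex s l \o face k = prism_simplex s (m := m) (omit k l).
Proof.
apply/funext => t; rewrite /prism_simplex /=; congr H.
  rewrite sum_face; apply: eq_bigr => j _.
  by rewrite /vertex nth_omit.
congr s; rewrite faceE -[LHS]/((_ \o _) t) simplex_map_comp; congr simplex_map.
by apply/funext => j; rewrite /vertex nth_omit.
Qed.

Lemma prism_simplex_level n (s : simplex n -> X) b :
  prism_simplex s (m := n) (level b (enum 'I_n.+1)) = H b%:R \o s.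
Proof.
have vE (j : 'I_n.+1) : vertex (level b (enum 'I_n.+1)) j = (j, b).
  by rewrite /vertex (nth_map ord0) ?size_enum_ord// nth_ord_enum.
apply/funext => t; rewrite /prism_simplex /=; congr H.
  by under eq_bigr do rewrite vE; rewrite -mulr_suml simplex_sum mul1r.
congr s; rewrite -[RHS]/(id t) -(simplex_map_id n); congr simplex_map.
by apply/funext => j; rewrite vE.
Qed.

Lemma prism_simplex_lift n (s : simplex n.+1 -> X) m (k : 'I_n.+2)
    (l : seq ('I_n.+1 * bool)) : (m < size l)%N ->
  prism_simplex s (m := m) [seq (fintype.lift k x.1, x.2) | x <- l] =
  prism_simplex (s \o face k) l.
Proof.
move=> ml; have vE (j : 'I_m.+1) : vertex [seq (fintype.lift k x.1, x.2) | x <- l] j =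
    (fintype.lift k (vertex l j).1, (vertex l j).2).
  by rewrite /vertex (nth_map (ord0, false))// (leq_trans _ ml)// ltnS -ltnS.
apply/funext => t; rewrite /prism_simplex /=; congr H.
  by apply: eq_bigr => j _; rewrite vE.
congr s; rewrite faceE -[RHS]/((_ \o _) t) simplex_map_comp; congr simplex_map.
by apply/funext => j; rewrite vE.
Qed.

Definition realize n (s : simplex n -> X) m
    (c : {freeg (seq ('I_n.+1 * bool)) / int}) : chain R Y m :=
  fglift (fun l => << prism_simplex s (m := m) l >> : chain R Y m) c.

Definition prism n (c : chain R X n) : chain R Y n.+1 :=
  fglift (fun s : simplex n -> X =>
    realize s n.+1 (list_prism (enum 'I_n.+1))) c.

(** The length condition matches the [m.+2] faces of the simplex with the [m.+2] omissions in the
    list: a longer list would be truncated by the realization, a shorter one padded with the default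
    vertex. *)
Lemma realize_boundary n (s : simplex n -> X) m c :
  supported (fun l => size l = m.+2) c ->
  singular_boundary (realize s m.+1 c) = realize s m (list_boundary c).
Proof.
move: c; apply: freeg_additive_ext_in => [c d|c d|l sl].
- by rewrite /realize fgliftB singular_boundaryB.
- by rewrite list_boundaryB /realize fgliftB.
rewrite /realize fgliftU singular_boundaryU list_boundaryU list_faceE sl.
rewrite raddf_sum /=; apply: eq_bigr => k _.
by rewrite [RHS]fglift_mapU prism_simplex_face.
Qed.

Lemma omit_enum n (k : 'I_n.+2) :
  omit k (enum 'I_n.+2) = [seq fintype.lift k j | j <- enum 'I_n.+1].
Proof.
have kn : (k < size (enum 'I_n.+2))%N by rewrite size_enum_ord.
have sE : size (omit k (enum 'I_n.+2)) = n.+1 by rewrite size_omit// size_enum_ord.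
apply: (@eq_from_nth _ ord0); first by rewrite sE size_map size_enum_ord.
move=> j; rewrite sE => jn.
rewrite nth_omit [RHS](nth_map ord0) ?size_enum_ord//; apply: ord_inj => /=.
have bn : (bump k j < n.+2)%N.
  by apply: leq_ltn_trans (leq_add (leq_b1 _) (leqnn j)) _; rewrite add1n ltnS.
by rewrite (nth_enum_ord _ jn) (nth_enum_ord _ bn).
Qed.

(** On a generator this is the realization of [list_prism_boundary]: the two levels become the two
    ends of the homotopy, and naturality in the vertices turns the prism over an omitted vertex into
    the prism over a face. *)
Lemma prism_boundary n (c : chain R X n.+1) :
  singular_boundary (prism c) =
  push (H 1) c - push (H 0) c - prism (singular_boundary c).
Proof.
move: c; apply: freeg_additive_ext => [c d|c d|s].
- by rewrite /prism fgliftB singular_boundaryB.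
- rewrite !pushB singular_boundaryB /prism fgliftB.
  by rewrite [RHS]subr_ACA [X in _ = X - _]subr_ACA.
rewrite /prism fgliftU !pushU singular_boundaryU realize_boundary; last first.
  by have := @size_list_prism _ (enum 'I_n.+2); rewrite size_enum_ord.
rewrite list_prism_boundary /realize !fgliftB !fgliftU !prism_simplex_level.
congr (_ - _); rewrite list_faceE [size _]size_enum_ord /chain_prism.
rewrite !raddf_sum /=; apply: eq_bigr => k _.
(* The signs, which act as scalars, are rewritten as integer multiples, with which additive maps
   commute. *)
rewrite omit_enum /= !liftU -[X in fglift _ (X *: _)]intz -[X in _ = X *: _]intz !scaler_int raddfMz; congr (_ *~ _).
rewrite -[LHS]/(fglift _ _) list_prism_map.
have := @size_list_prism _ (enum 'I_n.+1); rewrite size_enum_ord.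
move: (list_prism _); apply: freeg_additive_ext_in => [c d|c d|l sl].
- by rewrite !fgliftB.
- by rewrite fgliftB.
by rewrite !fgliftU prism_simplex_lift// sl.
Qed.

(** The time coordinate is a sum of some of the barycentric weights, hence stays in [0, 1]. *)
Lemma supported_prism n (A : set X) (B : set Y) (c : chain R X n) :
  continuous (fun p : R * X => H p.1 p.2) ->
  (forall t x, 0 <= t <= 1 -> A x -> B (H t x)) ->
  singular_in A c -> singular_in B (prism c).
Proof.
move=> cH HAB; apply: supported_fglift => s [cs As].
apply: (supported_fglift (P := fun=> True)) => // l _.
apply: supportedU; split; last first.
  move=> t; apply: HAB => //; apply/andP; split.
    by apply: sumr_ge0 => j _; rewrite mulr_ge0 ?simplex_ge0.
  rewrite -[leRHS](simplex_sum t); apply: ler_sum => j _.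
  by rewrite ler_piMr ?simplex_ge0// lern1 leq_b1.
pose h (t : simplex n.+1) := (\sum_j \val t 0 j * (vertex l j).2%:R : R,
  s (simplex_map (fun j : 'I_n.+2 => (vertex l j).1) t)).
rewrite [prism_simplex s l](_ : _ = (fun p : R * X => H p.1 p.2) \o h)//.
apply: continuous_compose cH; apply: continuous_pair.
  apply: continuous_sum => j _.
  by apply: continuous_mul; [exact: continuous_coord|exact: continuous_cst].
by apply: continuous_compose cs; exact: simplex_map_continuous.
Qed.

End Prism.

(** A simplex is the realization, under the constant homotopy, of the list of its own vertices; the
    identity is thus inherited from [list_boundaryK]. *)
Lemma singular_boundaryK (R : realType) (X : topologicalType) n
    (c : chain R X n.+2) : singular_boundary (singular_boundary c) = 0.
Proof.
move: c; apply: freeg_additive_ext => [c d|c d|s].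
- by rewrite !singular_boundaryB.
- by rewrite subrr.
pose l := level false (enum 'I_n.+3); pose H (_ : R) (x : X) := x.
have sl : size l = n.+3 by rewrite size_map size_enum_ord.
have -> : << s >> = realize H s n.+2 << l >>.
  by rewrite /realize fgliftU prism_simplex_level.
rewrite realize_boundary; last exact: supportedU.
rewrite realize_boundary ?list_boundaryK; first exact: fglift0.
rewrite list_boundaryU list_faceE; apply: supported_sum => k _.
by apply: supportedU; rewrite size_omit ?ltn_ord// sl.
Qed.

(** * Orientation under isotopies and additive conjugations *)

Section Isotopy.
Variables (R : realType) (n : nat) (X : normedModType R) (H : R -> X -> X).
Hypotheses (H_cont : continuous (fun p : R * X => H p.1 p.2))
  (H_inj : forall t, 0 <= t <= 1 -> injective (H t)).

(* Prism operator for the homotopy y |-> H t y - H t x of maps of pairs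
   (X, X \ x) -> (X, X \ 0). *)
Lemma isotopy_chain (x : X) (c : chain R X n.+1) :
  singular_in [set y | y != 0 /\ y != x] (singular_boundary c) ->
  singular_in [set y | y != 0] c ->
  exists d : chain R X n.+2,
    singular_in setT d /\
    singular_in [set y | y != 0]
      (push (fun y => H 1 y - H 1 x) c - push (fun y => H 0 y - H 0 x) c
       - singular_boundary d).
Proof.
move=> bc cc; pose G t y := H t y - H t x.
have cG : continuous (fun p : R * X => G p.1 p.2).
  apply: continuous_sub; first exact: H_cont.
  apply: continuous_compose (continuous_pair _ _) H_cont.
    exact: continuous_fst.
  exact: continuous_cst.
exists (prism G c); split; first by apply: supported_prism cc => //.
rewrite prism_boundary subKr.
apply: supported_prism bc => // t y t01 [_ yx] /=.
by rewrite subr_eq0 (inj_eq (H_inj t01)).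
Qed.

Lemma isotopy_orientation_preserving :
  orientation_preserving n (H 0) -> orientation_preserving n (H 1).
Proof.
move=> H0 x c x0 cc bc; have [d [dT dE]] := H0 x c x0 cc bc.
have [d' [dT' dE']] := isotopy_chain bc cc.
exists (d + d'); split; first exact: supportedD.
have := supportedD dE dE'; congr singular_in.
rewrite raddfD /= opprD addrACA; congr (_ + _).
by rewrite addrC subrKA.
Qed.

End Isotopy.

Lemma orientation_preserving_id (R : realType) n (X : normedModType R) :
  orientation_preserving n (@id X).
Proof.
move=> x c x0 cc bc; exists 0; split; first exact: supported0.
by rewrite subrr raddf0 sub0r oppr0; exact: supported0.
Qed.

Lemma singular_in_push (R : realType) (X Y : topologicalType) (g : X -> Y)
    (A : set X) (B : set Y) n (c : chain R X n) :
  continuous g -> (forall x, A x -> B (g x)) ->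
  singular_in A c -> singular_in B (push g c).
Proof.
move=> cg gAB; apply: supported_fglift => s [cs As].
apply: supportedU; split => [|t]; last exact: gAB.
exact: continuous_compose cs cg.
Qed.

Lemma push_comp (R : realType) (X Y Z : topologicalType) (f : X -> Y)
    (g : Y -> Z) n (c : chain R X n) : push g (push f c) = push (g \o f) c.
Proof.
move: c; apply: freeg_additive_ext => [c d|c d|s]; rewrite ?pushB//.
by rewrite !pushU.
Qed.

(** The definition compares maps after translations, and an additive [A] carries translations to
    translations. The chain is pushed by [A], the hypothesis is used at [A x], and the chain it
    yields is pushed back by [B]. *)
Lemma orientation_preserving_conj (R : realType) n (X : normedModType R)
    (A B G : X -> X) : additive A -> additive B -> cancel B A -> cancel A B ->
  continuous A -> continuous B ->
  orientation_preserving n (A \o G \o B) -> orientation_preserving n G.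
Proof.
move=> Aadd Badd BK AK cA cB opG x c x0 cc bc.
have A0 y : (A y == 0) = (y == 0).
  have A00 : A 0 = 0 by have := Aadd 0 0; rewrite !subrr.
  by rewrite -[in LHS]A00 (can_eq AK).
have B0 y : (B y == 0) = (y == 0).
  have B00 : B 0 = 0 by have := Badd 0 0; rewrite !subrr.
  by rewrite -[in LHS]B00 (can_eq BK).
have [|||d [dT dE]] := opG (A x) (push A c).
- by rewrite A0.
- by apply: singular_in_push cc => // y; rewrite /= A0.
- rewrite -push_boundary; apply: singular_in_push bc => // y /=.
  by rewrite A0 (can_eq AK).
exists (push B d); split; first exact: singular_in_push dT.
have BdE : singular_in [set y | y != 0] (push B (push (fun y => (A \o G \o B) y -
    (A \o G \o B) (A x)) (push A c) - push (fun y => y - A x) (push A c)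
    - singular_boundary d)).
  by apply: singular_in_push dE => // y /=; rewrite B0.
move: BdE; rewrite !pushB push_boundary !push_comp.
set g1 := (X in push X c - _); set g2 := (X in _ - push X c).
rewrite (_ : g1 = fun y => G y - G x); last first.
  by apply/funext => y; rewrite /g1 /= Badd !AK.
by rewrite (_ : g2 = fun y => y - x)//; apply/funext => y; rewrite /g2 /= Badd !AK.
Qed.

(** * Winding numbers *)

Section Polar.
Variable R : realType.
Implicit Types (x y z : R2 R) (r a b : R).

Definition polar r a : R2 R := (r * cos a, r * sin a).

(** With [ccross], the real and imaginary parts of the product of y with the conjugate of x: the
    pair is a vector whose angle is that from x to y. *)
Definition cdot x y : R := x.1 * y.1 + x.2 * y.2.
Definition ccross x y : R := x.1 * y.2 - x.2 * y.1.

Lemma cdot_gt0 x : x != 0 -> 0 < cdot x x.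
Proof.
case: x => a b; rewrite /cdot /= -!expr2 => ab0.
rewrite lt_def paddr_eq0 ?sqr_ge0// !sqrf_eq0 addr_ge0 ?sqr_ge0// andbT.
by apply: contra ab0 => /andP[/eqP -> /eqP ->].
Qed.

Lemma polar_half_plane x : 0 < x.1 ->
  exists2 r, 0 < r & x = polar r (atan (x.2 / x.1)).
Proof.
case: x => a b /= a0; set t := b / a.
have c0 : 0 < cos (atan t).
  by apply: cos_gt0_pihalf; rewrite atan_gtNpi2 atan_ltpi2.
exists (a / cos (atan t)); first exact: divr_gt0.
rewrite /polar divfK ?gt_eqF//; congr pair.
have : tan (atan t) = t by exact: atanK.
rewrite /tan mulrAC -mulrA => ->.
by rewrite /t mulrCA divff ?mulr1 ?gt_eqF.
Qed.

Lemma polarDpi r a : polar r (a + pi) = - polar r a.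
Proof. by rewrite /polar sinDpi cosDpi !mulrN. Qed.

Lemma polar_surj x : x != 0 -> exists2 r, 0 < r & exists a, x = polar r a.
Proof.
case: x => a b ab0; have [a0|a0|a0] := ltgtP a 0.
- have [|r r0 e] := @polar_half_plane (- (a, b)); first by rewrite /= oppr_gt0.
  by exists r => //; eexists; rewrite -[LHS]opprK e -polarDpi.
- by have [|r r0 e] := @polar_half_plane (a, b) => //; exists r => //; eexists; exact: e.
- have b0 : b != 0 by apply: contraNneq ab0 => ->; rewrite a0.
  exists `|b|; first by rewrite normr_gt0.
  exists (Num.sg b * (pi / 2)); rewrite /polar cos_sg// sin_sg cos_pihalf sin_pihalf.
  by rewrite mulr0 mulr1 a0 mulrC -numEsg.
Qed.

Lemma cdot_polar r a : cdot (polar r a) (polar r a) = r ^+ 2.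
Proof.
rewrite /cdot /polar /= -[RHS]mulr1 -(cos2Dsin2 a); ring.
Qed.

Lemma polar_inj r s a b : 0 < r -> 0 < s -> polar r a = polar s b ->
  r = s /\ cos a = cos b /\ sin a = sin b.
Proof.
move=> r0 s0 e; have rs : r = s.
  apply/eqP; rewrite -(@eqrXn2 _ 2) ?ltW//.
  by rewrite -(cdot_polar r a) -(cdot_polar s b) e.
split=> //; move: e; rewrite rs => -[e1 e2].
by split; apply: (mulfI (lt0r_neq0 s0)).
Qed.

Lemma cos_lt1 a : 0 < a < pi *+ 2 -> cos a < 1.
Proof.
move=> /andP[a0 a2]; rewrite [a](splitr a) -mulr2n cos_mulr2n.
have : 0 < sin (a / 2).
  by apply: sin_gt0_pi; rewrite divr_gt0//= ltr_pdivrMr// mulr_natr.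
move=> s0; rewrite cos2sin2; have : 0 < sin (a / 2) ^+ 2 by rewrite exprn_gt0.
lra.
Qed.

End Polar.

Section Lifts.
Variable R : realType.

Lemma continuous_cdot (T : topologicalType) (f g : T -> R2 R) :
  continuous f -> continuous g -> continuous (fun t => cdot (f t) (g t)).
Proof.
move=> cf cg; apply: continuous_add; apply: continuous_mul.
- exact: (continuous_compose cf (@continuous_fst _ _)).
- exact: (continuous_compose cg (@continuous_fst _ _)).
- exact: (continuous_compose cf (@continuous_snd _ _)).
- exact: (continuous_compose cg (@continuous_snd _ _)).
Qed.

Lemma continuous_ccross (T : topologicalType) (f g : T -> R2 R) :
  continuous f -> continuous g -> continuous (fun t => ccross (f t) (g t)).
Proof.
move=> cf cg; apply: continuous_sub; apply: continuous_mul.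
- exact: (continuous_compose cf (@continuous_fst _ _)).
- exact: (continuous_compose cg (@continuous_snd _ _)).
- exact: (continuous_compose cf (@continuous_snd _ _)).
- exact: (continuous_compose cg (@continuous_fst _ _)).
Qed.

Definition angle_lift (T : topologicalType) (g : T -> R2 R) (L : T -> R) :=
  continuous L /\ forall t, exists2 r, 0 < r & g t = polar r (L t).

Lemma angle_lift_half_plane (T : topologicalType) (g : T -> R2 R) :
  continuous g -> (forall t, 0 < (g t).1) ->
  angle_lift g (fun t => atan ((g t).2 / (g t).1)).
Proof.
move=> cg g0; split => [t|t]; last exact: polar_half_plane.
apply: continuous_comp; last exact: continuous_atan.
apply: cvgM.
  exact: (continuous_compose cg (@continuous_snd _ _)).
apply: cvgV; first by rewrite gt_eqF.
exact: (continuous_compose cg (@continuous_fst _ _)).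
Qed.

(** Here [q] is the product of [g'] with the conjugate of [g], so its angle is the increment from
    [g] to [g']. *)
Lemma angle_lift_mul (T : topologicalType) (g g' q : T -> R2 R) L L' :
  angle_lift g L -> angle_lift q L' ->
  (forall t, q t = (cdot (g t) (g' t), ccross (g t) (g' t))) ->
  angle_lift g' (fun t => L t + L' t).
Proof.
move=> [cL gL] [cL' qL'] qE; split; first exact: continuous_add.
move=> t; have [r r0 gE] := gL t; have [s s0] := qL' t.
rewrite qE gE /cdot /ccross; case: (g' t) => x y /= [e1 e2].
exists (s / r); first exact: divr_gt0.
have r0' := lt0r_neq0 r0; have c2 := cos2Dsin2 (L t).
have xE : r * x = s * (cos (L t) * cos (L' t) - sin (L t) * sin (L' t)).
  transitivity (cos (L t) * (r * cos (L t) * x + r * sin (L t) * y)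
    - sin (L t) * (r * cos (L t) * y - r * sin (L t) * x)); last by rewrite e1 e2; ring.
  by transitivity (r * x * (cos (L t) ^+ 2 + sin (L t) ^+ 2)); [rewrite c2 mulr1|ring].
have yE : r * y = s * (sin (L t) * cos (L' t) + cos (L t) * sin (L' t)).
  transitivity (sin (L t) * (r * cos (L t) * x + r * sin (L t) * y)
    + cos (L t) * (r * cos (L t) * y - r * sin (L t) * x)); last by rewrite e1 e2; ring.
  by transitivity (r * y * (cos (L t) ^+ 2 + sin (L t) ^+ 2)); [rewrite c2 mulr1|ring].
by rewrite /polar cosD sinD; congr pair; apply: (mulfI r0'); rewrite ?xE ?yE; field.
Qed.

(** The contraction [h] deforms [g] to a constant. By compactness one time step turns every value by
    less than a right angle, and [atan] then lifts each increment; the lift is carried from time 0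
    to time 1 by finitely many such steps. *)
Lemma angle_lift_exists (T : topologicalType) (h : R * T -> T) (t0 : T)
    (g : T -> R2 R) :
  compact [set: T] -> continuous h ->
  (forall t, h (0, t) = t0) -> (forall t, h (1, t) = t) ->
  continuous g -> (forall t, g t != 0) -> exists L, angle_lift g L.
Proof.
move=> Tc hc h0 h1 gc gN0.
pose phi s t := g (h (s, t)).
have phic : continuous (fun p => phi p.1 p.2).
  rewrite (_ : (fun p => _) = g \o h); last by apply/funext => -[].
  exact (continuous_compose hc gc).
have Kc : compact (`[0, 1]%classic `*` [set: T] : set (R * T)).
  by apply: compact_setX => //; exact: segment_compact.
(* A positive scalar product means that the angle moves by less than pi / 2 between the two
   times. *)
pose P (e : R) (p : R * T) := 0 < cdot (phi p.1 p.2) (phi (p.1 + e) p.2).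
have : \forall e \near (0 : R), `[0, 1]%classic `*` setT `<=` P e.
  apply: (((compact_near_coveringP _).1 Kc) _ (nbhs (0 : R)) P) => p _.
  pose Q (q : (R * T) * R) := cdot (phi q.1.1 q.1.2) (phi (q.1.1 + q.2) q.1.2).
  have c1 : continuous (fun q : (R * T) * R => q.1.1).
    exact: (continuous_compose (@continuous_fst _ _) (@continuous_fst _ _)).
  have c2 : continuous (fun q : (R * T) * R => q.1.2).
    exact: (continuous_compose (@continuous_fst _ _) (@continuous_snd _ _)).
  have Qc : continuous Q.
    apply: continuous_cdot.
      exact: (continuous_compose (continuous_pair c1 c2) phic).
    apply: (continuous_compose (continuous_pair _ c2) phic).
    by apply: continuous_add => //; exact: continuous_snd.
  have Q0 : 0 < Q (p, 0) by rewrite /Q addr0; apply: cdot_gt0; exact: gN0.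
  have := Qc (p, 0) _ (lt_nbhsr Q0).
  by rewrite /nbhs /= /filter_prod /=.
move=> /nbhs_ballP[e /= e0 eP].
(* Chosen so that the step 1 / N is smaller than the uniform radius [e]. *)
pose N := (Num.truncn e^-1).+1.
have NE : `|N%:R^-1| < e.
  rewrite ger0_norm ?invr_ge0// invf_plt ?posrE//.
  exact: truncnS_gt.
have phiP k t : (k <= N)%N -> 0 < cdot (phi (k%:R / N%:R) t) (phi (k.+1%:R / N%:R) t).
  move=> kN; have := eP N%:R^-1; rewrite /ball /= sub0r normrN => /(_ NE (k%:R / N%:R, t)).
  rewrite /P /= -[X in _ + X]mul1r -mulrDl natr1; apply; split => //=.
  by rewrite in_itv /= divr_ge0//= ler_pdivrMr// mul1r ler_nat.
have lift k : (k <= N)%N -> exists L, angle_lift (phi (k%:R / N%:R)) L.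
  elim: k => [_|k IH kN].
    have [r r0 [a ga]] := polar_surj (gN0 t0).
    exists (fun=> a); split => [|t]; first exact: continuous_cst.
    by exists r => //; rewrite /phi mul0r h0.
  have [|L gL] := IH; first exact: ltnW.
  pose q t := (cdot (phi (k%:R / N%:R) t) (phi (k.+1%:R / N%:R) t),
    ccross (phi (k%:R / N%:R) t) (phi (k.+1%:R / N%:R) t)).
  have phik s : continuous (phi s).
    apply: (continuous_compose (continuous_pair _ _) phic).
      exact: continuous_cst.
    by move=> ?; exact: cvg_id.
  have qc : continuous q.
    exact (continuous_pair (continuous_cdot (phik _) (phik _))
      (continuous_ccross (phik _) (phik _))).
  have q0 t : 0 < (q t).1 by exact: (phiP k t (ltnW kN)).
  exists (fun t => L t + atan ((q t).2 / (q t).1)).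
  exact (angle_lift_mul (g' := phi (k.+1%:R / N%:R)) gL
    (angle_lift_half_plane qc q0) (fun=> erefl)).
have [L] := lift N (leqnn N); rewrite divff ?pnatr_eq0// => L1; exists L.
by rewrite (_ : g = phi 1)//; apply/funext => t; rewrite /phi h1.
Qed.

(** Two lifts differ by a continuous function whose cosine is constantly 1. If its values at 0 and 1
    were distinct, it would take an intermediate value lying strictly between 0 and 2 pi above
    another of its values. *)
Lemma angle_lift_path_uniq (g : R -> R2 R) (L L' : R -> R) :
  angle_lift g L -> angle_lift g L' -> L 1 - L 0 = L' 1 - L' 0.
Proof.
move=> [cL gL] [cL' gL'].
pose D t := L t - L' t.
have cD : continuous D by exact: continuous_sub.
have cosD t : cos (D t) = 1.
  have [r r0 e] := gL t; have [r' r'0 e'] := gL' t.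
  have [_ [c s]] : r = r' /\ cos (L t) = cos (L' t) /\ sin (L t) = sin (L' t).
    by apply: polar_inj => //; rewrite -e e'.
  by rewrite /D cosB c s -!expr2 cos2Dsin2.
have sinD t : sin (D t) = 0 by apply: cos1sin0; rewrite cosD normr1.
suff : D 0 = D 1.
  rewrite /D => e; have -> : L 1 = D 1 + L' 1 by rewrite /D subrK.
  by rewrite -[D 1]/(L 1 - L' 1) -e; ring.
apply/eqP/negPn/negP => D01.
pose a := Num.min (D 0) (D 1); pose b := Num.max (D 0) (D 1).
have ab : a < b.
  by rewrite /a /b; have [//|//|h] := ltgtP (D 0) (D 1); rewrite h eqxx in D01.
have [t0 at0] : exists t0, D t0 = a.
  by rewrite /a; case: leP => _; [exists 0|exists 1].
(* The cap by pi keeps [v] in the interval from [a] to [b] and at a distance from [a] strictly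
   between 0 and 2 pi, where [cos_lt1] applies. *)
pose v := a + Num.min (b - a) pi.
have m0 : 0 < Num.min (b - a) (pi : R) by rewrite lt_min subr_gt0 ab pi_gt0.
have [||t _ Dt] := @IVT R D 0 1 v ler01.
- by apply: continuous_subspaceT => x; exact: cD.
- apply/andP; split; first by rewrite -/a lerDl ltW.
  by rewrite -/b /v -lerBrDl ge_min lexx.
have : cos (D t - D t0) < 1.
  apply: cos_lt1; rewrite Dt at0 /v [a + _]addrC addrK m0/=.
  by rewrite gt_min [pi *+ 2]mulr2n [pi < _]ltrDl pi_gt0 orbT.
by rewrite cosB !cosD !sinD mulr0 addr0 mulr1 ltxx.
Qed.

End Lifts.

(** * Compactness and contractibility of the standard simplex *)

Section SimplexTopology.
Variable R : realType.
Local Notation simplex n := (std_simplex R n).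

Lemma vertex_subproof n (i : 'I_n.+1) :
  (delta_mx 0 i : 'rV[R]_n.+1) \in simplex n.
Proof.
apply/mem_set; split => [j|]; first by rewrite mxE eqxx /= ler0n.
rewrite (bigD1 i)//= mxE !eqxx big1 ?addr0// => j ji.
by rewrite mxE eqxx (negbTE ji).
Qed.

Definition simplex_vertex n (i : 'I_n.+1) : simplex n :=
  exist _ (delta_mx 0 i) (vertex_subproof i).

Lemma face_vertex n (k : 'I_n.+2) (i : 'I_n.+1) :
  face k (simplex_vertex i) = simplex_vertex (fintype.lift k i).
Proof.
rewrite faceE; apply/val_inj/rowP => j; rewrite !mxE /=.
rewrite (eq_bigr (fun l => (l == i)%:R)); last by move=> l _; rewrite mxE eqxx.
have [->|ji] := eqVneq j (fintype.lift k i).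
  rewrite (bigD1 i)//= eqxx big1 ?addr0// => l /andP[_ /negbTE ->] //.
rewrite big1// => l /eqP lj; case: eqP => // li.
by rewrite -lj li eqxx in ji.
Qed.

(** [angle_lift_exists] expects a contraction parametrized by all real times; clamping the time
    keeps the convex combination inside the simplex. *)
Definition clamp (s : R) : R := Num.min 1 (Num.max 0 s).

Lemma clamp_itv s : 0 <= clamp s <= 1.
Proof.
by rewrite /clamp le_min ler01 le_max lexx ge_min lexx.
Qed.

Lemma clamp_continuous : continuous clamp.
Proof.
move=> s; apply: (@continuous_min R R (fun=> 1) (fun s => Num.max 0 s)).
  exact: cvg_cst.
by apply: (@continuous_max R R (fun=> 0) id); [exact: cvg_cst|exact: cvg_id].
Qed.

Lemma simplex_cone_subproof n (p : R * simplex n) :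
  (1 - clamp p.1) *: (delta_mx 0 0 : 'rV[R]_n.+1) + clamp p.1 *: \val p.2 \in simplex n.
Proof.
have /andP[c0 c1] := clamp_itv p.1.
apply/mem_set; split => [j|].
  by rewrite !mxE eqxx /= addr_ge0// mulr_ge0 ?subr_ge0 ?ler0n ?simplex_ge0.
rewrite (eq_bigr (fun j => (1 - clamp p.1) * \val (simplex_vertex ord0 : simplex n) 0 j
  + clamp p.1 * \val p.2 0 j)); last by move=> j _; rewrite !mxE.
by rewrite big_split /= -!mulr_sumr simplex_sum [X in _ * X](simplex_sum (simplex_vertex ord0)) !mulr1 subrK.
Qed.

Definition simplex_cone n (p : R * simplex n) : simplex n :=
  exist _ ((1 - clamp p.1) *: (delta_mx 0 0 : 'rV[R]_n.+1) + clamp p.1 *: \val p.2)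
    (simplex_cone_subproof p).

Lemma simplex_cone0 n (t : simplex n) : simplex_cone (0, t) = simplex_vertex ord0.
Proof.
apply/val_inj => /=.
by rewrite /clamp maxxx min_r ?ler01// subr0 scale1r scale0r addr0.
Qed.

Lemma simplex_cone1 n (t : simplex n) : simplex_cone (1, t) = t.
Proof.
apply/val_inj => /=.
by rewrite /clamp max_r ?ler01// minxx subrr scale1r scale0r add0r.
Qed.

Lemma simplex_cone_continuous n : continuous (@simplex_cone n).
Proof.
apply: continuous_val => /=.
have c1 : continuous (fun p : R * simplex n => clamp p.1).
  exact (continuous_compose (@continuous_fst _ _) clamp_continuous).
apply: continuous_add; apply: continuous_scale => //.
- by apply: continuous_sub => //; exact: continuous_cst.
- exact: continuous_cst.
- exact (continuous_compose (@continuous_snd _ _) (@val_continuous _ _)).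
Qed.

Lemma simplex_compact n : compact [set: simplex n].
Proof.
have cA : compact (simplex n : set 'rV[R]_n.+1).
  apply: bounded_closed_compact.
    exists 1; split => // x x1 t [t0 t1]; rewrite /= [X in X <= _]/Num.norm /= mx_normrE.
    have x0 : 0 <= x by rewrite (le_trans ler01)// ltW.
    apply/bigmax_leP; split => // -[i j] _ /=; rewrite ord1 ger0_norm//.
    apply: le_trans (ltW x1); rewrite -t1 (bigD1 j)//= lerDl.
    by apply: sumr_ge0 => l _.
  rewrite (_ : simplex n = (\bigcap_(j in [set: 'I_n.+1])
      ((fun t : 'rV[R]_n.+1 => t 0 j) @^-1` [set x | 0 <= x])) `&`
      ((fun t : 'rV[R]_n.+1 => \sum_j t 0 j) @^-1` [set x | x = 1])).
    apply: closedI.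
      apply: closed_bigI => j _.
      apply: (iffLR (continuous_closedP (fun t : 'rV[R]_n.+1 => t 0 j : R)) _
        [set x : R | 0 <= x]); [exact: coord_continuous|exact: closed_ge].
    apply: (iffLR (continuous_closedP (fun t : 'rV[R]_n.+1 => \sum_j t 0 j : R)) _
        [set x : R | x = 1]); last exact: closed_eq.
    by apply: continuous_sum => j _; exact: coord_continuous.
  by apply/seteqP; split => t [t0 t1]; split => // j; [move=> _|]; exact: t0.
(* A left inverse of [\val], continuous within the simplex: it transports compactness from the
   subset of row vectors to the subtype. *)
pose f (x : 'rV[R]_n.+1) : simplex n := insubd (simplex_vertex ord0) x.
have fK : f \o \val = id.
  by apply/funext => t; rewrite /f /= valKd.
have := continuous_compact _ cA.
have cf : {within simplex n, continuous f}.
  apply/subspace_sigL_continuousP; rewrite (_ : sigL _ f = id); last by [].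
  by move=> t; exact: cvg_id.
move=> /(_ _ _ cf); congr compact; apply/seteqP; split => // t _.
by exists (\val t); [case: t => t /= /set_mem|rewrite -[LHS]/((f \o \val) t) fK].
Qed.

End SimplexTopology.

(** * The winding cocycle and reversal of orientation *)

Section Winding.
Variable R : realType.
Local Notation simplex n := (std_simplex R n).

Lemma simplex_angle_lift n (s : simplex n -> R2 R) :
  continuous s -> (forall t, s t != 0) -> exists L, angle_lift s L.
Proof.
apply: (@angle_lift_exists R _ (@simplex_cone R n) (simplex_vertex R ord0)).
- exact: simplex_compact.
- exact: simplex_cone_continuous.
- exact: simplex_cone0.
- exact: simplex_cone1.
Qed.

Lemma angle_lift_comp (T U : topologicalType) (f : T -> U) (g : U -> R2 R) L :
  continuous f -> angle_lift g L -> angle_lift (g \o f) (L \o f).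
Proof.
move=> cf [cL gL]; split=> [|t]; last exact: gL.
exact (continuous_compose cf cL).
Qed.

(** The total change of angle, not divided by 2 pi and defined for paths that need not close up, so
    that it extends additively to all 1-chains. The zero function is only a default for simplices
    without a lift. *)
Definition winding (s : simplex 1 -> R2 R) : R :=
  let L := xget (fun=> 0) [set L | angle_lift s L] in
  L (simplex_vertex R ord_max) - L (simplex_vertex R ord0).

Lemma windingE (s : simplex 1 -> R2 R) L : angle_lift s L ->
  winding s = L (simplex_vertex R ord_max) - L (simplex_vertex R ord0).
Proof.
move=> sL; rewrite /winding; case: xgetP => [L' _ sL'|/(_ L)//].
(* The edge from vertex 0 to vertex 1, traversed in unit time, reduces the claim to uniqueness along
   a path. *)
pose p t : simplex 1 := simplex_cone (t, simplex_vertex R ord_max).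
have cp : continuous p.
  apply: (continuous_compose (continuous_pair _ _) (@simplex_cone_continuous R 1)).
    by move=> ?; exact: cvg_id.
  exact: continuous_cst.
have := angle_lift_path_uniq (angle_lift_comp cp sL') (angle_lift_comp cp sL).
by rewrite /= /p !simplex_cone0 !simplex_cone1.
Qed.

(** [zmodule R] is the group [R] seen as a module over [int], as [fglift] requires of its target. *)
Definition chain_winding (c : chain R (R2 R) 1) : zmodule R :=
  fglift (fun s => winding s : zmodule R) c.

Lemma chain_windingB : zmod_morphism chain_winding.
Proof. exact: fgliftB. Qed.

Lemma chain_winding_boundaryU (s : simplex 2 -> R2 R) :
  chain_winding (singular_boundary << s >>) =
  winding (s \o face (Ordinal (isT : 0 < 3)%N)) -
  winding (s \o face (Ordinal (isT : 1 < 3)%N)) +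
  winding (s \o face (Ordinal (isT : 2 < 3)%N)).
Proof.
rewrite singular_boundaryU /chain_winding raddf_sum !big_ord_recl big_ord0 addr0 /= !liftU.
have -> : ord0 = Ordinal (isT : 0 < 3)%N by exact: ord_inj.
have -> : fintype.lift (Ordinal (isT : 0 < 3)%N) ord0 = Ordinal (isT : 1 < 3)%N.
  exact: ord_inj.
have -> : fintype.lift (Ordinal (isT : 0 < 3)%N) (fintype.lift ord0 ord0) =
    Ordinal (isT : 2 < 3)%N by exact: ord_inj.
by rewrite /bump /= expr0 expr1 expr2 mulrNN mulr1 !scale1r scaleN1r addrA.
Qed.

(** A 2-simplex in the punctured plane has a global angle lift, from which all three edges are
    measured; the alternating sum telescopes. *)
Lemma chain_winding_boundary (c : chain R (R2 R) 2) :
  singular_in [set y : R2 R | y != 0] c -> chain_winding (singular_boundary c) = 0.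
Proof.
move: c; apply: (freeg_additive_ext_in (g := fun=> 0 : zmodule R)).
- by move=> c d; rewrite singular_boundaryB chain_windingB.
- by move=> c d; rewrite subr0.
move=> s [cs s0]; rewrite chain_winding_boundaryU.
have [L sL] := simplex_angle_lift cs s0.
rewrite !(windingE (angle_lift_comp (@face_continuous R 1 _) sL)) /= !face_vertex.
pose v i := L (simplex_vertex R (inord i)).
have E (k : 'I_3) (i : 'I_2) l : (bump k i = l)%N ->
    L (simplex_vertex R (fintype.lift k i)) = v l.
  move=> e; rewrite /v; congr (L (simplex_vertex R _)); apply: ord_inj.
  by rewrite -e inordK//; exact: (ltn_ord (fintype.lift k i)).
rewrite (E (Ordinal (isT : 0 < 3)%N) ord0 1%N)// (E (Ordinal (isT : 0 < 3)%N) ord_max 2%N)//.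
rewrite (E (Ordinal (isT : 1 < 3)%N) ord0 0%N)// (E (Ordinal (isT : 1 < 3)%N) ord_max 2%N)//.
rewrite (E (Ordinal (isT : 2 < 3)%N) ord0 0%N)// (E (Ordinal (isT : 2 < 3)%N) ord_max 1%N)//.
by ring.
Qed.

(** A 2-simplex of the plane whose boundary winds once around 0. The edge [t_0 = 0] runs along the
    unit circle by the double angle formulas, the edge [t_1 = 0] is constant at (1, 0), and the edge
    [t_2 = 0] goes up and back on the line of abscissa 1, without net winding. *)
Definition loop_disc (t : simplex 2) : R2 R :=
  (1 - 2 * sin (pi * \val t 0 (inord 1)) * sin (pi * \val t 0 (inord 2)),
   2 * sin (pi * \val t 0 (inord 1)) * cos (pi * \val t 0 (inord 2))).

Lemma loop_disc_continuous : continuous loop_disc.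
Proof.
have cs i : continuous (fun t : simplex 2 => sin (pi * \val t 0 i)).
  apply: (continuous_compose _ (@continuous_sin R)).
  by apply: continuous_mul; [exact: continuous_cst|exact: continuous_coord].
have cc i : continuous (fun t : simplex 2 => cos (pi * \val t 0 i)).
  apply: (continuous_compose _ (@continuous_cos R)).
  by apply: continuous_mul; [exact: continuous_cst|exact: continuous_coord].
have c2 i : continuous (fun t : simplex 2 => 2 * sin (pi * \val t 0 i) : R).
  by apply: continuous_mul => //; exact: continuous_cst.
apply: continuous_pair; last exact: continuous_mul.
by apply: continuous_sub; [exact: continuous_cst|exact: continuous_mul].
Qed.

(** A crude bound, enough for the translate by (10, 0) to miss the origin. *)
Lemma loop_disc_gtN10 t : - 10 < (loop_disc t).1.
Proof.
rewrite /loop_disc /=.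
set a := sin _; set b := sin _.
have : `|a * b| <= 1 by rewrite normrM mulr_ile1// sin_max.
rewrite ler_norml => /andP[_ ab]; have := ab; lra.
Qed.

Let k0 : 'I_3 := Ordinal (isT : 0 < 3)%N.
Let k1 : 'I_3 := Ordinal (isT : 1 < 3)%N.
Let k2 : 'I_3 := Ordinal (isT : 2 < 3)%N.

Lemma face_coord (k : 'I_3) (i : 'I_2) (j : 'I_3) (t : simplex 1) :
  bump k i = j -> \val (face k t) 0 j = \val t 0 i.
Proof.
move=> e; have -> : j = fintype.lift k i by exact: ord_inj.
by rewrite mxE liftK.
Qed.

Lemma face_coord0 (k : 'I_3) (t : simplex 1) : \val (face k t) 0 k = 0.
Proof. by rewrite mxE unlift_none. Qed.

Lemma simplex1_sum (t : simplex 1) : \val t 0 ord0 = 1 - \val t 0 ord_max.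
Proof.
have := simplex_sum t; rewrite !big_ord_recl big_ord0 addr0.
by rewrite (_ : fintype.lift _ _ = ord_max); [move=> <-; rewrite addrK|exact: ord_inj].
Qed.

Lemma loop_disc_lift0 :
  angle_lift (loop_disc \o face k0) (fun t => 2 * pi * \val t 0 ord_max).
Proof.
split=> [|t].
  by apply: continuous_mul; [exact: continuous_cst|exact: continuous_coord].
exists 1 => //; rewrite /loop_disc /= (@face_coord k0 ord0) ?inordK//.
rewrite (@face_coord k0 ord_max) ?inordK// simplex1_sum.
set u := \val t 0 _; rewrite mulrBr mulr1.
have -> : sin (pi - pi * u) = sin (pi * u) by rewrite sinB sinpi cospi; ring.
have -> : 2 * pi * u = pi * u + pi * u by ring.
rewrite /polar cosD sinD -!expr2 cos2sin2; congr pair; ring.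
Qed.

Lemma loop_disc_edge1 t : (loop_disc \o face k1) t = (1, 0).
Proof.
rewrite /loop_disc /= (_ : inord 1 = k1); last by apply: ord_inj; rewrite inordK.
by rewrite face_coord0 mulr0 sin0 mulr0 !mul0r subr0.
Qed.

Lemma loop_disc_edge2 t :
  (loop_disc \o face k2) t = (1, 2 * sin (pi * \val t 0 ord_max)).
Proof.
rewrite /loop_disc /= (@face_coord k2 ord_max) ?inordK//.
rewrite (_ : inord 2 = k2); last by apply: ord_inj; rewrite inordK.
by rewrite face_coord0 mulr0 sin0 mulr0 cos0 mulr1 subr0.
Qed.

Lemma loop_disc_face_continuous k : continuous (loop_disc \o face k).
Proof. exact (continuous_compose (@face_continuous R 1 k) loop_disc_continuous). Qed.

Lemma loop_disc_lift k : exists L, angle_lift (loop_disc \o face k) L.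
Proof.
have : k = k0 \/ k = k1 \/ k = k2.
  by case: k => -[|[|[|//]]] p; [left|right; left|right; right]; exact: ord_inj.
case=> [->|[->|->]]; first by eexists; exact: loop_disc_lift0.
  eexists; apply: angle_lift_half_plane (@loop_disc_face_continuous k1) _ => t.
  by rewrite loop_disc_edge1.
eexists; apply: angle_lift_half_plane (@loop_disc_face_continuous k2) _ => t.
by rewrite loop_disc_edge2.
Qed.

Lemma loop_disc_winding :
  chain_winding (singular_boundary << loop_disc >>) = 2 * pi :> R.
Proof.
rewrite chain_winding_boundaryU.
have v1 i : \val (simplex_vertex R (ord_max : 'I_2)) 0 i = (i == ord_max)%:R.
  by rewrite mxE.
have v0 i : \val (simplex_vertex R (ord0 : 'I_2)) 0 i = (i == ord0)%:R.
  by rewrite mxE.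
rewrite -/k0 -/k1 -/k2 (windingE loop_disc_lift0).
rewrite (windingE (angle_lift_half_plane (@loop_disc_face_continuous k1) _)); last first.
  by move=> t; rewrite loop_disc_edge1.
rewrite (windingE (angle_lift_half_plane (@loop_disc_face_continuous k2) _)); last first.
  by move=> t; rewrite loop_disc_edge2.
rewrite !loop_disc_edge1 !loop_disc_edge2 /= !v1 !v0 /= ?eqxx !mulr1 !mulr0 sinpi sin0.
by rewrite !subrr !subr0 addr0.
Qed.

Lemma singular_in_boundary_loop (g : R2 R -> R2 R) (A : set (R2 R)) :
  continuous g -> (forall k t, A (g (loop_disc (face k t)))) ->
  singular_in A (singular_boundary << g \o loop_disc >>).
Proof.
move=> cg gA; rewrite singular_boundaryU; apply: supported_sum => k _.
apply: supportedU; split => [|t]; last exact: gA.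
exact (continuous_compose (@loop_disc_face_continuous k) cg).
Qed.

Lemma polar_neq0 r (a : R) : 0 < r -> polar r a != 0.
Proof.
move=> r0; apply/eqP => e; have := cdot_polar r a; rewrite e /cdot !mulr0 addr0.
by move=> /esym/eqP; rewrite sqrf_eq0 gt_eqF.
Qed.

Lemma loop_disc_face_neq0 k t : loop_disc (face k t) != 0.
Proof.
have [L [_ /(_ t)[r r0 /= ->]]] := loop_disc_lift k; exact: polar_neq0.
Qed.

(** Preservation of orientation would make the image by [G] of the boundary of [loop_disc]
    homologous to that boundary in the punctured plane. The hypothesis on polar coordinates replaces
    a lift [L] by [a - L], so the windings are -2 pi and 2 pi. *)
Lemma reversing_not_orientation_preserving (G : R2 R -> R2 R) (a : R) :
  zmod_morphism G -> continuous G -> (forall y, (G y == 0) = (y == 0)) ->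
  (forall r b, G (polar r b) = polar r (a - b)) ->
  ~ orientation_preserving 1 G.
Proof.
move=> GB cG G0 Gpolar opG.
(* The definition tests chains of the punctured space around a nonzero point, so [loop_disc] is
   moved to surround [x] while avoiding 0. Additivity of [G] removes this translation afterwards. *)
pose x : R2 R := (10, 0).
have cx : continuous (fun y : R2 R => y + x).
  by apply: continuous_add; [move=> ?; exact: cvg_id|exact: continuous_cst].
have [||| d [_ dE]] := opG x << (fun y => y + x) \o loop_disc >>.
- by apply/eqP => -[/eqP]; rewrite pnatr_eq0.
- apply: supportedU; split => [|t].
    exact (continuous_compose loop_disc_continuous cx).
  apply/eqP => -[]; have := loop_disc_gtN10 t; rewrite /= => + h _; rewrite -subr_gt0.
  by rewrite opprK h ltxx.
- apply: singular_in_boundary_loop => // k t; split; last first.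
    rewrite -subr_eq0 addrK; exact: loop_disc_face_neq0.
  apply/eqP => -[]; have := loop_disc_gtN10 (face k t); rewrite /= => + h _; rewrite -subr_gt0.
  by rewrite opprK h ltxx.
have := chain_winding_boundary dE.
rewrite !singular_boundaryB singular_boundaryK subr0 !pushU chain_windingB.
set g1 := (X in chain_winding (singular_boundary << X >>) - _).
set g2 := (X in _ - chain_winding (singular_boundary << X >>)).
have -> : g1 = G \o loop_disc.
  by apply/funext => t; rewrite /g1 /= -GB addrK.
have -> : g2 = loop_disc by apply/funext => t; rewrite /g2 /= addrK.
have w k : winding (G \o loop_disc \o face k) = - winding (loop_disc \o face k).
  have [L lL] := loop_disc_lift k; rewrite (windingE lL).
  rewrite (windingE (L := fun t => a - L t)); first by ring.
  case: lL => cL eL; split => [|t].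
    by apply: continuous_sub => //; exact: continuous_cst.
  by have [r r0 e] := eL t; exists r => //; rewrite -Gpolar -e.
have := loop_disc_winding; rewrite !chain_winding_boundaryU !w.
set A := winding _; set B := winding _; set C := winding _ => e e'.
have p0 := pi_gt0 R.
have {}e' : - A - - B + - C - (A - B + C) = 0 by exact: e'.
move: p0; suff -> : (pi : R) = 0 by rewrite ltxx.
lra.
Qed.

End Winding.

Local Open Scope quotient_scope.

(** * Quotients by contractions *)

Definition quotient_map (X Y : topologicalType) (p : X -> Y) :=
  (forall y, exists x, p x = y) /\
  (forall O : set Y, open (p @^-1` O) <-> open O).

Section QuotientMap.
Variables X Y Z : topologicalType.

Lemma quotient_map_continuous (p : X -> Y) : quotient_map p -> continuous p.
Proof. by move=> [_ pO]; apply/continuousP => O /pO. Qed.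

Lemma open_quotient_map (p : X -> Y) : continuous p ->
  (forall y, exists x, p x = y) ->
  (forall x N, nbhs x N -> nbhs (p x) (p @` N)) -> quotient_map p.
Proof.
move=> cp sp op; split=> // O; split; last by move: cp => /continuousP; apply.
move=> oO; rewrite openE => y Oy; have [x xy] := sp y.
have := op x _ (open_nbhs_nbhs (conj oO _)); rewrite /= xy => /(_ Oy).
by apply: filterS => _ [u Ou <-].
Qed.

Lemma quotient_map_comp (p : X -> Y) (q : Y -> Z) :
  quotient_map p -> quotient_map q -> quotient_map (q \o p).
Proof.
move=> [sp op] [sq oq]; split => [z|O]; last by rewrite -oq -op.
by have [y <-] := sq z; have [x <-] := sp y; exists x.
Qed.

Lemma homeomorphism_quotient_map (h : X -> Y) : homeomorphism h -> quotient_map h.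
Proof.
move=> [ch [g [cg hK gK]]]; split => [y|O]; first by exists (g y); rewrite gK.
split; last by move: ch => /continuousP; apply.
move=> oO; suff -> : O = g @^-1` (h @^-1` O) by move: cg => /continuousP; apply.
by apply/funext => y; rewrite /preimage /= gK.
Qed.

Lemma homeomorphism_open (h : X -> Y) : homeomorphism h ->
  forall x N, nbhs x N -> nbhs (h x) (h @` N).
Proof.
move=> [ch [g [cg hK gK]]] x N; move=> xN.
have H : nbhs (h x) (g @^-1` N) by apply: cg; rewrite hK.
by apply: filterS H => y Ny; exists (g y).
Qed.

Lemma homeomorphism_comp (h : X -> Y) (k : Y -> Z) :
  homeomorphism h -> homeomorphism k -> homeomorphism (k \o h).
Proof.
move=> [ch [g [cg hK gK]]] [ck [l [cl kK lK]]].
split; first exact (continuous_compose ch ck).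
exists (g \o l); split; first exact (continuous_compose cl cg).
  exact: can_comp.
exact: can_comp.
Qed.

(** Arbitrary set-theoretic sections suffice: continuity of the induced bijections is read off
    upstairs, where they lift to the two quotient maps themselves. *)
Lemma quotient_map_homeomorphism (p : X -> Y) (q : X -> Z) :
  quotient_map p -> quotient_map q ->
  (forall x x', p x = p x' <-> q x = q x') ->
  exists2 h : Y -> Z, homeomorphism h & forall x, h (p x) = q x.
Proof.
move=> [sp op] [sq oq] pq.
have [s sK] := choice sp; have [t tK] := choice sq.
have hE x : q (s (p x)) = q x by apply/pq; rewrite sK.
have kE x : p (t (q x)) = p x by apply/pq; rewrite tK.
exists (q \o s) => //; split.
  apply/continuousP => O /oq oO; apply/op.
  suff -> : p @^-1` ((q \o s) @^-1` O) = q @^-1` O by [].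
  by apply/funext => x; rewrite /preimage /= hE.
exists (p \o t); split.
- apply/continuousP => O /op oO; apply/oq.
  suff -> : q @^-1` ((p \o t) @^-1` O) = p @^-1` O by [].
  by apply/funext => x; rewrite /preimage /= kE.
- by move=> y; rewrite /= kE sK.
- by move=> z; rewrite /= hE tK.
Qed.

End QuotientMap.

Lemma homeomorphism_inv (X Y : topologicalType) (h : X -> Y) :
  homeomorphism h -> exists2 g : Y -> X, homeomorphism g & cancel h g /\ cancel g h.
Proof. by move=> [ch [g [cg hK gK]]]; exists g => //; split => //; exists h. Qed.

Lemma homeomorphism_pair (X Y Z T : topologicalType) (h : X -> Y) (k : Z -> T) :
  homeomorphism h -> homeomorphism k ->
  homeomorphism (fun p : X * Z => (h p.1, k p.2)).
Proof.
move=> [ch [g [cg hK gK]]] [ck [l [cl kK lK]]]; split.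
  apply: continuous_pair.
    exact (continuous_compose (@continuous_fst _ _) ch).
  exact (continuous_compose (@continuous_snd _ _) ck).
exists (fun p : Y * T => (g p.1, l p.2)); split => [|[x y]|[x y]] /=.
- apply: continuous_pair.
    exact (continuous_compose (@continuous_fst _ _) cg).
  exact (continuous_compose (@continuous_snd _ _) cl).
- by rewrite hK kK.
- by rewrite gK lK.
Qed.

(** A product of quotient maps need not be a quotient map, whereas a product of open maps is open.
    For this reason openness is recorded for every factor that enters a product. *)
Lemma open_pair (X Y Z T : topologicalType) (h : X -> Y) (k : Z -> T) :
  (forall x N, nbhs x N -> nbhs (h x) (h @` N)) ->
  (forall x N, nbhs x N -> nbhs (k x) (k @` N)) ->
  forall (p : X * Z) N, nbhs p N ->
    nbhs (h p.1, k p.2) ((fun p : X * Z => (h p.1, k p.2)) @` N).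
Proof.
move=> oh ok [x z] N [[A B] /= [xA zB] ABN].
exists (h @` A, k @` B) => /=; first by split; [exact: oh|exact: ok].
move=> [_ _] /= [[u Au <-] [v Bv <-]]; exists (u, v) => //.
exact: ABN.
Qed.

Section Orbits.

Lemma orbit_class_quotient_map (U : topologicalType) (T : Type) (i : U -> T)
  (g : T -> T) : quotient_map (@orbit_class U T i g).
Proof.
split=> [y|O]; last by [].
by exists (@orbit_repr U T i g y); rewrite orbit_reprK.
Qed.

Lemma punctured_class_quotient_map (K : numFieldType) (X : normedModType K)
  (g : X -> X) : quotient_map (@punctured_class K X g).
Proof. exact: orbit_class_quotient_map. Qed.

End Orbits.

Section Punctured.
Variables (K L : numFieldType) (X : normedModType K) (Y : normedModType L).
Variable h : X -> Y.
Hypotheses (h_cont : continuous h) (h_eq0 : forall x, (h x == 0) = (x == 0)).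

Lemma punctured_map_subproof (x : punctured X) : h (\val x) \in punctured Y.
Proof.
by apply/mem_set; rewrite /punctured /mkset h_eq0; exact: (set_mem (valP x)).
Qed.

Definition punctured_map (x : punctured X) : punctured Y :=
  exist _ (h (\val x)) (punctured_map_subproof x).

Lemma punctured_map_continuous : continuous punctured_map.
Proof.
apply: continuous_val.
exact (continuous_compose (@val_continuous _ _) h_cont).
Qed.

(** Openness also passes to restrictions over saturated subsets: by [h_eq0], the punctured source is
    the full preimage of the punctured target. *)
Lemma punctured_map_quotient_map : (forall y, exists x, h x = y) ->
  (forall x N, nbhs x N -> nbhs (h x) (h @` N)) -> quotient_map punctured_map.
Proof.
move=> sh oh; apply: open_quotient_map; first exact: punctured_map_continuous.
  move=> [y /= py]; have [x xy] := sh y.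
  have x0 : x \in punctured X.
    apply/mem_set; move: (set_mem py).
    by rewrite /punctured /mkset -xy h_eq0.
  by exists (exist _ x x0); exact: val_inj.
move=> x N; case=> _ /= [] [W oW <- /= Wx WN].
have := oh _ _ (open_nbhs_nbhs (conj oW Wx)).
rewrite nbhsE => -[V [oV Vx] VW].
exists (\val @^-1` V); split => //; first by exists V.
move=> [y py] /= Vy; have [u Wu uy] := VW _ Vy.
have u0 : u \in punctured X.
  apply/mem_set; move: (set_mem py).
  by rewrite /punctured /mkset -[y]uy h_eq0.
exists (exist _ u u0); first exact: WN.
exact: val_inj.
Qed.

End Punctured.

(** * Squaring and radial maps of the plane *)

Section Plane.
Variable R : realType.
Implicit Types (x y z u : R2 R) (a r p : R) (n : nat).

Definition normsq x : R := cdot x x.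

Lemma normsq_ge0 x : 0 <= normsq x.
Proof. by rewrite /normsq /cdot -!expr2 addr_ge0 ?sqr_ge0. Qed.

Lemma normsq_eq0 x : (normsq x == 0) = (x == 0).
Proof.
have [->|x0] := eqVneq x 0; first by rewrite /normsq /cdot !mulr0 addr0 eqxx.
by rewrite gt_eqF ?cdot_gt0.
Qed.

Lemma normsq_gt0 x : (0 < normsq x) = (x != 0).
Proof. by rewrite lt_def normsq_eq0 normsq_ge0 andbT. Qed.

Lemma normsq0 : normsq 0 = 0.
Proof. by apply/eqP; rewrite normsq_eq0. Qed.

Lemma normsqN x : normsq (- x) = normsq x.
Proof. by rewrite /normsq /cdot /= !mulrNN. Qed.

Lemma normsqZ a x : normsq (a *: x) = a ^+ 2 * normsq x.
Proof. rewrite /normsq /cdot /= /GRing.scale /=; ring. Qed.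

Lemma continuous_normsq : continuous normsq.
Proof. by apply: continuous_cdot => ?; exact: cvg_id. Qed.

(** The norm of a product is the maximum norm; neighbourhoods are described instead by the Euclidean
    norm, which is rotation invariant and multiplicative under squaring. *)
Lemma nbhs_normsqP x (N : set (R2 R)) :
  nbhs x N <-> exists2 e, 0 < e & forall y, normsq (y - x) < e -> N y.
Proof.
split=> [/nbhs_ballP[e /= e0 eN]|[e e0 eN]].
  exists (e ^+ 2) => [|y]; first exact: exprn_gt0.
  rewrite /normsq /cdot -!expr2 => ye; apply: eN; split.
    rewrite /ball /= distrC -(@ltr_pXn2r _ 2) ?nnegrE ?normr_ge0 ?(ltW e0)// real_normK ?num_real//.
    by apply: le_lt_trans ye; rewrite lerDl sqr_ge0.
  rewrite /ball /= distrC -(@ltr_pXn2r _ 2) ?nnegrE ?normr_ge0 ?(ltW e0)// real_normK ?num_real//.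
  by apply: le_lt_trans ye; rewrite lerDr sqr_ge0.
have cx : continuous (fun y => normsq (y - x)).
  have c1 : continuous (fun y : R2 R => y - x).
    by apply: continuous_add; [move=> ?; exact: cvg_id|exact: continuous_cst].
  exact (continuous_compose c1 continuous_normsq).
have xe : normsq (x - x) < e by rewrite subrr normsq0.
have H : nbhs x [set y | normsq (y - x) < e].
  exact (cx x [set z | z < e] (lt_nbhsl xe)).
by apply: filterS H => y /= /eN.
Qed.

Lemma polar_sqr r a : sqr_map (polar r a) = polar (r ^+ 2) (a + a).
Proof. rewrite /sqr_map /polar /= cosD sinD; congr pair; ring. Qed.

Lemma sqr_map0 : sqr_map (0 : R2 R) = 0.
Proof. by rewrite /sqr_map /= expr0n /= subr0 mulr0. Qed.

Lemma sqr_map_surj u : exists x, sqr_map x = u.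
Proof.
have [->|u0] := eqVneq u 0; first by exists 0; rewrite sqr_map0.
have [r r0 [a ->]] := polar_surj u0; exists (polar (Num.sqrt r) (a / 2)).
by rewrite polar_sqr sqr_sqrtr ?ltW// -splitr.
Qed.

Lemma normsq_sqr x : normsq (sqr_map x) = normsq x ^+ 2.
Proof. rewrite /normsq /cdot /sqr_map /=; ring. Qed.

Lemma normsq_sqr_sub x y :
  normsq (sqr_map x - sqr_map y) = normsq (x - y) * normsq (x + y).
Proof. rewrite /normsq /cdot /sqr_map /=; ring. Qed.

Lemma sqr_mapN x : sqr_map (- x) = sqr_map x.
Proof. by rewrite /sqr_map /=; congr pair; ring. Qed.

Lemma sqr_mapZ a x : sqr_map (a *: x) = a ^+ 2 *: sqr_map x.
Proof.
by rewrite /sqr_map /GRing.scale /=; congr pair; rewrite /GRing.scale /=; ring.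
Qed.

Lemma sqr_map_eq x y : sqr_map x = sqr_map y <-> x = y \/ x = - y.
Proof.
split=> [e|[->//|->]]; last by rewrite sqr_mapN.
have := normsq_sqr_sub x y; rewrite e subrr normsq0 => /esym/eqP.
rewrite mulf_eq0 !normsq_eq0 subr_eq0 addr_eq0.
by case/orP => /eqP ->; [left|right].
Qed.

Lemma sqr_map_eq0 x : (sqr_map x == 0) = (x == 0).
Proof. by rewrite -!normsq_eq0 normsq_sqr sqrf_eq0. Qed.

Lemma sqr_map_continuous : continuous (@sqr_map R).
Proof.
have cid1 := @continuous_fst R R; have cid2 := @continuous_snd R R.
apply: continuous_pair.
  apply: continuous_sub; exact: continuous_exp.
by apply: continuous_mul => //; apply: continuous_mul => //; exact: continuous_cst.
Qed.

(** Since |y^2 - x^2| = |y - x| |y + x|, a point close to x^2 has one of its two roots y, -y close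
    to x. *)
Lemma sqr_map_open x (N : set (R2 R)) : nbhs x N -> nbhs (sqr_map x) (@sqr_map R @` N).
Proof.
move=> /nbhs_normsqP[e e0 eN]; apply/nbhs_normsqP; exists (e ^+ 2).
  exact: exprn_gt0.
move=> u; have [y <-] := sqr_map_surj u; rewrite normsq_sqr_sub => yx.
have [ye|ey] := ltP (normsq (y - x)) e; first by exists y => //; exact: eN.
exists (- y); last exact: sqr_mapN.
apply: eN; rewrite -opprD normsqN.
rewrite ltNge; apply/negP => ey'; move: yx; rewrite ltNge => /negP; apply.
by rewrite expr2; apply: ler_pM => //; exact: ltW.
Qed.

(* x |-> |x|^(p-1) x *)
Definition radial p x : R2 R := (normsq x `^ ((p - 1) / 2)) *: x.

Lemma radial0 p : radial p 0 = 0.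
Proof. exact: scaler0. Qed.

Lemma normsq_radial p x : 0 < p -> normsq (radial p x) = normsq x `^ p.
Proof.
move=> p0; rewrite normsqZ -powR_mulrn ?powR_ge0// -powRrM divfK ?pnatr_eq0//.
by rewrite mulrC mulr_powRB1// normsq_ge0.
Qed.

Lemma radialK p q : 0 < p -> p * q = 1 -> cancel (radial p) (radial q).
Proof.
move=> p0 pq x; rewrite /radial -/(radial p x) normsq_radial// /radial scalerA.
have [->|x0] := eqVneq x 0; first by rewrite scaler0.
rewrite -powRrM -powRD; last by rewrite normsq_eq0 x0 implybT.
rewrite (_ : _ + _ = 0) ?powRr0 ?scale1r//.
by rewrite mulrA mulrBr pq mulr1 -mulrDl addrC addrA subrK subrr mul0r.
Qed.

(** Away from 0 the scalar factor is a smooth expression in the norm; at 0 the factor may blow up,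
    but the norm of the image is a positive power of the norm. *)
Lemma radial_continuous p : 0 < p -> continuous (radial p).
Proof.
move=> p0 x; have [->|x0] := eqVneq x 0.
  move=> N; rewrite radial0 => /nbhs_normsqP[e e0 eN].
  apply/nbhs_normsqP; exists (e `^ p^-1); first exact: powR_gt0.
  move=> y; rewrite subr0 => ye; apply: eN; rewrite subr0 normsq_radial//.
  rewrite -[ltRHS]powRr1 ?ltW// -[1](mulVf (lt0r_neq0 p0)) powRrM.
  by apply: gt0_ltr_powR; rewrite ?nnegrE ?normsq_ge0 ?powR_ge0.
pose s y : R := expR ((p - 1) / 2 * ln (normsq y)).
have sc : {for x, continuous s}.
  have nx : 0 < normsq x by rewrite normsq_gt0.
  have c1 : (fun y => ln (normsq y)) @ x --> ln (normsq x).
    exact (continuous_comp (@continuous_normsq x) (continuous_ln nx)).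
  have c2 : (fun y => (p - 1) / 2 * ln (normsq y)) @ x --> (p - 1) / 2 * ln (normsq x).
    by apply: cvgM => //; exact: cvg_cst.
  exact (continuous_comp c2 (@continuous_expR R _)).
rewrite /continuous_at {2}/radial.
have -> : normsq x `^ ((p - 1) / 2) = s x.
  by rewrite /powR normsq_eq0 (negbTE x0).
have : (fun y => s y *: y) @ x --> s x *: x by apply: cvgZ => //; exact: cvg_id.
have nx : 0 < normsq x by rewrite normsq_gt0.
have H : nbhs x [set y | 0 < normsq y].
  exact (@continuous_normsq x [set z | 0 < z] (lt_nbhsr nx)).
have near : {near nbhs x, (fun y => s y *: y) =1 radial p}.
  by apply: filterS H => y /= y0; rewrite /radial /powR gt_eqF.
exact: cvg_trans (near_eq_cvg near).
Qed.

Lemma radial_homeomorphism p : 0 < p -> homeomorphism (radial p).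
Proof.
move=> p0; split; first exact: radial_continuous.
exists (radial p^-1); split; first by apply: radial_continuous; rewrite invr_gt0.
  by apply: radialK => //; rewrite divff// gt_eqF.
by apply: radialK; rewrite ?invr_gt0// mulVf// gt_eqF.
Qed.

(** Conjugation by [radial p] changes the contraction factor a into a^p, so any factor in (0, 1) can
    be brought to any other. *)
Lemma radialZ p a x : 0 < p -> 0 < a -> radial p (a *: x) = a `^ p *: radial p x.
Proof.
move=> p0 a0; rewrite /radial normsqZ powRM ?sqr_ge0 ?normsq_ge0// !scalerA.
congr (_ *: _); rewrite mulrAC; congr (_ * _).
rewrite -powR_mulrn ?ltW// -powRrM mulrC mulrCA divff ?pnatr_eq0// mulr1.
by rewrite mulr_powRB1 ?ltW.
Qed.

Lemma radial_isometry p (G : R2 R -> R2 R) x :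
  (forall y, normsq (G y) = normsq y) -> (forall a y, G (a *: y) = a *: G y) ->
  radial p (G x) = G (radial p x).
Proof. by move=> Gn GZ; rewrite /radial Gn GZ. Qed.

End Plane.

(** * The covering of the circle by the line *)

Section CircleCover.
Variable R : realType.
Implicit Types (t : R) (m n : int).

Definition expi t : R2 R := polar 1 (2 * pi * t).

Lemma expi_circle t : expi t \in circle R.
Proof. by apply/mem_set; rewrite /circle /= !mul1r cos2Dsin2. Qed.

Definition circle_cover t : circle R := exist _ (expi t) (expi_circle t).

Lemma circle_normsq (p : circle R) : normsq (\val p) = 1.
Proof. by case: p => p /= /set_mem; rewrite /circle /= /normsq /cdot -!expr2. Qed.

Lemma expi_continuous : continuous expi.
Proof.
have c t : continuous (fun t => 2 * pi * t : R).
  by apply: continuous_mul; [exact: continuous_cst|move=> ?; exact: cvg_id].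
apply: continuous_pair; apply: continuous_mul => //; try exact: continuous_cst.
  exact (continuous_compose (c 0) (@continuous_cos R)).
exact (continuous_compose (c 0) (@continuous_sin R)).
Qed.

Lemma circle_cover_continuous : continuous circle_cover.
Proof. by apply: continuous_val; exact: expi_continuous. Qed.

Lemma circle_cover_surj (p : circle R) : exists t, circle_cover t = p.
Proof.
have p0 : \val p != 0 by rewrite -normsq_gt0 circle_normsq.
have [r r0 [a pE]] := polar_surj p0.
have r1 : r = 1.
  apply/eqP; rewrite -(@eqrXn2 _ 2) ?ltW// expr1n -(cdot_polar r a) -pE.
  by rewrite -[cdot _ _]/(normsq _) circle_normsq.
exists (a / (2 * pi)); apply: val_inj; rewrite /= /expi pE r1.
by rewrite mulrC divfK// mulf_neq0// gt_eqF ?pi_gt0.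
Qed.

Lemma expiD_nat t (n : nat) : expi (t + n%:R) = expi t.
Proof.
rewrite /expi mulrDr (_ : 2 * pi * n%:R = pi *+ 2 *+ n); last first.
  by rewrite -[RHS]mulr_natr -[pi *+ 2]mulr_natl.
by rewrite /polar (periodicn (@cosD2pi R)) (periodicn (@sinD2pi R)).
Qed.

Lemma expiD_int t n : expi (t + n%:~R) = expi t.
Proof.
case: n => n; first exact: expiD_nat.
by rewrite NegzE -[LHS](expiD_nat _ n.+1) mulrNz subrK.
Qed.

(** Removing the integer part of t' - t leaves r in [0, 1) with cos (2 pi r) = 1, and [cos_lt1]
    forces r = 0. *)
Lemma expi_eq t t' : expi t = expi t' <-> exists n, t' = t + n%:~R.
Proof.
split=> [e|[n ->]]; last by rewrite expiD_int.
have [_ [ce se]] := polar_inj ltr01 ltr01 e.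
have c1 : cos (2 * pi * (t' - t)) = 1.
  by rewrite mulrBr cosB ce se -!expr2 cos2Dsin2.
exists (Num.floor (t' - t)); set n := Num.floor _.
pose r := t' - t - n%:~R.
have [r0 r1] : 0 <= r /\ r < 1.
  by rewrite /r subr_ge0 floor_le_tmp ltrBlDl -intrD1 floorD1_gt.
have c2 : cos (2 * pi * r) = 1.
  have := expiD_int r n; rewrite /r subrK => -[+ _].
  by rewrite !mul1r c1.
suff r00 : r = 0 by move: r00; rewrite /r => /eqP; rewrite subr_eq0 => /eqP <-; rewrite addrC subrK.
apply/eqP; apply/negPn/negP => rN0.
have : cos (2 * pi * r) < 1.
  have r0' : 0 < r by rewrite lt_def rN0.
  apply: cos_lt1; apply/andP; split; first by rewrite !mulr_gt0 ?pi_gt0.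
  by rewrite -[pi *+ 2]mulr_natl gtr_pMr ?mulr_gt0 ?pi_gt0.
by rewrite c2 ltxx.
Qed.

Lemma circle_cover_eq t t' :
  circle_cover t = circle_cover t' <-> exists n, t' = t + n%:~R.
Proof.
rewrite -expi_eq; split=> [/(congr1 \val)//|e]; exact: val_inj.
Qed.

(** [G] is a continuous local section near [expi t]: on the half plane facing [expi t] it adds to t
    the angle from [expi t] to y, measured by [atan]. *)
Lemma circle_cover_open t (N : set R) :
  nbhs t N -> nbhs (circle_cover t) (circle_cover @` N).
Proof.
move=> tN; pose d y := cdot (expi t) y; pose c y := ccross (expi t) y.
pose G y := t + atan (c y / d y) / (2 * pi).
have cid : continuous (fun y : R2 R => y) by move=> ?; exact: cvg_id.
have ce : continuous (fun _ : R2 R => expi t) by exact: continuous_cst.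
have cd : continuous d by exact: continuous_cdot.
have cc : continuous c by exact: continuous_ccross.
have d1 : d (expi t) = 1.
  by rewrite -[LHS]/(normsq (\val (circle_cover t))) circle_normsq.
have c0 : c (expi t) = 0 by rewrite /c /ccross mulrC subrr.
have GE : G (expi t) = t by rewrite /G c0 mul0r atan0 mul0r addr0.
have cG : G @ expi t --> t.
  rewrite -[in X in _ --> X]GE; apply: cvgD; first exact: cvg_cst.
  apply: cvgM; last exact: cvg_cst.
  have cr : (fun y => c y / d y) @ expi t --> c (expi t) / d (expi t).
    apply: cvgM; first exact: cc.
    by apply: cvgV; [rewrite d1 oner_neq0|exact: cd].
  exact (continuous_comp cr (@continuous_atan R _)).
have H1 : nbhs (expi t) [set y | 0 < d y].
  by apply: (cd (expi t) [set z | 0 < z]); apply: lt_nbhsr; rewrite d1 ltr01.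
have H2 : nbhs (expi t) [set y | N (G y)] by exact: cG.
have H3 : nbhs (circle_cover t) (\val @^-1` [set y | 0 < d y /\ N (G y)]).
  by apply: (@val_continuous _ (circle R) (circle_cover t)); exact: filterI.
apply: filterS H3 => p /= [dp Np]; exists (G (\val p)) => //.
apply: val_inj => /=; have [r r0 rE] := @polar_half_plane R (d (\val p), c (\val p)) dp.
move: rE => /=; set th := atan _ => rE.
have r1 : r = 1.
  apply/eqP; rewrite -(@eqrXn2 _ 2) ?ltW// expr1n -(cdot_polar r th) -rE.
  apply/eqP; transitivity (normsq (expi t) * normsq (\val p)); last first.
    by rewrite circle_normsq mulr1 -[expi t]/(\val (circle_cover t)) circle_normsq.
  by rewrite /normsq /d /c /cdot /ccross /=; ring.
move: rE; rewrite r1 /polar !mul1r => -[dE cE].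
rewrite /expi /G mulrDr (_ : 2 * pi * (atan _ / _) = th); last first.
  by rewrite mulrC divfK// mulf_neq0// gt_eqF ?pi_gt0.
rewrite /polar !mul1r cosD sinD -dE -cE.
have cs := cos2Dsin2 (2 * pi * t).
rewrite /d /c /cdot /ccross /expi /polar /=; case: (\val p) => x y /=.
congr pair.
  transitivity (x * (cos (2 * pi * t) ^+ 2 + sin (2 * pi * t) ^+ 2)); last by rewrite cs mulr1.
  by ring.
transitivity (y * (cos (2 * pi * t) ^+ 2 + sin (2 * pi * t) ^+ 2)); last by rewrite cs mulr1.
by ring.
Qed.

End CircleCover.

(** * Recognition of products with the circle and of the Klein bottle *)

Section MappingTorus.
Variables (R : realType) (X : normedModType R) (Sigma : topologicalType).
Variables (F : X -> X) (Theta : R * Sigma -> punctured X).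
Hypotheses (Theta_quot : quotient_map Theta) (Theta_inj : injective Theta).

(** In the coordinates [Theta] the map is a unit translation of the line, so both spaces are
    quotients of [R * Sigma] by integer translations of the first factor. *)
Lemma mapping_torus_homeomorphic :
  (forall t s, F (\val (Theta (t, s))) = \val (Theta (t + 1, s))) ->
  homeomorphic (punctured_quotient F) (circle R * Sigma)%type.
Proof.
move=> FT; pose q (p : R * Sigma) := (circle_cover p.1, p.2).
have qq : quotient_map q.
  apply: open_quotient_map.
  - apply: continuous_pair; last exact: continuous_snd.
    exact (continuous_compose (@continuous_fst _ _) (@circle_cover_continuous R)).
  - by move=> [c s]; have [t <-] := circle_cover_surj c; exists (t, s).
  - move=> p N; apply: (open_pair (k := id)) => [t M|s M].
      exact: circle_cover_open.
    by rewrite image_id.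
have pq := quotient_map_comp Theta_quot (@punctured_class_quotient_map _ _ F).
have [|h hh _] := quotient_map_homeomorphism pq qq; last by exists h.
have it n t s : iter n F (\val (Theta (t, s))) = \val (Theta (t + n%:R, s)).
  elim: n => [|n IH]; first by rewrite addr0.
  by rewrite iterS IH FT -addrA natr1.
move=> [t s] [t' s'] /=; split.
  move=> /punctured_classP[m [n]]; rewrite !it => /val_inj/Theta_inj[e <-].
  rewrite /q /=; congr pair; apply/circle_cover_eq; exists (m%:Z - n%:Z).
  by rewrite intrB -!pmulrn addrA e addrK.
rewrite /q => e; have /= <- := congr1 snd e.
have /= /circle_cover_eq [k ->] := congr1 fst e.
apply/punctured_classP.
case: k => k; [exists k, 0%N|exists 0%N, k.+1]; rewrite !it ?addr0//.
by rewrite NegzE mulrNz subrK.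
Qed.

End MappingTorus.

Section Klein.
Variables (R : realType) (F : R2 R -> R2 R).
Variable Theta : R * circle R -> punctured (R2 R).
Hypotheses (Theta_quot : quotient_map Theta) (Theta_inj : injective Theta).

Lemma klein_homeomorphic :
  (forall x y, F (\val (Theta (x, circle_cover y))) =
    \val (Theta (x + 1, circle_cover (- y)))) ->
  homeomorphic (punctured_quotient F) (klein_bottle R).
Proof.
move=> FT; pose q (p : R * R) := (p.1, circle_cover p.2).
have qq : quotient_map q.
  apply: open_quotient_map.
  - apply: continuous_pair; first exact: continuous_fst.
    exact (continuous_compose (@continuous_snd _ _) (@circle_cover_continuous R)).
  - by move=> [t c]; have [s <-] := circle_cover_surj c; exists (t, s).
  - move=> p N; apply: (open_pair (h := id)) => [t M|s M].
      by rewrite image_id.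
    exact: circle_cover_open.
have pq := quotient_map_comp (quotient_map_comp qq Theta_quot)
  (@punctured_class_quotient_map _ _ F).
have kq : quotient_map (\pi_(klein_bottle R)%qT : R2 R -> klein_bottle R).
  by split => [y|W]; [exists (repr y); exact: reprK|].
have [|h hh _] := quotient_map_homeomorphism pq kq; last by exists h.
have it n x y : iter n F (\val (Theta (x, circle_cover y))) =
    \val (Theta (x + n%:R, circle_cover ((-1) ^+ n * y))).
  elim: n => [|n IH]; first by rewrite addr0 mul1r.
  by rewrite iterS IH FT -addrA natr1 exprS mulN1r mulNr.
move=> [x y] [x' y'] /=; split.
  move=> /punctured_classP[m [n]]; rewrite !it => /val_inj/Theta_inj ee.
  have /= e := congr1 fst ee; have /= /circle_cover_eq [k ke] := congr1 snd ee.
  (* The equality of circle points reads (-1)^n y' = (-1)^m y + k; solving it for y' gives the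
     translation (-1)^n k. *)
  apply/eqmodP/asboolP; exists (m%:Z - n%:Z), ((-1) ^+ n * k) => /=; congr pair.
    by rewrite intrB -!pmulrn addrA e addrK.
  rewrite expfzDr ?oppr_eq0 ?oner_eq0// -exprnN -exprVn invrN1 -exprnP.
  rewrite intrM rmorph_sign -[LHS](signrMK n) ke mulrDr mulrA.
  by rewrite [(-1) ^+ m * _]mulrC.
move=> /eqmodP/asboolP[m [n /= [-> ->]]]; apply/punctured_classP.
case: m => k; [exists k, 0%N|exists 0%N, k.+1]; rewrite !it.
  rewrite addr0 expr0 mul1r; congr (\val (Theta (_, _))).
  by apply/circle_cover_eq; exists n.
rewrite addr0 expr0 mul1r NegzE mulrNz subrK; congr (\val (Theta (_, _))).
apply/circle_cover_eq; exists ((-1) ^+ k.+1 * n).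
rewrite intrM rmorph_sign mulrDr -exprnN -exprVn invrN1.
by rewrite signrMK.
Qed.

End Klein.

(** * Time-one maps of contracting flows *)

Section Flow.
Variables (R : realType) (X : normedModType R) (Phi : R -> X -> X) (Nf : X -> R).
Hypotheses (Phi_cont : continuous (fun p : R * X => Phi p.1 p.2))
  (Phi0 : forall x, Phi 0 x = x)
  (PhiD : forall s t x, Phi (s + t) x = Phi s (Phi t x))
  (Nf_cont : continuous Nf)
  (Nf_ge0 : forall x, 0 <= Nf x)
  (Nf_eq0 : forall x, (Nf x == 0) = (x == 0))
  (NfPhi : forall t x, Nf (Phi t x) = expR (- (2 * t)) * Nf x).
Variables (F S : X -> X).
Hypotheses (S_homeo : homeomorphism S) (S_eq0 : forall x, (S x == 0) = (x == 0)).
Hypothesis FS : forall x, F (S x) = S (Phi 1 x).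

Local Notation sphere := [set x | Nf x = 1].

Lemma Phi_eq0 t x : (Phi t x == 0) = (x == 0).
Proof. by rewrite -!Nf_eq0 NfPhi mulf_eq0 expR_eq0. Qed.

Lemma flow_isotopy n : orientation_preserving n F.
Proof.
have [T [[cT _] [SK TK]]] : exists T, homeomorphism T /\ cancel S T /\ cancel T S.
  by have [T hT [SK TK]] := homeomorphism_inv S_homeo; exists T.
have cS := S_homeo.1.
have cH : continuous (fun p : R * X => S (Phi p.1 (T p.2))).
  have c1 : continuous (fun p : R * X => (p.1, T p.2)).
    apply: continuous_pair; first exact: continuous_fst.
    exact (continuous_compose (@continuous_snd _ _) cT).
  exact (continuous_compose (continuous_compose c1 Phi_cont) cS).
have -> : F = (fun t x => S (Phi t (T x))) 1.
  by apply/funext => x; rewrite -FS TK.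
apply: (isotopy_orientation_preserving (H := fun t x => S (Phi t (T x)))).
- exact: cH.
- move=> t _ x y /(can_inj SK) /(congr1 (Phi (- t))).
  by rewrite -!PhiD addNr !Phi0 => /(can_inj TK).
- rewrite (_ : (fun _ => _) = id); first exact: orientation_preserving_id.
  by apply/funext => x; rewrite Phi0 TK.
Qed.

Lemma flow_polar_subproof (p : R * sphere) : S (Phi p.1 (\val p.2)) \in punctured X.
Proof.
apply/mem_set; rewrite /punctured /mkset S_eq0 Phi_eq0 -Nf_eq0.
by rewrite (set_mem (valP p.2)) oner_eq0.
Qed.

Definition flow_polar (p : R * sphere) : punctured X :=
  exist _ (S (Phi p.1 (\val p.2))) (flow_polar_subproof p).

(** [Nf] decreases strictly along each nonzero orbit, which therefore crosses the unit level exactly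
    once; the crossing time depends continuously on the point. *)
Lemma flow_polar_homeomorphism : homeomorphism flow_polar.
Proof.
have [T [[cT _] [SK TK]]] : exists T, homeomorphism T /\ cancel S T /\ cancel T S.
  by have [T hT [SK TK]] := homeomorphism_inv S_homeo; exists T.
have T_eq0 x : (T x == 0) = (x == 0) by rewrite -S_eq0 TK.
have NT (x : punctured X) : 0 < Nf (T (\val x)).
  by rewrite lt_def Nf_ge0 andbT Nf_eq0 T_eq0; exact: (set_mem (valP x)).
(* Solution of exp(2 tau) Nf (T x) = 1. *)
pose tau (x : punctured X) := - (ln (Nf (T (\val x))) / 2).
have Ntau x : Nf (Phi (- tau x) (T (\val x))) = 1.
  rewrite NfPhi /tau opprK (_ : 2 * (_ / 2) = ln (Nf (T (\val x)))); last by field.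
  by rewrite expRN lnK ?posrE// mulVf// gt_eqF.
pose g (x : punctured X) : R * sphere :=
  (tau x, exist _ (Phi (- tau x) (T (\val x))) (mem_set (Ntau x))).
have cTv : continuous (fun x : punctured X => T (\val x)).
  exact (continuous_compose (@val_continuous _ _) cT).
have ctau : continuous tau.
  have cN : continuous (fun x : punctured X => Nf (T (\val x))).
    exact (continuous_compose cTv Nf_cont).
  have cl : continuous (fun x : punctured X => ln (Nf (T (\val x)))).
    move=> x; exact (continuous_comp (cN x) (continuous_ln (NT x))).
  by apply: continuous_opp; apply: continuous_mul => //; exact: continuous_cst.
split.
  apply: continuous_val.
  have c1 : continuous (fun p : R * sphere => (p.1, \val p.2)).
    apply: continuous_pair; first exact: continuous_fst.
    exact (continuous_compose (@continuous_snd _ _) (@val_continuous _ _)).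
  exact (continuous_compose (continuous_compose c1 Phi_cont) S_homeo.1).
exists g; split.
- apply: continuous_pair => //; apply: continuous_val => /=.
  have c1 : continuous (fun x : punctured X => (- tau x, T (\val x))).
    by apply: continuous_pair => //; exact: continuous_opp.
  exact (continuous_compose c1 Phi_cont).
- move=> [t s]; have Ns : Nf (\val s) = 1 := set_mem (valP s).
  have tE : tau (flow_polar (t, s)) = t.
    rewrite /tau /= SK NfPhi Ns mulr1 expRK; lra.
  rewrite /g; congr pair => //; apply: val_inj => /=.
  by rewrite [in LHS]tE SK -PhiD addNr Phi0.
- move=> x; apply: val_inj => /=.
  by rewrite -PhiD subrr Phi0 TK.
Qed.

Lemma flow_torus : homeomorphic (punctured_quotient F) (circle R * sphere)%type.
Proof.
apply: (mapping_torus_homeomorphic (Theta := flow_polar)).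
- exact: homeomorphism_quotient_map flow_polar_homeomorphism.
- by have [_ [g [_ gK _]]] := flow_polar_homeomorphism; exact: can_inj gK.
- by move=> t s /=; rewrite FS -PhiD addrC.
Qed.

Lemma flow_iter n x : iter n F (S x) = S (Phi n%:R x).
Proof.
elim: n => [|n IH]; first by rewrite Phi0.
by rewrite iterS IH FS -PhiD nat1r.
Qed.

(** [Nf] of the conjugated points is bounded on balls by compactness, decays like exp(-2 n) under
    iteration, and controls the norm near 0 through the second premise. *)
Lemma flow_contraction : 
  (forall M, compact [set x : X | `|x| <= M]) ->
  (forall N, nbhs (0 : X) N -> exists2 e, 0 < e & forall x, Nf x < e -> N x) ->
  punctured_contraction F.
Proof.
move=> Xc Nf_nbhs.
have [T hT [SK TK]] := homeomorphism_inv S_homeo.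
have S0 : S 0 = 0 by apply/eqP; rewrite S_eq0.
have Phi10 : Phi 1 0 = 0 by apply/eqP; rewrite Phi_eq0.
have FE : F = S \o (Phi 1 \o T) by apply/funext => x; rewrite /= -FS TK.
have cPhi t : continuous (Phi t).
  have c1 : continuous (fun x : X => (t, x)).
    by apply: continuous_pair; [exact: continuous_cst|move=> ?; exact: cvg_id].
  exact (continuous_compose c1 Phi_cont).
split.
- rewrite FE; apply: homeomorphism_comp S_homeo; apply: homeomorphism_comp => //.
  split; first exact: cPhi.
  exists (Phi (-1)); split; first exact: cPhi.
    by move=> x; rewrite -PhiD addNr Phi0.
  by move=> x; rewrite -PhiD subrr Phi0.
- by rewrite -{1}S0 FS Phi10 S0.
move=> M e e0.
have [d d0 dS] : exists2 d, 0 < d & forall x, Nf x < d -> `|S x| < e.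
  apply: Nf_nbhs; have := S_homeo.1 0; rewrite /continuous_at S0.
  by move=> /cvgr0Pnorm_lt; apply.
have [C C0 CN] : exists2 C, 0 < C & forall x, `|x| <= M -> Nf (T x) < C.
  have cNT : continuous (fun x => Nf (T x)) by exact (continuous_compose hT.1 Nf_cont).
  have : compact ((fun x => Nf (T x)) @` [set x : X | `|x| <= M]).
    by apply: continuous_compact => //; exact: continuous_subspaceT.
  (* [compact_bounded] yields bounds only strictly above [B]: [|B| + 1] is one of them, and one more
     unit makes the inequality strict. *)
  move=> /compact_bounded[B [_ BP]]; exists (`|B| + 2) => [|x xM].
    by rewrite ltr_wpDl.
  have := BP (`|B| + 1) _ (Nf (T x)); rewrite /= (ger0_norm (Nf_ge0 (T x))) => H.
  apply: le_lt_trans (H _ _) _; last by rewrite ltrD2l ltr1n.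
    by rewrite (le_lt_trans (ler_norm _))// ltrDl.
  by exists x.
(* The bound n <= 1 + 2 n <= exp(2 n) makes any n > C / d sufficient. *)
have [N NE] : exists N : nat, forall n, (N <= n)%N -> expR (- (2 * n%:R)) * C < d.
  exists (Num.truncn (C / d)).+1 => n Nn.
  have CNd : C / d < n%:R.
    by apply: lt_le_trans (truncnS_gt _) _; rewrite ler_nat.
  rewrite expRN mulrC ltr_pdivrMr ?expR_gt0// mulrC -ltr_pdivrMr//.
  apply: lt_le_trans CNd _; apply: le_trans (expR_ge1Dx _).
  by rewrite -[leLHS]add0r lerD// ler_peMl// ler1n.
exists N => n x Nn xM; rewrite -[x]TK flow_iter; apply: dS; rewrite NfPhi.
apply: le_lt_trans (NE n Nn); rewrite ler_pM2l ?expR_gt0//; exact/ltW/CN.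
Qed.

End Flow.

(** * The linear model flows *)

Section Models.
Variable R : realType.
Implicit Types (a t phi : R) (x : R2 R) (y : R4 R).

Definition rot a x : R2 R :=
  (cos a * x.1 - sin a * x.2, sin a * x.1 + cos a * x.2).

Arguments rot : simpl never.

Lemma rot0 x : rot 0 x = x.
Proof. by case: x => u v; rewrite /rot cos0 sin0 /= !mul1r !mul0r subr0 add0r. Qed.

Lemma rotD a b x : rot (a + b) x = rot a (rot b x).
Proof. rewrite /rot cosD sinD /=; congr pair; ring. Qed.

Lemma rotZ a t x : rot a (t *: x) = t *: rot a x.
Proof.
by rewrite /rot /GRing.scale /=; congr pair; rewrite /GRing.scale /=; ring.
Qed.

Lemma normsq_rot a x : normsq (rot a x) = normsq x.
Proof.
transitivity ((cos a ^+ 2 + sin a ^+ 2) * normsq x); last by rewrite cos2Dsin2 mul1r.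
by rewrite /normsq /cdot /rot /=; ring.
Qed.

Lemma sqr_map_rot a x : sqr_map (rot a x) = rot (a + a) (sqr_map x).
Proof. rewrite /sqr_map /rot cosD sinD /=; congr pair; ring. Qed.

Lemma continuous_rot (T : topologicalType) (f : T -> R) (g : T -> R2 R) :
  continuous f -> continuous g -> continuous (fun w => rot (f w) (g w)).
Proof.
move=> cf cg.
have cc : continuous (fun w => cos (f w)) by exact (continuous_compose cf (@continuous_cos R)).
have cs : continuous (fun w => sin (f w)) by exact (continuous_compose cf (@continuous_sin R)).
have c1 : continuous (fun w => (g w).1) by exact (continuous_compose cg (@continuous_fst _ _)).
have c2 : continuous (fun w => (g w).2) by exact (continuous_compose cg (@continuous_snd _ _)).
apply: continuous_pair; first by apply: continuous_sub; exact: continuous_mul.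
by apply: continuous_add; exact: continuous_mul.
Qed.

(** Written, like [norm4sq], with the very expressions of [circle] and [sphere3], so that the unit
    levels in [flow_torus] are these sets by conversion. *)
Definition norm2sq x : R := x.1 ^+ 2 + x.2 ^+ 2.

Definition norm4sq y : R := y.1.1 ^+ 2 + y.1.2 ^+ 2 + y.2.1 ^+ 2 + y.2.2 ^+ 2.

Lemma norm2sqE x : norm2sq x = normsq x.
Proof. by rewrite /norm2sq /normsq /cdot !expr2. Qed.

Lemma norm4sqE y : norm4sq y = normsq y.1 + normsq y.2.
Proof. by rewrite /norm4sq /normsq /cdot !expr2 !addrA. Qed.

Lemma norm2sq_continuous : continuous norm2sq.
Proof.
rewrite (_ : norm2sq = @normsq R); first exact: continuous_normsq.
by apply/funext => x; exact: norm2sqE.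
Qed.

Lemma norm4sq_continuous : continuous norm4sq.
Proof.
rewrite (_ : norm4sq = fun y => normsq y.1 + normsq y.2); last first.
  by apply/funext => y; exact: norm4sqE.
apply: continuous_add.
  exact (continuous_compose (@continuous_fst _ _) (@continuous_normsq R)).
exact (continuous_compose (@continuous_snd _ _) (@continuous_normsq R)).
Qed.

Lemma norm4sq_ge0 y : 0 <= norm4sq y.
Proof. by rewrite norm4sqE addr_ge0 ?normsq_ge0. Qed.

Lemma norm4sq_eq0 y : (norm4sq y == 0) = (y == 0).
Proof.
by rewrite norm4sqE paddr_eq0 ?normsq_ge0// !normsq_eq0; case: y.
Qed.

Lemma norm4sqZ a y : norm4sq (a *: y) = a ^+ 2 * norm4sq y.
Proof. by rewrite !norm4sqE mulrDr -!normsqZ. Qed.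

Lemma nbhs_norm4sq (N : set (R4 R)) : nbhs (0 : R4 R) N ->
  exists2 e, 0 < e & forall y, norm4sq y < e -> N y.
Proof.
case=> -[A B] /= [/nbhs_normsqP[e e0 eA] /nbhs_normsqP[d d0 dB]] AB.
exists (Num.min e d) => [|[x u]]; first by rewrite lt_min e0 d0.
rewrite norm4sqE /= lt_min => /andP[he hd]; apply: AB; split => /=.
  apply: eA; rewrite [x - _]subr0; apply: le_lt_trans he.
  by rewrite lerDl normsq_ge0.
apply: dB; rewrite [u - _]subr0; apply: le_lt_trans hd.
by rewrite lerDr normsq_ge0.
Qed.

Lemma compact_ball4 (M : R) : compact [set y : R4 R | `|y| <= M].
Proof.
pose I := `[- M, M]%classic : set R.
have cI : compact I by apply: segment_compact.
rewrite (_ : [set _ | _] = (I `*` I) `*` (I `*` I)).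
  by apply: (compact_setX (compact_setX cI cI) (compact_setX cI cI)).
apply/seteqP; split => -[[a b] [c d]] /=; rewrite !prod_normE /= !ge_max /I /= !in_itv /= !ler_norml.
  by move=> /andP[/andP[-> ->] /andP[-> ->]].
by move=> [[-> ->] [-> ->]].
Qed.

Definition flow2 phi t x : R2 R := expR (- t) *: rot (t * phi) x.

(** The second plane is that of squares, hence the doubled angle, written as a sum to match
    [sqr_map_rot]. *)
Definition flow4 phi t y : R4 R :=
  expR (- t) *: (rot (t * phi) y.1, rot (t * phi + t * phi) y.2).

(** The two reflections negate one coordinate in each plane; together they are the half turn of the
    plane spanned by these two coordinates. Only at integer times does this flow preserve the plane
    [y.2 = 0], so it does not connect the map on that plane to the identity. *)
Definition twist_flow t y : R4 R :=
  let v := rot (t * pi) (y.1.2, y.2.2) in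
  expR (- t) *: ((y.1.1, v.1), (y.2.1, v.2)).

Lemma expR_opp_sqr t : expR (- t) ^+ 2 = expR (- (2 * t)).
Proof. by rewrite -expRM_natl; congr expR; ring. Qed.

Lemma continuous_expR_opp : continuous (fun t => expR (- t)).
Proof.
have c : continuous (fun t : R => - t) by apply: continuous_opp => ?; exact: cvg_id.
exact (continuous_compose c (@continuous_expR R)).
Qed.

Section Flow2.
Variable phi : R.

Lemma flow2_continuous : continuous (fun p : R * R2 R => flow2 phi p.1 p.2).
Proof.
apply: continuous_scale.
  exact (continuous_compose (@continuous_fst _ _) continuous_expR_opp).
apply: continuous_rot; last exact: continuous_snd.
by apply: continuous_mul; [exact: continuous_fst|exact: continuous_cst].
Qed.

Lemma flow20 x : flow2 phi 0 x = x.
Proof. by rewrite /flow2 oppr0 expR0 scale1r mul0r rot0. Qed.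

Lemma flow2D s t x : flow2 phi (s + t) x = flow2 phi s (flow2 phi t x).
Proof. by rewrite /flow2 rotZ scalerA mulrDl rotD opprD expRD. Qed.

Lemma norm2sq_flow2 t x : norm2sq (flow2 phi t x) = expR (- (2 * t)) * norm2sq x.
Proof. by rewrite !norm2sqE normsqZ normsq_rot expR_opp_sqr. Qed.

Lemma flow4_continuous : continuous (fun p : R * R4 R => flow4 phi p.1 p.2).
Proof.
apply: continuous_scale.
  exact (continuous_compose (@continuous_fst _ _) continuous_expR_opp).
have c : continuous (fun p : R * R4 R => p.1 * phi : R).
  by apply: continuous_mul; [exact: continuous_fst|exact: continuous_cst].
apply: continuous_pair; apply: continuous_rot => //.
- exact (continuous_compose (@continuous_snd _ _) (@continuous_fst _ _)).
- exact: continuous_add.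
- exact (continuous_compose (@continuous_snd _ _) (@continuous_snd _ _)).
Qed.

Lemma flow40 y : flow4 phi 0 y = y.
Proof. by rewrite /flow4 oppr0 expR0 scale1r mul0r addr0 !rot0; case: y. Qed.

Lemma flow4D s t y : flow4 phi (s + t) y = flow4 phi s (flow4 phi t y).
Proof.
transitivity (expR (- s) *: (expR (- t) *:
    (rot (s * phi) (rot (t * phi) y.1),
     rot (s * phi + s * phi) (rot (t * phi + t * phi) y.2)))).
  rewrite scalerA -expRD -opprD -!rotD /flow4 mulrDl.
  by congr (_ *: (_, rot _ _)); ring.
by rewrite /flow4 /= !rotZ.
Qed.

Lemma norm4sq_flow4 t y : norm4sq (flow4 phi t y) = expR (- (2 * t)) * norm4sq y.
Proof. by rewrite norm4sqZ !norm4sqE !normsq_rot expR_opp_sqr. Qed.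

End Flow2.

Lemma twist_flow_continuous : continuous (fun p : R * R4 R => twist_flow p.1 p.2).
Proof.
apply: continuous_scale.
  exact (continuous_compose (@continuous_fst _ _) continuous_expR_opp).
have c1 : continuous (fun p : R * R4 R => p.2.1).
  exact (continuous_compose (@continuous_snd _ _) (@continuous_fst _ _)).
have c2 : continuous (fun p : R * R4 R => p.2.2).
  exact (continuous_compose (@continuous_snd _ _) (@continuous_snd _ _)).
have c11 := continuous_compose c1 (@continuous_fst _ _).
have c12 := continuous_compose c1 (@continuous_snd _ _).
have c21 := continuous_compose c2 (@continuous_fst _ _).
have c22 := continuous_compose c2 (@continuous_snd _ _).
have cr : continuous (fun p : R * R4 R => rot (p.1 * pi) (p.2.1.2, p.2.2.2)).
  apply: continuous_rot; last exact: continuous_pair.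
  by apply: continuous_mul; [exact: continuous_fst|exact: continuous_cst].
apply: continuous_pair; apply: continuous_pair => //.
  exact (continuous_compose cr (@continuous_fst _ _)).
exact (continuous_compose cr (@continuous_snd _ _)).
Qed.

Lemma twist_flow0 y : twist_flow 0 y = y.
Proof.
by rewrite /twist_flow oppr0 expR0 scale1r mul0r rot0; case: y => [[? ?] [? ?]].
Qed.

Lemma twist_flowD s t y : twist_flow (s + t) y = twist_flow s (twist_flow t y).
Proof.
pose v := rot (t * pi) (y.1.2, y.2.2).
transitivity (expR (- s) *: (expR (- t) *:
    (((y.1.1, (rot (s * pi) v).1), (y.2.1, (rot (s * pi) v).2)) : R4 R))).
  by rewrite scalerA -expRD -opprD /twist_flow mulrDl rotD.
have E : ((twist_flow t y).1.2, (twist_flow t y).2.2) = expR (- t) *: v by [].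
by rewrite {1}/twist_flow E rotZ.
Qed.

Lemma norm4sq_twist_flow t y :
  norm4sq (twist_flow t y) = expR (- (2 * t)) * norm4sq y.
Proof.
rewrite norm4sqZ expR_opp_sqr; congr (_ * _).
have E (v : R2 R) :
    norm4sq ((y.1.1, v.1), (y.2.1, v.2)) = y.1.1 ^+ 2 + y.2.1 ^+ 2 + normsq v.
  by rewrite /norm4sq /normsq /cdot /=; ring.
by rewrite E normsq_rot /norm4sq /normsq /cdot /=; ring.
Qed.

Lemma twist_flow1 y : twist_flow 1 y =
  expR (- 1) *: ((y.1.1, - y.1.2), (y.2.1, - y.2.2)).
Proof.
by rewrite /twist_flow /rot mul1r cospi sinpi /= !mul0r !mulN1r subr0 add0r.
Qed.

End Models.

(** * Normalization of contractions commuting with the real structure *)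

Section ComplexPlane.
Variable R : realType.
Implicit Types (x y : R2 R) (z w : R[i]) (k : R).

Definition cpx x : R[i]^o := (x.1 +i* x.2)%C.
Definition uncpx (z : R[i]^o) : R2 R := (complex.Re z, complex.Im z).

Lemma cpxK : cancel cpx uncpx.
Proof. by case. Qed.

Lemma uncpxK : cancel uncpx cpx.
Proof. by case. Qed.

Lemma cpxB x y : cpx (x - y) = cpx x - cpx y.
Proof. by case: x y => a b [c d]. Qed.

Lemma cpxZ k x : cpx (k *: x) = k%:C * cpx x.
Proof.
by case: x => a b; apply/eqP; rewrite eq_complex /= !mul0r subr0 addr0 !eqxx.
Qed.

Lemma norm_cpx x : `|cpx x : R[i]| = (Num.sqrt (normsq x))%:C.
Proof. by rewrite normc_def /normsq /cdot !expr2. Qed.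

Lemma cpx_continuous : continuous cpx.
Proof.
move=> x N /nbhs_ballP[e /= e0 eN].
(* The radius of a ball of [R[i]^o] is a complex number; being positive, it is real. *)
have [e1 e2] : 0 < complex.Re e /\ e = (complex.Re e)%:C.
  move: e0; rewrite ltcE /= => /andP[/eqP i0 r0]; split => //.
  by apply/eqP; rewrite eq_complex /= eqxx i0 eqxx.
apply/nbhs_normsqP; exists (complex.Re e ^+ 2); first exact: exprn_gt0.
move=> y yx; apply: eN; rewrite /ball /= -cpxB norm_cpx e2 ltcR.
rewrite -[ltRHS](ger0_norm (ltW e1)) -sqrtr_sqr ltr_sqrt ?exprn_gt0//.
by rewrite -normsqN opprB.
Qed.

Lemma uncpx_continuous : continuous uncpx.
Proof.
move=> z N /nbhs_normsqP[e e0 eN]; apply/nbhs_ballP.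
exists (Num.sqrt e)%:C; first by rewrite /= ltcR sqrtr_gt0.
move=> w /=; rewrite /ball /= => zw; apply: eN.
have -> : uncpx w - uncpx z = uncpx (w - z) by case: w z {zw} => a b [c d].
move: zw; rewrite distrC => zw.
rewrite -[w - z]uncpxK norm_cpx ltcR in zw.
by move: zw; rewrite ltr_sqrt.
Qed.

Lemma cpx_homeomorphism : homeomorphism cpx.
Proof.
split; first exact: cpx_continuous.
by exists uncpx; split; [exact: uncpx_continuous|exact: cpxK|exact: uncpxK].
Qed.

Lemma real_complex_continuous : continuous (fun k => k%:C : R[i]^o).
Proof.
have c : continuous (fun k => (k, 0) : R2 R).
  by apply: continuous_pair; [move=> ?; exact: cvg_id|exact: continuous_cst].
exact (continuous_compose c cpx_continuous).
Qed.

End ComplexPlane.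

(** * Real coordinates on the two eigenplanes *)

Section IdentDecomposition.
Variables (R : realType) (f : normal_form R) (phip phim : C2 R -> R2 R).
Hypotheses (hphip : linear_iso_on (eigen_plus f) phip)
  (hphim : linear_iso_on (eigen_minus f) phim).
Local Notation c := (real_struct f).
Implicit Types (u v : C2 R) (k : R) (x : R2 R) (y : R4 R).

Lemma real_structD u v : c (u + v) = c u + c v.
Proof.
by rewrite /real_struct; case: ifP => _; rewrite /= !rmorphD.
Qed.

Lemma real_structZ k u : c (k%:C *: u) = k%:C *: c u.
Proof.
have cZ (z : R[i]) : conjc (k%:C * z) = k%:C * conjc z by rewrite [LHS]rmorphM /= oppr0.
by rewrite /real_struct; case: ifP => _; rewrite /= /GRing.scale /= /GRing.scale /= !cZ.
Qed.

Lemma real_structN u : c (- u) = - c u.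
Proof. by rewrite /real_struct; case: ifP => _; rewrite /= !rmorphN. Qed.

Lemma real_structK u : c (c u) = u.
Proof.
by case: u => [[a b] [a' b']]; rewrite /real_struct; case: (is_IIc' f) => /=; rewrite !opprK.
Qed.

Lemma real_struct0 : c 0 = 0.
Proof. by have := real_structD 0 0; rewrite addr0 => /esym/eqP; rewrite addrC -subr_eq0 addrK => /eqP. Qed.

Lemma linear_iso0 (V : set (C2 R)) (phi : C2 R -> R2 R) :
  linear_iso_on V phi -> V 0 -> phi 0 = 0.
Proof.
move=> [phiD _] V0; have := phiD 1 0 0 V0 V0.
by rewrite scaler0 addr0 scale1r => /eqP; rewrite -subr_eq0 opprD addNKr oppr_eq0 => /eqP.
Qed.

Definition proj_plus v : C2 R := (2^-1 : R[i]) *: (v + c v).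
Definition proj_minus v : C2 R := (2^-1 : R[i]) *: (v - c v).

Let half : (2^-1 : R[i]) = (2^-1 : R)%:C.
Proof. by rewrite fmorphV rmorph_nat. Qed.

Let halfD (u : C2 R) : (2^-1 : R[i]) *: (u + u) = u.
Proof.
rewrite scalerDr -scalerDl (_ : 2^-1 + 2^-1 = 1) ?scale1r//; by field.
Qed.

Lemma proj_plus_eigen v : eigen_plus f (proj_plus v).
Proof. by rewrite /eigen_plus /= /proj_plus half real_structZ real_structD real_structK addrC. Qed.

Lemma proj_minus_eigen v : eigen_minus f (proj_minus v).
Proof.
rewrite /eigen_minus /= /proj_minus half real_structZ real_structD real_structN.
by rewrite real_structK -scalerN opprB addrC.
Qed.

Lemma proj_sum v : proj_plus v + proj_minus v = v.
Proof.
by rewrite /proj_plus /proj_minus -scalerDr addrACA subrr addr0 halfD.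
Qed.

Lemma proj_plus_sum u v : eigen_plus f u -> eigen_minus f v -> proj_plus (u + v) = u.
Proof.
rewrite /eigen_plus /eigen_minus /= /proj_plus real_structD => -> ->.
by rewrite addrACA subrr addr0 halfD.
Qed.

Lemma proj_minus_sum u v : eigen_plus f u -> eigen_minus f v -> proj_minus (u + v) = v.
Proof.
rewrite /eigen_plus /eigen_minus /= /proj_minus real_structD => -> ->.
by rewrite opprD opprK addrACA subrr add0r halfD.
Qed.

Lemma proj_plusD k u v : proj_plus (k%:C *: u + v) = k%:C *: proj_plus u + proj_plus v.
Proof.
rewrite /proj_plus real_structD real_structZ addrACA -[k%:C *: u + _]scalerDr.
by rewrite [LHS]scalerDr !scalerA mulrC.
Qed.

Lemma proj_minusD k u v : proj_minus (k%:C *: u + v) = k%:C *: proj_minus u + proj_minus v.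
Proof.
rewrite /proj_minus real_structD real_structZ opprD addrACA -[k%:C *: u - _]scalerBr.
by rewrite [LHS]scalerDr !scalerA mulrC.
Qed.

(** The identification before squaring: a real-linear isomorphism that turns the real structure into
    (x, u) -> (x, -u). *)
Definition eigen_coord v : R4 R := (phip (proj_plus v), phim (proj_minus v)).

Lemma eigen_coordD k u v :
  eigen_coord (k%:C *: u + v) = k *: eigen_coord u + eigen_coord v.
Proof.
rewrite /eigen_coord proj_plusD proj_minusD.
rewrite hphip.1 ?hphim.1//; try exact: proj_plus_eigen; exact: proj_minus_eigen.
Qed.

Lemma eigen_coord0 : eigen_coord 0 = 0.
Proof.
have := eigen_coordD 1 0 0; rewrite !scale1r addr0 => /eqP.
by rewrite -subr_eq subrr => /eqP.
Qed.

Lemma eigen_coord_conj v : eigen_coord (c v) = ((eigen_coord v).1, - (eigen_coord v).2).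
Proof.
rewrite /eigen_coord /=; congr pair.
  by rewrite /proj_plus real_structK addrC.
have e : proj_minus v + proj_minus (c v) = 0.
  by rewrite /proj_minus real_structK -scalerDr addrA subrK subrr scaler0.
have m0 : phim 0 = 0.
  by apply: (linear_iso0 hphim); rewrite /eigen_minus /= real_struct0 oppr0.
apply/eqP; rewrite -addr_eq0 addrC.
have := hphim.1 1 _ _ (proj_minus_eigen v) (proj_minus_eigen (c v)).
by rewrite !scale1r e m0 => <-.
Qed.

Lemma eigen_coord_continuous : continuous eigen_coord.
Proof.
pose e1 : C2 R := (1, 0); pose e2 : C2 R := ('i%C, 0).
pose e3 : C2 R := (0, 1); pose e4 : C2 R := (0, 'i%C).
(* The final zero gives every partial sum the shape [k *: u + v] of [eigen_coordD]. *)
have vE v : v = (uncpx v.1).1%:C *: e1 + ((uncpx v.1).2%:C *: e2 +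
    ((uncpx v.2).1%:C *: e3 + ((uncpx v.2).2%:C *: e4 + 0))).
  case: v => [[a b] [p q]] /=; rewrite /GRing.scale /= /GRing.scale /=.
  congr pair; apply/eqP; rewrite eq_complex /=; apply/andP; split; apply/eqP; ring.
have -> : eigen_coord = fun v => (uncpx v.1).1 *: eigen_coord e1 +
   ((uncpx v.1).2 *: eigen_coord e2 + ((uncpx v.2).1 *: eigen_coord e3 +
   ((uncpx v.2).2 *: eigen_coord e4 + 0))).
  by apply/funext => v; rewrite {1}[v]vE !eigen_coordD eigen_coord0.
have c1 := continuous_compose (@continuous_fst R[i]^o R[i]^o) (@uncpx_continuous R).
have c2 := continuous_compose (@continuous_snd R[i]^o R[i]^o) (@uncpx_continuous R).
have c11 := continuous_compose c1 (@continuous_fst _ _).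
have c12 := continuous_compose c1 (@continuous_snd _ _).
have c21 := continuous_compose c2 (@continuous_fst _ _).
have c22 := continuous_compose c2 (@continuous_snd _ _).
do 4 (apply: continuous_add; first by apply: continuous_scale => //; exact: continuous_cst).
exact: continuous_cst.
Qed.

Lemma eigen_coord_homeomorphism : homeomorphism eigen_coord.
Proof.
split; first exact: eigen_coord_continuous.
have [_ [_ injp surjp]] := hphip; have [_ [_ injm surjm]] := hphim.
have lift_p x : exists2 a, eigen_plus f a & phip a = x by have [a] := surjp x I; exists a.
have lift_m x : exists2 a, eigen_minus f a & phim a = x by have [a] := surjm x I; exists a.
have [a1 a1V a1E] := lift_p (1, 0); have [a2 a2V a2E] := lift_p (0, 1).
have [b1 b1V b1E] := lift_m (1, 0); have [b2 b2V b2E] := lift_m (0, 1).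
pose g (y : R4 R) : C2 R := y.1.1%:C *: a1 + (y.1.2%:C *: a2 +
  (y.2.1%:C *: b1 + (y.2.2%:C *: b2 + 0))).
have gE y : g y = (y.1.1%:C *: a1 + y.1.2%:C *: a2) + (y.2.1%:C *: b1 + y.2.2%:C *: b2).
  by rewrite /g addr0 addrA.
have Vp k l : eigen_plus f (k%:C *: a1 + l%:C *: a2).
  by rewrite /eigen_plus /= real_structD !real_structZ a1V a2V.
have Vm k l : eigen_minus f (k%:C *: b1 + l%:C *: b2).
  by rewrite /eigen_minus /= real_structD !real_structZ b1V b2V !scalerN opprD.
have p0 : phip 0 = 0 by apply: (linear_iso0 hphip); exact: real_struct0.
have m0 : phim 0 = 0.
  by apply: (linear_iso0 hphim); rewrite /eigen_minus /= real_struct0 oppr0.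
have basis k l : k *: (1, 0) + l *: (0, 1) = (k, l) :> R2 R.
  have -> : k *: (1, 0) + l *: (0, 1) = (k * 1 + l * 0, k * 0 + l * 1) :> R2 R by [].
  by rewrite !mulr1 !mulr0 addr0 add0r.
have Ep k l : phip (k%:C *: a1 + l%:C *: a2) = (k, l).
  have := hphip.1 l a2 0 a2V (real_struct0); rewrite addr0 p0 addr0 a2E => e.
  rewrite hphip.1//; last by rewrite /eigen_plus /= real_structZ a2V.
  by rewrite e a1E basis.
have Em k l : phim (k%:C *: b1 + l%:C *: b2) = (k, l).
  have V0 : eigen_minus f 0 by rewrite /eigen_minus /= real_struct0 oppr0.
  have := hphim.1 l b2 0 b2V V0; rewrite addr0 m0 addr0 b2E => e.
  rewrite hphim.1//; last by rewrite /eigen_minus /= real_structZ b2V scalerN.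
  by rewrite e b1E basis.
have gK : cancel g eigen_coord.
  move=> y; rewrite gE /eigen_coord proj_plus_sum// proj_minus_sum// Ep Em.
  by case: y => [[? ?] [? ?]].
exists g; split => //.
  have cr (h : R4 R -> R) : continuous h -> continuous (fun y => (h y)%:C : R[i]^o).
    by move=> ch; exact (continuous_compose ch (@real_complex_continuous R)).
  have c1 := @continuous_fst (R2 R) (R2 R); have c2 := @continuous_snd (R2 R) (R2 R).
  have c11 := continuous_compose c1 (@continuous_fst _ _).
  have c12 := continuous_compose c1 (@continuous_snd _ _).
  have c21 := continuous_compose c2 (@continuous_fst _ _).
  have c22 := continuous_compose c2 (@continuous_snd _ _).
  do 4 (apply: continuous_add; first by apply: continuous_scale; [exact: cr|exact: continuous_cst]).
  exact: continuous_cst.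
move=> v.
rewrite gE -[RHS]proj_sum; congr (_ + _).
  apply: injp; first exact/mem_set/Vp.
    exact/mem_set/proj_plus_eigen.
  by rewrite Ep /=; case: (phip _).
apply: injm; first exact/mem_set/Vm.
  exact/mem_set/proj_minus_eigen.
by rewrite Em /=; case: (phim _).
Qed.

End IdentDecomposition.

(** * The logarithmic shear *)

Section LogShear.
Variable R : realType.
Implicit Types (x : R2 R) (k : R) (r : nat).

Definition log_scale x : R2 R := ln (normsq x) *: x.

Lemma log_scale0 : log_scale 0 = 0.
Proof. exact: scaler0. Qed.

Lemma log_scale_continuous : continuous log_scale.
Proof.
move=> x; have [->|x0] := eqVneq x 0; last first.
  have nx : 0 < normsq x by rewrite normsq_gt0.
  apply: cvgZ; last exact: cvg_id.
  exact (continuous_comp (@continuous_normsq R x) (continuous_ln nx)).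
move=> N; rewrite log_scale0 => /nbhs_normsqP[e e0 eN].
(* With n = |y|^2 = s^4 <= 1, ln n = -4 ln(1/s) and 0 <= ln(1/s) < 1/s, so (ln n)^2 n <= 16 s^2. The
   bound by 1 gives the sign of the logarithm, the other one gives s^2 < e / 16. *)
apply/nbhs_normsqP; exists (Num.min 1 ((e / 16) ^+ 2)).
  by rewrite lt_min ltr01 exprn_gt0// divr_gt0.
move=> y; rewrite subr0 lt_min => /andP[y1 ye]; apply: eN; rewrite subr0.
have [->|y0] := eqVneq y 0; first by rewrite log_scale0 normsq0.
rewrite /log_scale normsqZ; have N0 : 0 < normsq y by rewrite normsq_gt0.
set n := normsq y in y1 ye N0 *; pose s := Num.sqrt (Num.sqrt n).
have s0 : 0 < s by rewrite !sqrtr_gt0.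
have s4 : s ^+ 4 = n.
  by rewrite (exprM s 2 2) !sqr_sqrtr ?sqrtr_ge0// ltW.
have s2e : s ^+ 2 < e / 16.
  rewrite /s sqr_sqrtr ?sqrtr_ge0// -(ger0_norm (_ : 0 <= e / 16)) ?divr_ge0 ?ltW//.
  by rewrite -sqrtr_sqr ltr_sqrt// exprn_gt0// divr_gt0.
have lnn : ln n = - (ln s^-1 *+ 4).
  by rewrite lnV ?posrE// -s4 lnXn// mulNrn opprK.
have l0 : 0 <= ln s^-1.
  apply: ln_ge0; rewrite invf_ge1// -(@expr_le1 _ 4) ?ltW//.
  by rewrite s4.
have l1 : ln s^-1 < s^-1 by apply: ln_sublinear; rewrite invr_gt0.
rewrite lnn -s4 sqrrN -[_ *+ 4]mulr_natr.
apply: le_lt_trans (_ : 16 * s ^+ 2 < e); last by rewrite mulrC -ltr_pdivlMr.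
have -> : 16 * s ^+ 2 = (s^-1 * 4) ^+ 2 * s ^+ 4 by field; rewrite gt_eqF.
have l4 : ln s^-1 * 4 <= s^-1 * 4 by rewrite ler_pM2r// ltW.
by rewrite ler_pM2r ?exprn_gt0// ler_pXn2r ?nnegrE ?mulr_ge0 ?invr_ge0 ?(ltW s0).
Qed.

(** This is ln |w|^2 w^(r+1): one factor w accompanies the logarithm to ensure continuity at 0, so
    the exponent exceeds the index by one. *)
Definition shear_term r (w : R[i]^o) : R[i]^o := cpx (log_scale (uncpx w)) * w ^+ r.

Lemma shear_term_continuous r : continuous (shear_term r).
Proof.
apply: continuous_mul; last by apply: continuous_exp => ?; exact: cvg_id.
exact (continuous_compose (continuous_compose (@uncpx_continuous R)
  log_scale_continuous) (@cpx_continuous R)).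
Qed.

Lemma shear_term0 r : shear_term r 0 = 0.
Proof.
by rewrite /shear_term (_ : uncpx 0 = 0)// log_scale0 (_ : cpx 0 = 0)// mul0r.
Qed.

Definition shear k r (v : C2 R) : C2 R := (v.1 + k%:C * shear_term r v.2, v.2).

Lemma shear_homeomorphism k r : homeomorphism (shear k r).
Proof.
have c l : continuous (shear l r).
  apply: continuous_pair; last exact: continuous_snd.
  apply: continuous_add; first exact: continuous_fst.
  apply: continuous_mul; first exact: continuous_cst.
  exact (continuous_compose (@continuous_snd _ _) (@shear_term_continuous r)).
split; first exact: c.
exists (shear (- k) r); split; first exact: c.
  by case=> z w; rewrite /shear /= rmorphN mulNr addrK.
by case=> z w; rewrite /shear /= rmorphN mulNr subrK.
Qed.

Lemma shear0 k r : shear k r 0 = 0.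
Proof.
by rewrite /shear /= shear_term0 mulr0 addr0.
Qed.

Lemma shear_conj k r (v : C2 R) :
  shear k r (conjc v.1, conjc v.2) = (conjc (shear k r v).1, conjc (shear k r v).2).
Proof.
rewrite /shear /=; congr pair.
have -> : shear_term r (conjc v.2) = conjc (shear_term r v.2).
  have -> : shear_term r (conjc v.2) = cpx (log_scale (uncpx (conjc v.2))) * (conjc v.2) ^+ r by [].
  have -> : conjc (shear_term r v.2) = conjc (cpx (log_scale (uncpx v.2))) * (conjc v.2) ^+ r.
    by rewrite rmorphM rmorphXn.
  congr (_ * _); case: (v.2) => a b; rewrite /log_scale /uncpx /=.
  have -> : normsq (a, - b) = normsq (a, b) by rewrite /normsq /cdot /= mulrNN.
  exact: (congr1 (Complex _) (mulrN _ _)).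
have cD (a b : R[i]) : conjc (a + b) = conjc a + conjc b by exact: rmorphD.
have cM (a b : R[i]) : conjc (a * b) = conjc a * conjc b by exact: rmorphM.
by rewrite [RHS]cD; congr (_ + _); rewrite [RHS]cM conjc_real.
Qed.

Lemma log_scaleM (d : R) (w : R[i]^o) : d != 0 -> w != 0 ->
  cpx (log_scale (uncpx (d%:C * w))) =
  d%:C * cpx (log_scale (uncpx w)) + (d * ln (d ^+ 2))%:C * w.
Proof.
move=> d0 w0.
have -> : uncpx (d%:C * w) = d *: uncpx w.
  by case: w {w0} => a b; rewrite /uncpx /= !mul0r subr0 addr0.
have n0 : 0 < normsq (uncpx w).
  by rewrite normsq_gt0; apply: contra w0 => /eqP e; rewrite -[w]uncpxK e.
have d2 : 0 < d ^+ 2 by rewrite exprn_even_gt0.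
rewrite /log_scale normsqZ lnM ?posrE// scalerA !cpxZ uncpxK.
rewrite [(d * ln _)%:C]rmorphM/= rmorphM rmorphD /=; ring.
Qed.

(** Multiplying w by d adds ln (d^2) to the logarithm, so the shear produces the extra term k
    d^(r+1) ln (d^2) w^(r+1). The value of [k] makes its coefficient 1; the logarithm is nonzero
    since |d| < 1. *)
Lemma shear_conjugates (d : R) r (v : C2 R) : 0 < `|d| < 1 ->
  let k := (d ^+ r.+1 * ln (d ^+ 2))^-1 in
  ((d%:C : R[i]) ^+ r.+1 * (shear k r v).1 + (shear k r v).2 ^+ r.+1,
   d%:C * (shear k r v).2) = shear k r ((d%:C : R[i]) ^+ r.+1 * v.1, d%:C * v.2).
Proof.
move=> /andP[d0 d1] k; rewrite normr_gt0 in d0.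
case: v => z w; rewrite /shear /=; congr pair.
have l0 : ln (d ^+ 2) != 0.
  rewrite ln_eq0 ?exprn_even_gt0// -real_normK ?num_real//.
  by rewrite lt_eqF// exprn_ilt1.
have kE : k%:C * ((d ^+ r.+1 * ln (d ^+ 2))%:C) = 1 :> R[i].
  by rewrite -rmorphM /k mulVf ?rmorph1// mulf_neq0// expf_neq0.
have [->|w0] := eqVneq w 0.
  by rewrite mulr0 shear_term0 mulr0 !addr0 expr0n /= addr0.
rewrite /shear_term log_scaleM// exprMn.
set L := cpx _.
transitivity ((d%:C : R[i]) ^+ r.+1 * z + (d%:C : R[i]) ^+ r.+1 * (k%:C * (L * w ^+ r)) +
   k%:C * ((d ^+ r.+1 * ln (d ^+ 2))%:C) * w ^+ r.+1).
  by rewrite kE mul1r mulrDr.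
rewrite !rmorphM rmorphXn /= !exprS; ring.
Qed.

End LogShear.

(** * Normal forms with real coefficients *)

Section Normalization.
Variable R : realType.
Implicit Types (x : R2 R) (y : R4 R) (a d s p : R) (v : C2 R).

Definition sdiag s d x : R2 R := (s * x.1, d * x.2).

Lemma sdiagZ s d a x : sdiag s d (a *: x) = a *: sdiag s d x.
Proof.
by rewrite /sdiag; case: x => u w /=; congr pair; rewrite /GRing.scale /= mulrCA.
Qed.

Lemma normsq_sdiag s d x : s ^+ 2 = 1 -> d ^+ 2 = 1 -> normsq (sdiag s d x) = normsq x.
Proof.
move=> s1 d1; rewrite /normsq /cdot /=.
transitivity (s ^+ 2 * (x.1 * x.1) + d ^+ 2 * (x.2 * x.2)); first by ring.
by rewrite s1 d1 !mul1r.
Qed.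

Lemma radial_expR p t x : 0 < p -> radial p (expR t *: x) = expR (t * p) *: radial p x.
Proof. by move=> p0; rewrite radialZ ?expR_gt0// expRM. Qed.

Lemma radialN p x : radial p (- x) = - radial p x.
Proof. by rewrite /radial normsqN scalerN. Qed.

(** Exchanges the splitting into eigenplanes, real parts and imaginary parts, with the splitting
    into the two complex coordinates. *)
Definition transpose y : R4 R := ((y.1.1, y.2.1), (y.1.2, y.2.2)).

Lemma transpose_continuous : continuous transpose.
Proof.
have c1 := @continuous_fst (R2 R) (R2 R); have c2 := @continuous_snd (R2 R) (R2 R).
have c11 := continuous_compose c1 (@continuous_fst _ _).
have c12 := continuous_compose c1 (@continuous_snd _ _).
have c21 := continuous_compose c2 (@continuous_fst _ _).
have c22 := continuous_compose c2 (@continuous_snd _ _).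
exact (continuous_pair (continuous_pair c11 c21) (continuous_pair c12 c22)).
Qed.

Lemma transpose_homeomorphism : homeomorphism transpose.
Proof.
split; first exact: transpose_continuous.
by exists transpose; split; [exact: transpose_continuous|case=> [[? ?] [? ?]]..].
Qed.

Lemma homeomorphism_id (T : topologicalType) : homeomorphism (@id T).
Proof. by split; [move=> ?; exact: cvg_id|exists id; split => // ?; exact: cvg_id]. Qed.

Lemma radial_sdiag p s d x : s ^+ 2 = 1 -> d ^+ 2 = 1 ->
  radial p (sdiag s d x) = sdiag s d (radial p x).
Proof.
move=> s1 d1; apply: radial_isometry => [z|k z]; first exact: normsq_sdiag.
exact: sdiagZ.
Qed.

(** After [transpose], each complex coordinate is adjusted by the power of the radius that turns
    exp(-1) into |a| or |d|. The signs of a and d act alike on real and imaginary parts, which gives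
    the same signed diagonal map on both eigenplanes. *)
Lemma diag_normalization a d : 0 < `|a| < 1 -> 0 < `|d| < 1 ->
  exists eta : R4 R -> C2 R, [/\ homeomorphism eta, eta 0 = 0,
    forall y, eta (y.1, - y.2) = (conjc (eta y).1, conjc (eta y).2) &
    forall y, (a%:C * (eta y).1, d%:C * (eta y).2) =
      eta (expR (- 1) *: sdiag (Num.sg a) (Num.sg d) y.1,
           expR (- 2^-1) *: sdiag (Num.sg a) (Num.sg d) y.2)].
Proof.
move=> /andP[a0 a1] /andP[d0 d1].
pose p := - ln `|a|; pose q := - ln `|d|.
have p0 : 0 < p by rewrite /p oppr_gt0 ln_lt0// a0.
have q0 : 0 < q by rewrite /q oppr_gt0 ln_lt0// d0.
have sg1 (b : R) : 0 < `|b| -> Num.sg b ^+ 2 = 1 by rewrite normr_gt0 => b0; rewrite sqr_sg b0.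
have rad (b : R) x : 0 < `|b| -> 0 < - ln `|b| ->
    radial (- ln `|b|) (expR (- 1) *: (Num.sg b *: x)) = b *: radial (- ln `|b|) x.
  move=> b0 l0; rewrite radial_expR// mulN1r opprK lnK ?posrE//.
  rewrite (@radial_isometry _ _ (fun x => Num.sg b *: x)).
  - by rewrite scalerA mulrC -numEsg.
  - by move=> z; rewrite normsqZ sg1// mul1r.
  - by move=> c z; rewrite !scalerA mulrC.
(* [radial 2] turns the rate exp(-1/2) prescribed on [y.2] into exp(-1); real and imaginary parts
   must contract equally before they are recombined. *)
pose g1 (y : R4 R) : R4 R := (y.1, radial 2 y.2).
pose g3 (y : R4 R) : C2 R := (cpx (radial p y.1), cpx (radial q y.2)).
pose eta := g3 \o (transpose \o g1).
exists eta; split.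
- apply: homeomorphism_comp.
    apply: homeomorphism_comp transpose_homeomorphism.
    apply: (homeomorphism_pair (@homeomorphism_id _)).
    by apply: radial_homeomorphism.
  apply: (homeomorphism_pair (h := cpx (R := R) \o radial p) (k := cpx (R := R) \o radial q)).
    exact: homeomorphism_comp (radial_homeomorphism p0) (@cpx_homeomorphism R).
  exact: homeomorphism_comp (radial_homeomorphism q0) (@cpx_homeomorphism R).
- have e1 : g1 0 = 0 by rewrite /g1 [radial 2 _]radial0.
  have e2 : transpose 0 = 0 by [].
  by rewrite /eta /comp e1 e2 /g3 [radial p _]radial0 [radial q _]radial0.
- move=> y.
  have -> : eta (y.1, - y.2) = g3 (transpose (y.1, - radial 2 y.2)).
    by rewrite /eta /comp /g1 radialN.
  have E r (u : R2 R) : cpx (radial r (u.1, - u.2)) = conjc (cpx (radial r u)).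
    have -> : (u.1, - u.2) = sdiag 1 (- 1) u by rewrite /sdiag mul1r mulN1r.
    rewrite radial_sdiag ?expr1n ?sqrrN ?expr1n// /sdiag /cpx /=.
    by rewrite mul1r mulN1r.
  by rewrite -!E.
- move=> y; pose u := transpose (y.1, radial 2 y.2).
  have -> : (a%:C * (eta y).1, d%:C * (eta y).2) =
      (cpx (a *: radial p u.1), cpx (d *: radial q u.2)).
    congr pair; [exact: esym (cpxZ a _)|exact: esym (cpxZ d _)].
  rewrite -!rad// /eta /comp /g1 (@radial_expR 2)// (@radial_sdiag 2) ?sg1//.
  by have -> : - 2^-1 * 2 = - 1 :> R by lra.
Qed.

Lemma real_conj_diag (f : normal_form R) : admissible f -> real_coefs f ->
  exists a d, [/\ diag_coefs f = (a%:C, d%:C), 0 < `|a| < 1, 0 < `|d| < 1 &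
  exists h : C2 R -> C2 R, [/\ homeomorphism h, h 0 = 0,
    forall v, h (conjc v.1, conjc v.2) = (conjc (h v).1, conjc (h v).2) &
    forall v, map_of f (h v) = h (a%:C * v.1, d%:C * v.2)]].
Proof.
move=> hf /andP[/complex_realP[a aE] /complex_realP[d dE]].
have nC (b : R) : (0 < `|b%:C : R[i]| < 1) = (0 < `|b| < 1).
  by rewrite normc_def /= expr0n addr0 sqrtr_sqr !ltcR.
have hid : exists h : C2 R -> C2 R, [/\ homeomorphism h, h 0 = 0,
    forall v, h (conjc v.1, conjc v.2) = (conjc (h v).1, conjc (h v).2) &
    forall v, h v = v].
  by exists id; split => //; exact: homeomorphism_id.
have pown r (b : R) : (0 < r)%N -> 0 < `|b| < 1 -> 0 < `|b ^+ r| < 1.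
  by move=> r0 /andP[b0 b1]; rewrite normrX exprn_gt0//= exprn_ilt1// -lt0n.
exists a, d; have E : diag_coefs f = (a%:C, d%:C).
  by rewrite -aE -dE; case: (diag_coefs f).
have dX r : ((d ^+ r)%:C : R[i]) = d%:C ^+ r by rewrite rmorphXn.
case: f hf E {aE dE} => /=.
- move=> b b01 [bE bE']; rewrite bE nC in b01; have ad : a = d.
    by apply: complexI; rewrite -bE.
  rewrite -ad bE; split=> //; have [h [hh h0 hc hv]] := hid.
  by exists h; split => // v; rewrite !hv /=.
- move=> r b [r2 b01] [bE bE']; rewrite bE' nC in b01.
  have ad : a = d ^+ r by apply: complexI; rewrite -bE bE' dX.
  rewrite bE' ad dX; split=> //; first by apply: pown => //; apply: leq_trans r2.
  have [h [hh h0 hc hv]] := hid.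
  by exists h; split => // v; rewrite !hv /=.
- case=> [|r] b [r2 b01] [bE bE'] //; rewrite bE' nC in b01.
  have ad : a = d ^+ r.+1 by apply: complexI; rewrite -bE bE' dX.
  rewrite bE' ad dX; split=> //; first exact: pown.
  exists (shear (d ^+ r.+1 * ln (d ^+ 2))^-1 r); split.
  - exact: shear_homeomorphism.
  - exact: shear0.
  - by move=> v; rewrite shear_conj.
  - by move=> v; rewrite -shear_conjugates.
- move=> b b01 [bE bE']; rewrite bE nC in b01; have ad : a = d.
    by apply: complexI; rewrite -bE.
  rewrite bE -ad; split=> //.
  (* The form [IIb] has the shape of [IIa] with exponent 1, hence the shear of index 0. *)
  exists (shear (a ^+ 1 * ln (a ^+ 2))^-1 0); split.
  - exact: shear_homeomorphism.
  - exact: shear0.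
  - by move=> v; rewrite shear_conj.
  - by move=> v; rewrite -[X in (X * _, _)]expr1 -shear_conjugates//= expr1.
- move=> b c [b01 c01 _] [bE bE']; rewrite bE nC in b01; rewrite bE' nC in c01.
  rewrite bE bE'; split=> //; have [h [hh h0 hc hv]] := hid.
  by exists h; split => // v; rewrite !hv /=.
Qed.

End Normalization.

(** * The swapped real structure and the common normal form *)

Section Normalization.
Variable R : realType.
Implicit Types (x : R2 R) (y : R4 R) (p : R) (v : C2 R).

(** The eigenplanes of (z, w) -> (conj w, conj z) consist of the vectors (z, conj z) and (z, - conj
    z). Conjugating the second component of [sum_diff] adds a vector of each. *)
Definition sum_diff y : R4 R := (y.1 + y.2, y.1 - y.2).

Lemma sum_diff_homeomorphism : homeomorphism sum_diff.
Proof.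
have c1 := @continuous_fst (R2 R) (R2 R); have c2 := @continuous_snd (R2 R) (R2 R).
have c : continuous sum_diff.
  by apply: continuous_pair; [exact: continuous_add|exact: continuous_sub].
have halfD (x : R2 R) : 2^-1 *: (x + x) = x.
  by rewrite scalerDr -scalerDl (_ : 2^-1 + 2^-1 = 1) ?scale1r//; field.
have E1 (x u : R2 R) : x + u + (x - u) = x + x by rewrite addrACA subrr addr0.
have E2 (x u : R2 R) : x + u - (x - u) = u + u.
  by rewrite opprB [x + u]addrC addrACA subrr addr0.
split => //; exists (fun y => 2^-1 *: sum_diff y); split.
- by apply: continuous_scale => //; exact: continuous_cst.
- case=> x u; have -> : 2^-1 *: sum_diff (sum_diff (x, u)) =
    (2^-1 *: (x + u + (x - u)), 2^-1 *: (x + u - (x - u))) by [].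
  by rewrite E1 E2 !halfD.
- case=> x u; have -> : sum_diff (2^-1 *: sum_diff (x, u)) =
    (2^-1 *: (x + u) + 2^-1 *: (x - u), 2^-1 *: (x + u) - 2^-1 *: (x - u)) by [].
  by rewrite -scalerDr -scalerBr E1 E2 !halfD.
Qed.

Lemma cpx_conj x : cpx (sdiag 1 (- 1) x) = conjc (cpx x).
Proof. by rewrite /cpx /sdiag /= mul1r mulN1r. Qed.

Lemma cpx_polarM r a x : cpx (polar r a) * cpx x = cpx (r *: rot a x).
Proof.
rewrite /cpx /polar /rot; case: x => u w /=; apply/eqP; rewrite eq_complex /=.
by apply/andP; split; apply/eqP; rewrite /GRing.scale /=; ring.
Qed.

Lemma sdiag_homeomorphism s d : s ^+ 2 = 1 -> d ^+ 2 = 1 -> homeomorphism (@sdiag R s d).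
Proof.
move=> s1 d1; have c : continuous (@sdiag R s d).
  apply: continuous_pair; apply: continuous_mul; try exact: continuous_cst.
    exact: continuous_fst.
  exact: continuous_snd.
have K : cancel (@sdiag R s d) (@sdiag R s d).
  by case=> u w; rewrite /sdiag /= !mulrA -!expr2 s1 d1 !mul1r.
by split => //; exists (@sdiag R s d).
Qed.

(** The map multiplies the parameter z of each eigenplane by [al]: it scales both planes by |al| and
    rotates both by the argument of [al]. *)
Lemma swap_normalization (al : R[i]) : 0 < `|al| < 1 ->
  exists phi (eta : R4 R -> C2 R), [/\ homeomorphism eta, eta 0 = 0,
    forall y, eta (y.1, - y.2) = (conjc (eta y).2, conjc (eta y).1) &
    forall y, (al * (eta y).1, conjc al * (eta y).2) =
      eta (expR (- 1) *: rot phi y.1, expR (- 2^-1) *: rot phi y.2)].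
Proof.
move=> /andP[al0 al1].
have al00 : uncpx al != 0.
  apply: contraTneq al0 => e; rewrite -[al]uncpxK e (_ : cpx 0 = 0)//.
  by rewrite normr0 ltxx.
have [r r0 [phi aE]] := polar_surj al00.
have alE : al = cpx (polar r phi) by rewrite -aE uncpxK.
have r1 : r < 1.
  move: al1; rewrite alE norm_cpx -[normsq _]/(cdot _ _) cdot_polar sqrtr_sqr ger0_norm ?ltW//.
  by rewrite (_ : 1 = 1%:C :> R[i])// ltcR.
exists phi; pose p := - ln r; have p0 : 0 < p by rewrite oppr_gt0 ln_lt0// r0.
have p20 : 0 < p * 2 by rewrite mulr_gt0.
(* exp(-1) to the power p and exp(-1/2) to the power 2 p both equal r. *)
pose g1 (y : R4 R) : R4 R := (radial p y.1, radial (p * 2) y.2).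
pose g3 (y : R4 R) : C2 R := (cpx y.1, cpx (sdiag 1 (- 1) y.2)).
pose eta := g3 \o (sum_diff \o g1); exists eta; split.
- apply: homeomorphism_comp.
    apply: homeomorphism_comp sum_diff_homeomorphism.
    by apply: homeomorphism_pair; exact: radial_homeomorphism.
  apply: (homeomorphism_pair (h := cpx (R := R)) (k := cpx (R := R) \o sdiag 1 (- 1))).
    exact: cpx_homeomorphism.
  apply: homeomorphism_comp (@cpx_homeomorphism R).
  by apply: sdiag_homeomorphism; rewrite ?sqrrN expr1n.
- have e1 : g1 0 = 0 by rewrite /g1 [radial p _]radial0 [radial (p * 2) _]radial0.
  have e2 : sum_diff 0 = 0 by rewrite /sum_diff addr0 subr0.
  by rewrite /eta /comp e1 e2 /g3 cpx_conj; congr pair; exact: conjc0.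
- move=> y; have -> : eta (y.1, - y.2) =
    g3 (sum_diff (radial p y.1, - radial (p * 2) y.2)).
    by rewrite /eta /comp /g1 radialN.
  set z := radial p y.1; set w := radial (p * 2) y.2.
  have -> : g3 (sum_diff (z, - w)) = (cpx (z - w), conjc (cpx (z - - w))).
    by rewrite -cpx_conj.
  have -> : eta y = (cpx (z + w), conjc (cpx (z - w))) by rewrite -cpx_conj.
  by rewrite opprK; congr pair; exact: esym (conjcK _).
- move=> y.
  have radr q x : 0 < q -> radial q (rot phi x) = rot phi (radial q x).
    move=> q0; apply: radial_isometry => [z|k z]; first exact: normsq_rot.
    exact: rotZ.
  have E1 : radial p (expR (- 1) *: rot phi y.1) = r *: rot phi (radial p y.1).
    by rewrite radial_expR// radr// mulN1r opprK lnK ?posrE.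
  have E2 : radial (p * 2) (expR (- 2^-1) *: rot phi y.2) = r *: rot phi (radial (p * 2) y.2).
    rewrite radial_expR// radr// (_ : - 2^-1 * (p * 2) = ln r) ?lnK ?posrE//.
    by rewrite /p; field.
  have rotD' u w : rot phi (u + w) = rot phi u + rot phi w :> R2 R.
    by rewrite /rot; congr pair => /=; ring.
  have rotB' u w : rot phi (u - w) = rot phi u - rot phi w :> R2 R.
    by rewrite /rot; congr pair => /=; ring.
  rewrite /eta /comp /g1 E1 E2 /g3 /sum_diff.
  rewrite -scalerDr -scalerBr -rotD' -rotB' !cpx_conj -!cpx_polarM -alE.
  by congr pair; exact/esym/rmorphM.
Qed.

Lemma normalization (f : normal_form R) :
  admissible f -> real_coefs f \/ is_IIc' f ->
  exists eta : R4 R -> C2 R, [/\ homeomorphism eta, eta 0 = 0,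
    forall y, eta (y.1, - y.2) = real_struct f (eta y) &
    (exists2 phi, 0 < (diag_coefs f).1 * (diag_coefs f).2 &
      forall y, map_of f (eta y) =
        eta (expR (- 1) *: rot phi y.1, expR (- 2^-1) *: rot phi y.2)) \/
    ([/\ (diag_coefs f).1 * (diag_coefs f).2 < 0, real_coefs f &
      forall y, map_of f (eta y) =
        eta (expR (- 1) *: sdiag 1 (- 1) y.1, expR (- 2^-1) *: sdiag 1 (- 1) y.2)])].
Proof.
move=> hf; case: (boolP (is_IIc' f)) => [hc _|hc].
  have : exists al, 0 < `|al| < 1 /\ f = IIc al (conjc al).
    by case: f hf hc => // a d [a01 _ _] /andP[/eqP -> _]; exists a.
  move=> [al [al01 fE]]; have [phi [eta [eh e0 ec ef]]] := swap_normalization al01.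
  exists eta; split => //; first by move=> y; rewrite ec /real_struct hc.
  left; exists phi.
    (* The product of the two conjugate coefficients is |al|^2. *)
    by rewrite fE /= -[al * _]normCK exprn_gt0//; case/andP: al01.
  by move=> y; rewrite -ef fE.
case=> // hr; have [a [d [adE a01 d01 [h [hh h0 hcj hm]]]]] := real_conj_diag hf hr.
have [eta [eh e0 ec ef]] := diag_normalization a01 d01.
have rs v : real_struct f v = (conjc v.1, conjc v.2).
  by rewrite /real_struct (negbTE hc).
have eta'h : homeomorphism (h \o eta) by exact: homeomorphism_comp.
have eta'0 : (h \o eta) 0 = 0 by rewrite /= e0.
have eta'c y : (h \o eta) (y.1, - y.2) = real_struct f ((h \o eta) y).
  by rewrite /= ec hcj rs.
have eta'f y : map_of f ((h \o eta) y) = (h \o eta)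
   (expR (- 1) *: sdiag (Num.sg a) (Num.sg d) y.1,
    expR (- 2^-1) *: sdiag (Num.sg a) (Num.sg d) y.2).
  by rewrite /= hm ef.
have prodE : (diag_coefs f).1 * (diag_coefs f).2 = (a * d)%:C by rewrite adE rmorphM.
have C0 : 0 = 0%:C :> R[i] by [].
move: a01 d01 => /andP[a0 _] /andP[d0 _]; rewrite !normr_gt0 in a0 d0.
have [ap|an|] := ltgtP 0 a; last by move=> /eqP; rewrite eq_sym (negbTE a0).
  have [dp|dn|] := ltgtP 0 d; last by move=> /eqP; rewrite eq_sym (negbTE d0).
    exists (h \o eta); split => //; left; exists 0; first by rewrite prodE C0 ltcR mulr_gt0.
    move=> y; rewrite eta'f (gtr0_sg ap) (gtr0_sg dp) !rot0.
    by congr ((h \o eta) (_ *: _, _ *: _)); rewrite /sdiag !mul1r -surjective_pairing.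
  exists (h \o eta); split => //; right; split => //; first by rewrite prodE C0 ltcR pmulr_rlt0.
  by move=> y; rewrite eta'f (gtr0_sg ap) (ltr0_sg dn).
have [dp|dn|] := ltgtP 0 d; last by move=> /eqP; rewrite eq_sym (negbTE d0).
  (* Exchanging the two coordinates of both planes reduces the signs (-1, 1) to (1, -1). *)
  pose sw (x : R2 R) : R2 R := (x.2, x.1).
  have swc : continuous sw.
    by apply: continuous_pair; [exact: continuous_snd|exact: continuous_fst].
  have swh : homeomorphism sw by split => //; exists sw; split => //; case.
  exists ((h \o eta) \o (fun y : R4 R => (sw y.1, sw y.2))); split.
  - by apply: homeomorphism_comp => //; exact: homeomorphism_pair.
  - by rewrite -[RHS]eta'0.
  - by move=> y; rewrite /= -[RHS]eta'c.
  right; split => //; first by rewrite prodE C0 ltcR nmulr_rlt0.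
  by move=> y; rewrite [LHS]eta'f (ltr0_sg an) (gtr0_sg dp).
(* Two negative signs amount to a half turn of each eigenplane. *)
exists (h \o eta); split => //; left; exists pi; first by rewrite prodE C0 ltcR nmulr_rgt0.
move=> y; rewrite eta'f (ltr0_sg an) (ltr0_sg dn).
by congr ((h \o eta) (_ *: _, _ *: _)); rewrite /sdiag /rot cospi sinpi !mul0r subr0 add0r.
Qed.

End Normalization.

(** * The induced contraction *)

Section SquareQuotient.
Variable R : realType.

Definition square_snd (y : R4 R) : R4 R := (y.1, sqr_map y.2).

Lemma square_snd_quotient_map : quotient_map square_snd.
Proof.
apply: open_quotient_map.
- apply: continuous_pair; first exact: continuous_fst.
  exact (continuous_compose (@continuous_snd _ _) (@sqr_map_continuous R)).
- by case=> x u; have [w <-] := sqr_map_surj u; exists (x, w).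
- move=> p N; apply: (open_pair (h := id)) => [x M|x M].
    by rewrite image_id.
  exact: sqr_map_open.
Qed.

Lemma square_snd_open p N : nbhs p N -> nbhs (square_snd p) (square_snd @` N).
Proof.
apply: (open_pair (h := id)) => [x M|x M]; first by rewrite image_id.
exact: sqr_map_open.
Qed.

Lemma square_snd_eq y y' :
  square_snd y = square_snd y' <-> y = y' \/ y = (y'.1, - y'.2).
Proof.
case: y y' => [x u] [x' u']; rewrite /square_snd /=; split.
  move=> e; have := congr1 fst e; have := congr1 snd e => /= /sqr_map_eq[] -> ->.
    by left.
  by right.
by case=> e; have := congr1 fst e; have := congr1 snd e => /= -> ->; rewrite ?sqr_mapN.
Qed.

End SquareQuotient.

(** * Identification of the quotient and of the fixed locus *)

Section Assembly.
Variables (R : realType) (f : normal_form R).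
Hypotheses (hf : admissible f) (hreal : real_coefs f \/ is_IIc' f).
Variables phip phim : C2 R -> R2 R.
Hypotheses (hphip : linear_iso_on (eigen_plus f) phip)
  (hphim : linear_iso_on (eigen_minus f) phim).
Variable eta : R4 R -> C2 R.
Hypotheses (eta_homeo : homeomorphism eta) (eta0 : eta 0 = 0)
  (eta_conj : forall y, eta (y.1, - y.2) = real_struct f (eta y)).
Variables (f0 : R4 R -> R4 R) (Phi : R -> R4 R -> R4 R) (M0 : R2 R -> R2 R).
Hypotheses (f0_inj : injective f0) (f0E : forall y, map_of f (eta y) = eta (f0 y))
  (Phi1E : forall y, Phi 1 (square_snd y) = square_snd (f0 y))
  (Phi1_plane : forall x, Phi 1 (x, 0) = (M0 x, 0))
  (M0_homeo : homeomorphism M0)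
  (Phi_cont : continuous (fun p : R * R4 R => Phi p.1 p.2))
  (Phi0 : forall x, Phi 0 x = x)
  (PhiD : forall s t x, Phi (s + t) x = Phi s (Phi t x))
  (NfPhi : forall t x, norm4sq (Phi t x) = expR (- (2 * t)) * norm4sq x).

Local Notation c := (real_struct f).
Local Notation L := (eigen_coord f phip phim).
Local Notation id4 := (ident f phip phim).
Implicit Types (v w : C2 R) (x : R2 R) (y : R4 R).

Let L_homeo : homeomorphism L := eigen_coord_homeomorphism hphip hphim.

Lemma eta_inj : injective eta.
Proof. by have [_ [g [_ K _]]] := eta_homeo; exact: can_inj K. Qed.

Lemma eta_surj v : exists y, eta y = v.
Proof. by have [_ [g [_ _ K]]] := eta_homeo; exists (g v). Qed.

Lemma eigen_coord_inj : injective L.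
Proof. by have [_ [g [_ K _]]] := L_homeo; exact: can_inj K. Qed.

Lemma map_of_inj : injective (map_of f).
Proof.
move=> v w; have [y <-] := eta_surj v; have [y' <-] := eta_surj w.
by rewrite !f0E => /eta_inj/f0_inj ->.
Qed.

Lemma ident_square v : id4 v = square_snd (L v).
Proof. by []. Qed.

Lemma ident_eq v w : id4 v = id4 w <-> v = w \/ v = c w.
Proof.
rewrite !ident_square square_snd_eq -eigen_coord_conj//; split.
  by case=> /eigen_coord_inj; [left|right].
by case=> ->; [left|right].
Qed.

Lemma ident_eq0 v : (id4 v == 0) = (v == 0).
Proof.
have i0 : id4 0 = 0.
  by rewrite ident_square eigen_coord0//; congr pair; exact: sqr_map0.
apply/eqP/eqP => [|-> //]; rewrite -i0 => /ident_eq[->//|->].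
exact: real_struct0.
Qed.

Lemma ident_quotient_map : quotient_map id4.
Proof.
have -> : id4 = @square_snd R \o L by [].
apply: quotient_map_comp; last exact: square_snd_quotient_map.
exact: homeomorphism_quotient_map.
Qed.

Lemma ident_continuous : continuous id4.
Proof. exact: quotient_map_continuous ident_quotient_map. Qed.

Lemma ident_open v N : nbhs v N -> nbhs (id4 v) (id4 @` N).
Proof.
move=> /(homeomorphism_open L_homeo) /square_snd_open.
by rewrite image_comp.
Qed.

(** [eta] intertwines (x, u) -> (x, -u) with the real structure, so it descends to the quotients,
    both of which are modelled on [R4 R]. *)
Lemma chart_exists : exists2 S : R4 R -> R4 R, homeomorphism S &
  forall y, S (square_snd y) = id4 (eta y).
Proof.
apply: (quotient_map_homeomorphism (q := id4 \o eta)).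
- exact: square_snd_quotient_map.
- apply: quotient_map_comp ident_quotient_map.
  exact: homeomorphism_quotient_map.
move=> y y'; rewrite square_snd_eq /= ident_eq -eta_conj; split.
  by case=> ->; [left|right].
by case=> /eta_inj; [left|right].
Qed.

(** [F] is the time-one map transported by the chart. The last two clauses prepare the third
    statement: conjugacy with [M0] determines the quotient of the plane, and the relation with [f]
    on [V_+] gives access to the orientation of [F0]. *)
Lemma assembly : exists F : R4 R -> R4 R,
  [/\ forall v, F (id4 v) = id4 (map_of f v), punctured_contraction F &
  exists Psi : hopf_quotient f -> punctured_quotient F,
  [/\ [/\ orientation_preserving 3 F, homeomorphism Psi,
        (forall v : punctured (C2 R), exists2 y : punctured (R4 R),
           \val y = id4 (\val v) &
           Psi (hopf_quotient_class (hopf_class f v)) = punctured_class F y) &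
        homeomorphic (hopf_quotient f) (circle R * sphere3 R)%type],
     F @` [set y : R4 R | y.1 != 0 /\ y.2 = 0] = [set y : R4 R | y.1 != 0 /\ y.2 = 0] &
     exists F0 : R2 R -> R2 R,
     [/\ forall x, F (x, 0) = (F0 x, 0), punctured_contraction F0,
        (exists2 Chi : fixed_locus f -> punctured_quotient F0,
           homeomorphism Chi &
           forall h : fixed_locus f,
           exists (x : punctured (R2 R)) (y : punctured (R4 R)),
           [/\ Chi h = punctured_class F0 x, \val y = (\val x, 0) &
               Psi (hopf_quotient_class (\val h)) = punctured_class F y]),
        (exists S0 : R2 R -> R2 R, [/\ homeomorphism S0,
           forall x, (S0 x == 0) = (x == 0) & forall x, F0 (S0 x) = S0 (M0 x)]) &
        forall v, c v = v -> F0 (phip v) = phip (map_of f v)]]].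
Proof.
have [S S_homeo SE] := chart_exists.
have [T T_homeo [SK TK]] := homeomorphism_inv S_homeo.
have Q0 : square_snd 0 = 0 :> R4 R by congr pair; exact: sqr_map0.
have S0 : S 0 = 0 by rewrite -[in LHS]Q0 SE eta0; apply/eqP; rewrite ident_eq0.
have S_eq0 y : (S y == 0) = (y == 0) by rewrite -[in LHS]S0 (can_eq SK).
pose F y := S (Phi 1 (T y)).
have FS y : F (S y) = S (Phi 1 y) by rewrite /F SK.
have FI v : F (id4 v) = id4 (map_of f v).
  by have [y <-] := eta_surj v; rewrite f0E -!SE FS Phi1E.
have F_contr : punctured_contraction F.
  apply: (@flow_contraction R (R4 R) Phi (@norm4sq R) Phi_cont Phi0 PhiD
    (@norm4sq_continuous R) (@norm4sq_ge0 R) (@norm4sq_eq0 R) NfPhi F S S_homeo S_eq0 FS).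
    exact: compact_ball4.
  exact: nbhs_norm4sq.
have F_or : orientation_preserving 3 F.
  exact: (@flow_isotopy R (R4 R) Phi Phi_cont Phi0 PhiD F S S_homeo FS).
have F_torus : homeomorphic (punctured_quotient F) (circle R * sphere3 R)%type.
  exact: (@flow_torus R (R4 R) Phi (@norm4sq R) Phi_cont Phi0 PhiD
    (@norm4sq_continuous R) (@norm4sq_ge0 R) (@norm4sq_eq0 R) NfPhi F S S_homeo S_eq0 FS).
exists F; split => //.
have F_iter m v : iter m F (id4 v) = id4 (iter m (map_of f) v).
  by elim: m => //= m ->; rewrite FI.
have f_iter m v : iter m (map_of f) (c v) = c (iter m (map_of f) v).
  by elim: m => //= m ->; rewrite real_struct_map.
have id_c v : id4 (c v) = id4 v by apply/ident_eq; right.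
have id_c_iter m v : id4 (iter m c v) = id4 v by elim: m => //= m <-; rewrite id_c.
pose idW := @punctured_map R[i] R (C2 R) (R4 R) id4 ident_eq0.
have qW : quotient_map (@punctured_class _ _ F \o idW).
  apply: quotient_map_comp; last exact: punctured_class_quotient_map.
  apply: punctured_map_quotient_map; [exact: ident_continuous|exact: ident_quotient_map.1|].
  exact: ident_open.
have pW : quotient_map (@hopf_quotient_class R f \o @hopf_class R f).
  apply: quotient_map_comp; first exact: punctured_class_quotient_map.
  exact: orbit_class_quotient_map.
have s_iter m (v : punctured (C2 R)) :
    iter m (@standard_real_structure R f) (hopf_class f v) =
    hopf_class f (iter m (real_structW f) v).
  elim: m => [|m IH]; first exact: erefl.
  rewrite [LHS]iterS [in RHS]iterS IH; exact: standard_real_structure_class.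
have cW_iter m (v : punctured (C2 R)) :
    \val (iter m (real_structW f) v) = iter m c (\val v).
  elim: m => [|m IH]; first exact: erefl.
  rewrite [in LHS]iterS [RHS]iterS -IH; exact: erefl.
have clsE (v w : punctured (C2 R)) : hopf_class f v = hopf_class f w <->
    exists m n, iter m (map_of f) (\val v) = iter n (map_of f) (\val w).
  exact: punctured_classP.
have qclsE (h h' : hopf f) : hopf_quotient_class h = hopf_quotient_class h' <->
    exists m n, iter m (@standard_real_structure R f) h =
      iter n (@standard_real_structure R f) h'.
  exact (@orbit_classP (hopf f) (hopf f) id (@standard_real_structure R f) h h').
have pclsE (v w : punctured (C2 R)) :
    punctured_class F (idW v) = punctured_class F (idW w) <->
    exists m n, iter m F (id4 (\val v)) = iter n F (id4 (\val w)).
  exact (punctured_classP F (idW v) (idW w)).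
(* Both maps from the punctured space have as fibres the orbits of the group generated by [f] and
   the real structure. *)
have [|Psi Psi_homeo PsiE] := quotient_map_homeomorphism pW qW.
  move=> v w; split.
    move=> /qclsE[m [n]]; rewrite !s_iter => /clsE[a [b]].
    rewrite !cW_iter => e; apply/pclsE; exists a, b.
    by rewrite -(id_c_iter m) -[id4 (\val w)](id_c_iter n) !F_iter e.
  move=> /pclsE[a [b]]; rewrite !F_iter => /ident_eq e.
  apply/qclsE; case: e => e.
    by exists 0%N, 0%N; apply/clsE; exists a, b.
  exists 0%N, 1%N; rewrite !s_iter; apply/clsE; exists a, b.
  by rewrite !cW_iter /= f_iter.
exists Psi.
(* The section of the identification over the invariant plane, with values in [V_+]. *)
pose j x := (fun g : R4 R -> C2 R => g (x, 0)) (sval (cid L_homeo.2)).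
have jE x : L (j x) = (x, 0).
  by rewrite /j; case: (cid _) => g [_ _ gK] /=; rewrite gK.
have j_cont : continuous j.
  rewrite /j; case: (cid _) => g [cg _ _] /=.
  have c1 : continuous (fun x : R2 R => (x, 0 : R2 R)).
    by apply: continuous_pair; [move=> ?; exact: cvg_id|exact: continuous_cst].
  exact (continuous_compose c1 cg).
have self_opp (x : R2 R) : - x = x -> x = 0.
  case: x => u w e; have /= e1 := congr1 fst e; have /= e2 := congr1 snd e.
  by congr pair; lra.
have cE v : c v = v <-> (L v).2 = 0.
  split=> [e|e].
    by apply: self_opp; rewrite -[in RHS]e eigen_coord_conj.
  apply: eigen_coord_inj; rewrite eigen_coord_conj// e oppr0 -e.
  by rewrite -surjective_pairing.
have LV v : c v = v -> (L v).1 = phip v.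
  move=> cv; rewrite /eigen_coord /=; congr phip.
  rewrite -[in LHS](addr0 v); apply: proj_plus_sum => //.
  by rewrite /eigen_minus /= real_struct0 oppr0.
have id4V v : c v = v -> id4 v = ((L v).1, 0).
  by move=> /cE e; rewrite ident_square /square_snd e sqr_map0.
have c_eta x : c (eta (x, 0)) = eta (x, 0) by rewrite -eta_conj /= oppr0.
have Qx x : square_snd (x, 0) = (x, 0) :> R4 R by rewrite /square_snd sqr_map0.
have S_plane x : S (x, 0) = ((S (x, 0)).1, 0) by rewrite -Qx SE id4V.
(* A point over the plane comes from a vector fixed by the real structure; its [eta]-coordinates (x,
   u) satisfy u = -u, hence u = 0. *)
have T_plane x : T (x, 0) = ((T (x, 0)).1, 0).
  have [y yE] := (@square_snd_quotient_map R).1 (T (x, 0)).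
  have : S (square_snd y) = (x, 0) by rewrite yE TK.
  rewrite SE ident_square => /(congr1 snd) /= /eqP; rewrite sqr_map_eq0 => /eqP /cE.
  rewrite -eta_conj => /eta_inj /(congr1 snd) /= /self_opp y2.
  by rewrite -yE /square_snd /= y2 sqr_map0.
pose F0 x := (F (x, 0)).1; pose sigma x := (S (x, 0)).1; pose tau x := (T (x, 0)).1.
have sigmaE x : S (x, 0) = (sigma x, 0) by exact: S_plane.
have tauE x : T (x, 0) = (tau x, 0) by exact: T_plane.
have F_plane x : F (x, 0) = (F0 x, 0).
  by rewrite /F0 /F tauE Phi1_plane sigmaE.
have sigmaK : cancel sigma tau by move=> x; rewrite /tau -sigmaE SK.
have tauK : cancel tau sigma by move=> x; rewrite /sigma -tauE TK.
have F0E x : F0 (sigma x) = sigma (M0 x).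
  by rewrite /F0 -sigmaE FS Phi1_plane sigmaE.
have c0 : continuous (fun x : R2 R => (x, 0 : R2 R)).
  by apply: continuous_pair; [move=> ?; exact: cvg_id|exact: continuous_cst].
have sigma_cont : continuous sigma.
  exact (continuous_compose (continuous_compose c0 S_homeo.1) (@continuous_fst _ _)).
have tau_cont : continuous tau.
  exact (continuous_compose (continuous_compose c0 T_homeo.1) (@continuous_fst _ _)).
have sigma_homeo : homeomorphism sigma by split => //; exists tau.
have tau_homeo : homeomorphism tau by split => //; exists sigma.
have F0_homeo : homeomorphism F0.
  have -> : F0 = sigma \o (M0 \o tau).
    by apply/funext => x; rewrite -{1}[x]tauK F0E.
  by apply: homeomorphism_comp => //; exact: homeomorphism_comp.
have F00 : F0 0 = 0 by rewrite /F0 (_ : (0, 0) = 0)//; have [_ -> _] := F_contr.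
have F0_inj : injective F0 by have [_ [g [_ K _]]] := F0_homeo; exact: can_inj K.
have F0_eq0 x : (F0 x == 0) = (x == 0) by rewrite -[in LHS]F00 (inj_eq F0_inj).
have F_iter_plane n x : iter n F (x, 0) = (iter n F0 x, 0).
  by elim: n => //= n ->; rewrite F_plane.
have norm_plane x : `|(x, 0 : R2 R)| = `|x|.
  by rewrite prod_normE /= normr0 max_l.
have F0_contr : punctured_contraction F0.
  split => // M e e0; have [_ _ /(_ M e e0)[N NE]] := F_contr.
  exists N => n x Nn xM; have := NE n (x, 0) Nn.
  by rewrite F_iter_plane !norm_plane; apply.
split.
- split => //.
    by move=> v; exists (idW v) => //; exact: PsiE.
  have [h h_homeo] := F_torus; exists (h \o Psi); exact: homeomorphism_comp.
- apply/seteqP; split => [_ [[x u] /= [x0 ->] <-]|[x u] /= [x0 ->]].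
    by rewrite F_plane /= F0_eq0.
  have [_ [g [_ _ gK]]] := F0_homeo.
  exists (g x, 0) => /=; last by rewrite F_plane gK.
  by rewrite -F0_eq0 gK.
exists F0; split => //; last first.
- move=> v cv; have cfv : c (map_of f v) = map_of f v by rewrite real_struct_map// cv.
  by rewrite -!LV// /F0 -id4V// FI id4V.
- exists sigma; split => // x.
  have sigma0 : sigma 0 = 0 by rewrite /sigma (_ : (0, 0) = 0)// S0.
  by rewrite -[in LHS]sigma0 (can_eq sigmaK).
have jV x : c (j x) = j x by apply/cE; rewrite jE.
have j_id x : id4 (j x) = (x, 0) by rewrite id4V// jE.
have jL v : c v = v -> v = j (L v).1.
  move=> /cE v2; apply: eigen_coord_inj; rewrite jE -v2.
  by rewrite -surjective_pairing.
have j_inj : injective j by move=> x x' /(congr1 id4); rewrite !j_id => /(congr1 fst).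
have j_eq0 x : (j x == 0) = (x == 0).
  have j0 : j 0 = 0 by apply/eqP; rewrite -ident_eq0 j_id.
  by rewrite -[in LHS]j0 (inj_eq j_inj).
pose jW := @punctured_map R R[i] (R2 R) (C2 R) j j_eq0.
have f_j x : map_of f (j x) = j (F0 x).
  have cfj : c (map_of f (j x)) = map_of f (j x) by rewrite real_struct_map// jV.
  rewrite [LHS]jL//; congr j.
  have e := id4V _ cfj; rewrite -FI j_id F_plane in e.
  exact: esym (congr1 fst e).
have f_j_iter n x : iter n (map_of f) (j x) = j (iter n F0 x).
  by elim: n => // n IH; rewrite !iterS IH f_j.
have f_iter_inj n : injective (iter n (map_of f)).
  by elim: n => // n IH v w; rewrite !iterS => /map_of_inj/IH.
have jfix (x : punctured (R2 R)) : fixed_locus f (hopf_class f (jW x)).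
  rewrite /fixed_locus /mkset standard_real_structure_class//; congr hopf_class.
  by apply: val_inj; exact: jV.
(* A nonzero periodic point would return at arbitrarily late times, while the contraction property
   with both bounds equal to its own norm sends late iterates strictly below that norm. *)
have noper v n : v != 0 -> iter n.+1 F (id4 v) = id4 v -> False.
  move=> v0 e; have [_ _ Fc] := F_contr.
  have nv : 0 < `|id4 v| by rewrite normr_gt0 ident_eq0.
  have [N NE] := Fc `|id4 v| `|id4 v| nv.
  have eN k : iter (k * n.+1) F (id4 v) = id4 v.
    by elim: k => // k IH; rewrite mulSn iterD IH.
  have := NE (N * n.+1)%N (id4 v); rewrite eN ltxx.
  by move=> H; suff : false by []; apply: H => //; rewrite leq_pmulr.
(* The images of w and c w under [id4] coincide, so f^m (c w) = f^n w with distinct exponents would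
   give a periodic point of [F]. *)
have fixE (w : punctured (C2 R)) : fixed_locus f (hopf_class f w) -> c (\val w) = \val w.
  rewrite /fixed_locus /mkset standard_real_structure_class// => /clsE[m [n]].
  have w0 : \val w != 0 := set_mem (valP w).
  rewrite [\val (real_structW f w)](_ : _ = c (\val w))// => e.
  case: (ltngtP m n) e => [mn|nm|->]; last by move=> /f_iter_inj.
    have -> : n = (m + (n - m).-1.+1)%N by lia.
    rewrite iterD => /f_iter_inj e; exfalso; apply: (noper _ (n - m).-1 w0).
    by rewrite F_iter -e id_c.
  have -> : m = (n + (m - n).-1.+1)%N by lia.
  rewrite iterD => /f_iter_inj e; exfalso; apply: (noper _ (m - n).-1 w0).
  by rewrite -[in LHS](id_c (\val w)) F_iter e.
pose p (x : punctured (R2 R)) : fixed_locus f :=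
  exist _ (hopf_class f (jW x)) (mem_set (jfix x)).
have p_surj (h : fixed_locus f) : exists x : punctured (R2 R), p x = h.
  pose w := punctured_repr (\val h : hopf f).
  have wE : hopf_class f w = \val h by exact: punctured_reprK.
  have cw : c (\val w) = \val w by apply: fixE; rewrite wE; exact: (set_mem (valP h)).
  have x0 : (L (\val w)).1 \in punctured (R2 R).
    by apply/mem_set; rewrite /punctured /mkset -j_eq0 -jL//; exact: (set_mem (valP w)).
  exists (exist _ (L (\val w)).1 x0); apply: val_inj; rewrite -wE.
  by congr hopf_class; apply: val_inj; exact: esym (jL _ cw).
have p_cont : continuous p.
  apply: continuous_val.
  have jW_cont : continuous jW by exact: punctured_map_continuous.
  have cls_cont := quotient_map_continuous (@punctured_class_quotient_map _ _ (map_of f)).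
  exact (continuous_compose jW_cont cls_cont).
have p_quot : quotient_map p.
  split => // W; split; last by move: p_cont => /continuousP; apply.
  move=> [U oU UW].
  (* The fixed locus carries the subspace topology, so an open set of the plane must be extended to
     an open set of the Hopf surface. Adding the whole open complement of [V_+] gives an open set
     that is also saturated. *)
  pose B : set (punctured (C2 R)) :=
    [set w | (L (\val w)).2 != 0 \/ U (L (\val w)).1].
  have oB : open B.
    have cL : continuous (fun w : punctured (C2 R) => L (\val w)).
      exact (continuous_compose (@val_continuous _ _) L_homeo.1).
    have c1 := continuous_compose cL (@continuous_fst _ _).
    have c2 := continuous_compose (continuous_compose cL (@continuous_snd _ _))
      (@continuous_normsq R).
    have -> : B = (fun w : punctured (C2 R) => normsq (L (\val w)).2) @^-1`
        [set z | 0 < z] `|` (fun w : punctured (C2 R) => (L (\val w)).1) @^-1` U.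
      by apply/seteqP; split => w /=; rewrite /B /= normsq_gt0.
    apply: openU; last exact: ((continuousP _).1 c1 _ oU).
    by apply: ((continuousP _).1 c2); exact: open_gt.
  pose D : set (hopf f) := [set h | forall x : punctured (R2 R), h = hopf_class f (jW x) -> W (p x)].
  have UWE (x : punctured (R2 R)) : U (\val x) = W (p x).
    by rewrite -[U (\val x)]/((\val @^-1` U) x) UW.
  have DB : @hopf_class R f @^-1` D = B.
    apply/seteqP; split => w.
      move=> Dw; rewrite /B /mkset; have [w2|] := eqVneq (L (\val w)).2 0; last by left.
      right; have cw : c (\val w) = \val w by apply/cE.
      have x0 : (L (\val w)).1 \in punctured (R2 R).
        by apply/mem_set; rewrite /punctured /mkset -j_eq0 -jL//; exact: (set_mem (valP w)).
      rewrite -[(L _).1]/(\val (exist _ (L (\val w)).1 x0 : punctured (R2 R))) UWE.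
      by apply: Dw; congr hopf_class; apply: val_inj; exact: jL cw.
    move=> Bw x wx; move: (wx) => /clsE[m [n]].
    rewrite -[\val (jW x)]/(j (\val x)) f_j_iter => e.
    have cw : c (\val w) = \val w.
      by apply: (f_iter_inj m); rewrite f_iter e jV.
    have Uw : U (L (\val w)).1 by case: Bw => //; move: cw => /cE ->; rewrite eqxx.
    have x0 : (L (\val w)).1 \in punctured (R2 R).
      by apply/mem_set; rewrite /punctured /mkset -j_eq0 -jL//; exact: (set_mem (valP w)).
    have : W (p (exist _ (L (\val w)).1 x0)) by rewrite -UWE.
    congr W; apply: val_inj; rewrite -[RHS]wx.
    by congr hopf_class; apply: val_inj; exact: esym (jL _ cw).
  have oDB : open (@hopf_class R f @^-1` D) by rewrite DB.
  have oD : open D.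
    exact: (iffLR ((@punctured_class_quotient_map _ _ (map_of f)).2 D) oDB).
  exists D => //; apply/seteqP; split => h.
    have [x <-] := p_surj h => Dh; exact: Dh.
  have [x <-] := p_surj h => Wh x' e.
  suff -> : p x' = p x by [].
  exact: val_inj.
have [|Chi Chi_homeo ChiE] := quotient_map_homeomorphism p_quot
    (@punctured_class_quotient_map _ _ F0).
  move=> x x'; split.
    move=> /(congr1 val) /clsE[m [n]] /=; rewrite !f_j_iter => /j_inj e.
    by apply/punctured_classP; exists m, n.
  move=> /punctured_classP[m [n e]]; apply: val_inj; apply/clsE; exists m, n.
  by rewrite !f_j_iter e.
exists Chi => // h; have [x <-] := p_surj h.
exists x, (idW (jW x)); split; [exact: ChiE|exact: j_id|exact: PsiE].
Qed.

End Assembly.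

(** * Reversal of orientation on the invariant plane *)

Section RealPlane.
Variable R : realType.
Implicit Types (x y : R2 R) (k : R).

Lemma linear_plane_continuous (A : R2 R -> R2 R) :
  (forall k x y, A (k *: x + y) = k *: A x + A y) -> continuous A.
Proof.
move=> AD; have A0 : A 0 = 0.
  by have := AD 1 0 0; rewrite scaler0 addr0 scale1r => /eqP; rewrite -subr_eq subrr => /eqP.
have -> : A = fun x => x.1 *: A (1, 0) + (x.2 *: A (0, 1) + 0).
  apply/funext => x; rewrite -[in RHS]A0 -!AD; congr A; case: x => u w.
  have -> : u *: (1, 0) + (w *: (0, 1) + 0) = (u * 1 + (w * 0 + 0), u * 0 + (w * 1 + 0)) :> R2 R by [].
  by rewrite !mulr1 !mulr0 !addr0 !add0r.
apply: continuous_add; first by apply: continuous_scale; [exact: continuous_fst|exact: continuous_cst].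
apply: continuous_add; last exact: continuous_cst.
by apply: continuous_scale; [exact: continuous_snd|exact: continuous_cst].
Qed.

(** A reflection sends the angle b to -b or to pi - b, according to its axis. *)
Lemma sdiag_polar (s d : R) (r b : R) : s ^+ 2 = 1 -> d = - s ->
  sdiag s d (polar r b) = polar r ((if s == 1 then 0 else pi) - b).
Proof.
move=> /eqP; rewrite sqrf_eq1 => /orP[]/eqP -> ->; rewrite /sdiag /polar /=.
  by rewrite eqxx sub0r cosN sinN mul1r mulN1r mulrN.
have -> : (-1 == 1 :> R) = false by apply/negbTE/eqP; lra.
by rewrite cosB sinB cospi sinpi; congr pair; ring.
Qed.

Lemma sdiag_not_orientation_preserving (s d : R) : s ^+ 2 = 1 -> d = - s ->
  ~ orientation_preserving 1 (@sdiag R s d).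
Proof.
move=> s1 ds; have d1 : d ^+ 2 = 1 by rewrite ds sqrrN.
apply: (@reversing_not_orientation_preserving _ _ (if s == 1 then 0 else pi)).
- by move=> x y; rewrite /sdiag; congr pair => /=; rewrite mulrBr.
- exact: (sdiag_homeomorphism s1 d1).1.
- by move=> x; rewrite -!normsq_eq0 normsq_sdiag.
- by move=> r b; exact: sdiag_polar.
Qed.

Lemma sg_interp (a t : R) : a != 0 -> 0 <= t <= 1 -> (1 - t) * a + t * Num.sg a != 0.
Proof.
move=> a0 /andP[t0 t1]; have [ap|an|] := ltgtP a 0; last by move/eqP; rewrite (negbTE a0).
  rewrite (ltr0_sg ap) lt_eqF//.
  have [->|tN] := eqVneq t 0; first by rewrite subr0 mul1r mul0r addr0.
  have tp : 0 < t by rewrite lt_def tN.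
  by nra.
rewrite (gtr0_sg an) gt_eqF//.
have [->|tN] := eqVneq t 0; first by rewrite subr0 mul1r mul0r addr0.
have tp : 0 < t by rewrite lt_def tN.
by nra.
Qed.

(** The isotopy moves the diagonal entries linearly to their signs and shrinks [b] to 0. It stays
    triangular with nonzero diagonal entries, hence injective, and ends at a reflection conjugated
    by the linear map [A]. *)
Lemma triangular_not_orientation_preserving (A B : R2 R -> R2 R) (F : R2 R -> R2 R)
    (a d : R) (b : R -> R) :
  (forall k x y, A (k *: x + y) = k *: A x + A y) -> cancel A B -> cancel B A ->
  continuous b -> a * d < 0 ->
  (forall x, F (A x) = A (a * x.1 + b x.2, d * x.2)) ->
  ~ orientation_preserving 1 F.
Proof.
move=> AD AK BK cb ad FA opF.
have A_inj := can_inj AK.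
have BD k x y : B (k *: x + y) = k *: B x + B y by apply: A_inj; rewrite AD !BK.
have cA := linear_plane_continuous AD; have cB := linear_plane_continuous BD.
have addA (C : R2 R -> R2 R) : (forall k x y, C (k *: x + y) = k *: C x + C y) ->
    zmod_morphism C.
  by move=> CD x y; rewrite addrC -scaleN1r CD scaleN1r addrC.
have a0 : a != 0 by apply: contraTneq ad => ->; rewrite mul0r ltxx.
have d0 : d != 0 by apply: contraTneq ad => ->; rewrite mulr0 ltxx.
pose sa := Num.sg a; pose sd := Num.sg d.
have sds : sd = - sa.
  have : sa * sd = -1 by rewrite /sa /sd -sgrM ltr0_sg.
  have sa2 : sa ^+ 2 = 1 by rewrite /sa sqr_sg a0.
  move=> e; transitivity (sa ^+ 2 * sd); first by rewrite sa2 mul1r.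
  by rewrite expr2 -mulrA e mulrN1.
have sa2 : sa ^+ 2 = 1 by rewrite /sa sqr_sg a0.
apply: (sdiag_not_orientation_preserving sa2 sds).
apply: (@orientation_preserving_conj _ _ _ A B (sdiag sa sd)) => //; [exact: addA|exact: addA|].
pose g (t : R) (x : R2 R) : R2 R :=
  (((1 - t) * a + t * sa) * x.1 + (1 - t) * b x.2, ((1 - t) * d + t * sd) * x.2).
pose H t x := A (g t (B x)).
have H0 : H 0 = F.
  apply/funext => x; rewrite -{2}[x]BK FA /H /g; congr A.
  by rewrite !subr0 !mul1r !mul0r !addr0.
have H1 : H 1 = A \o sdiag sa sd \o B.
  apply/funext => x; rewrite /H /g /= /sdiag; congr A.
  by rewrite !subrr !mul0r !add0r !mul1r addr0.
rewrite -H1; apply: isotopy_orientation_preserving; last by rewrite H0.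
  have c1 : continuous (fun p : R * R2 R => p.1) by exact: continuous_fst.
  have c2 : continuous (fun p : R * R2 R => B p.2).
    exact (continuous_compose (@continuous_snd _ _) cB).
  have c21 := continuous_compose c2 (@continuous_fst _ _).
  have c22 := continuous_compose c2 (@continuous_snd _ _).
  have cm : continuous (fun p : R * R2 R => 1 - p.1 : R).
    by apply: continuous_sub => //; exact: continuous_cst.
  have ci (u w : R) : continuous (fun p : R * R2 R => (1 - p.1) * u + p.1 * w : R).
    by apply: continuous_add; apply: continuous_mul => //; exact: continuous_cst.
  have cg : continuous (fun p : R * R2 R => g p.1 (B p.2)).
    apply: continuous_pair; last exact (continuous_mul (ci _ _) c22).
    apply: continuous_add; first exact (continuous_mul (ci _ _) c21).
    exact (continuous_mul cm (continuous_compose c22 cb)).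
  exact (continuous_compose cg cA).
move=> t t01 x y /A_inj e; apply: (can_inj BK).
have /= e1 := congr1 fst e; have /= e2 := congr1 snd e.
have {}e2 : (B x).2 = (B y).2 by apply: mulfI e2; exact: sg_interp.
rewrite e2 in e1; move/addIr: e1 => e1.
have {}e1 : (B x).1 = (B y).1 by apply: mulfI e1; exact: sg_interp.
by rewrite [B x]surjective_pairing e1 e2 -surjective_pairing.
Qed.

Lemma rot_inj a : injective (@rot R a).
Proof. by move=> x y /(congr1 (rot (- a))); rewrite -!rotD addNr !rot0. Qed.

Lemma expR_scale_inj (V : lmodType R) t : injective (fun x : V => expR t *: x).
Proof. by apply: scalerI; rewrite gt_eqF ?expR_gt0. Qed.

Lemma expR_half2 : expR (- 2^-1) ^+ 2 = expR (- 1) :> R.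
Proof. by rewrite expR_opp_sqr mulfV. Qed.

End RealPlane.

Section RealForm.
Variables (R : realType) (f : normal_form R).
Hypotheses (hf : admissible f) (hr : real_coefs f).
Hypothesis hprod : (diag_coefs f).1 * (diag_coefs f).2 < 0.
Variable phip : C2 R -> R2 R.
Hypothesis hphip : linear_iso_on (eigen_plus f) phip.
Variable F : R2 R -> R2 R.
Hypothesis F_phip : forall v, real_struct f v = v -> F (phip v) = phip (map_of f v).

(** On [V_+], which consists of the real vectors, [f] is a real triangular map, and [phip] is linear
    there. [F] is thus linearly conjugate to a triangular map, without passing through the
    logarithmic shear or the radial maps. *)
Lemma real_form_not_orientation_preserving : ~ orientation_preserving 1 F.
Proof.
pose emb (x : R2 R) : C2 R := (x.1%:C, x.2%:C).
have hc : is_IIc' f = false.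
  case: f hr => //= a d /andP[/= ar _]; apply/negP => /andP[_].
  by rewrite ar.
have Vemb x : real_struct f (emb x) = emb x.
  by rewrite /real_struct hc /emb /= oppr0.
have cD (a b : R) : (a + b)%:C = a%:C + b%:C :> R[i] by exact: rmorphD.
have cM (a b : R) : (a * b)%:C = a%:C * b%:C :> R[i] by exact: rmorphM.
have cX (a : R) n : (a ^+ n)%:C = a%:C ^+ n :> R[i] by exact: rmorphXn.
have embD k x y : emb (k *: x + y) = k%:C *: emb x + emb y.
  have -> : k%:C *: emb x + emb y =
    (k%:C * x.1%:C + y.1%:C, k%:C * x.2%:C + y.2%:C) by [].
  by rewrite -!cM -!cD.
pose A x := phip (emb x).
have AD k x y : A (k *: x + y) = k *: A x + A y.
  by rewrite /A embD hphip.1//; exact: Vemb.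
have [_ [_ inj surj]] := hphip.
have A_surj x : exists y, A y = x.
  have [v Vv <-] := surj x I; move: Vv; rewrite /eigen_plus /= /real_struct hc.
  case: v => [[a b] [a' b']] e; exists (a, a'); rewrite /A /emb /=.
  have /= eb := congr1 (fun v : C2 R => complex.Im v.1) e.
  have /= eb' := congr1 (fun v : C2 R => complex.Im v.2) e.
  congr phip; congr pair; apply/eqP; rewrite eq_complex /= eqxx; apply/eqP; lra.
have A_inj : injective A.
  move=> x y /inj; rewrite !inE => /(_ (Vemb _) (Vemb _)).
  case: x y => [a b] [a' b'] e.
  have /= -> := congr1 (fun v : C2 R => complex.Re v.1) e.
  by have /= -> := congr1 (fun v : C2 R => complex.Re v.2) e.
have [B BK] := choice A_surj.
have AK : cancel A B by move=> x; apply: A_inj; rewrite BK.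
have FA x : F (A x) = phip (map_of f (emb x)) by rewrite F_phip.
have [a [d [adE _ _ _]]] := real_conj_diag hf hr.
have ad : a * d < 0.
  by move: hprod; rewrite adE /= -cM (_ : 0 = 0%:C)// ltcR.
(* [b] is 0 for the diagonal forms, t^r for [IIa] and t for [IIb]. *)
have [b cb bE] : exists2 b : R -> R, continuous b &
    forall x, map_of f (emb x) = emb (a * x.1 + b x.2, d * x.2).
  have c0 : continuous (fun _ : R => 0 : R) by exact: continuous_cst.
  have cP r : continuous (fun t : R => t ^+ r : R).
    by apply: continuous_exp => ?; exact: cvg_id.
  move: adE; case: (f) => /=.
  - move=> z [-> E]; exists (fun=> 0) => // x.
    by rewrite /emb /= addr0 !cM -E.
  - move=> r z [-> ->]; exists (fun=> 0) => // x.
    by rewrite /emb /= addr0 !cM.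
  - move=> r z [-> ->]; exists (fun t => t ^+ r) => [|x]; first exact: cP.
    by rewrite /emb /= cD !cM cX.
  - move=> z [-> E]; exists id => [?|x]; first exact: cvg_id.
    by rewrite /emb /= cD !cM -E.
  - move=> z w [-> ->]; exists (fun=> 0) => // x.
    by rewrite /emb /= addr0 !cM.
apply: (triangular_not_orientation_preserving AD AK BK cb ad) => x.
by rewrite FA bE.
Qed.

End RealForm.

(** * Torus or Klein bottle *)

Section Conclusion.
Variables (R : realType) (F0 S0 : R2 R -> R2 R).
Hypotheses (S0_homeo : homeomorphism S0) (S0_eq0 : forall x, (S0 x == 0) = (x == 0)).

Let norm2sq_ge0 (x : R2 R) : 0 <= norm2sq x.
Proof. by rewrite norm2sqE normsq_ge0. Qed.

Let norm2sq_eq0 (x : R2 R) : (norm2sq x == 0) = (x == 0).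
Proof. by rewrite norm2sqE normsq_eq0. Qed.

Lemma rotation_torus phi : (forall x, F0 (S0 x) = S0 (flow2 phi 1 x)) ->
  homeomorphic (punctured_quotient F0) (torus R).
Proof.
move=> F0E; exact: (@flow_torus R (R2 R) (flow2 phi) (@norm2sq R)
  (@flow2_continuous R phi) (@flow20 R phi) (@flow2D R phi)
  (@norm2sq_continuous R) norm2sq_ge0 norm2sq_eq0 (@norm2sq_flow2 R phi)
  F0 S0 S0_homeo S0_eq0 F0E).
Qed.

Lemma rotation_orientation_preserving phi :
  (forall x, F0 (S0 x) = S0 (flow2 phi 1 x)) -> orientation_preserving 1 F0.
Proof.
move=> F0E; exact: (@flow_isotopy R (R2 R) (flow2 phi)
  (@flow2_continuous R phi) (@flow20 R phi) (@flow2D R phi) F0 S0 S0_homeo F0E).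
Qed.

Lemma reflection_klein :
  (forall x, F0 (S0 x) = S0 (expR (- 1) *: sdiag 1 (- 1) x)) ->
  homeomorphic (punctured_quotient F0) (klein_bottle R).
Proof.
(* The angle 0 makes the flow a pure dilation, commuting with the reflection: in its polar
   coordinates the map shifts the time by 1 and sends y to -y on the circle. *)
move=> F0E; pose Phi := @flow2 R 0.
have polar_homeo := @flow_polar_homeomorphism R (R2 R) Phi (@norm2sq R)
  (@flow2_continuous R 0) (@flow20 R 0) (@flow2D R 0)
  (@norm2sq_continuous R) norm2sq_ge0 norm2sq_eq0 (@norm2sq_flow2 R 0)
  S0 S0_homeo S0_eq0.
apply: (klein_homeomorphic (homeomorphism_quotient_map polar_homeo)).
  by have [_ [g [_ K _]]] := polar_homeo; exact: can_inj K.
move=> x y.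
have E t z : Phi t z = expR (- t) *: z by rewrite /Phi /flow2 mulr0 rot0.
transitivity (F0 (S0 (Phi x (expi y)))); first by [].
transitivity (S0 (Phi (x + 1) (expi (- y)))); last by [].
rewrite F0E !E sdiagZ scalerA -expRD -opprD addrC; congr (S0 (_ *: _)).
by rewrite /expi /polar /sdiag /= mulrN sinN cosN !mul1r mulN1r.
Qed.

End Conclusion.

Theorem proposition5p16 (R : realType) (f : normal_form R)
    (hf : admissible f) (hreal : real_coefs f \/ is_IIc' f)
    (phip phim : C2 R -> R2 R)
    (hphip : linear_iso_on (eigen_plus f) phip)
    (hphim : linear_iso_on (eigen_minus f) phim) :
  exists F : R4 R -> R4 R,
    [/\ forall v : C2 R,
          F (ident f phip phim v) = ident f phip phim (map_of f v),
        punctured_contraction F &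
    exists Phi : hopf_quotient f -> punctured_quotient F,
    [/\
      (* (1) *)
      [/\ orientation_preserving 3 F,
          homeomorphism Phi,
          (forall v : punctured (C2 R), exists2 y : punctured (R4 R),
             \val y = ident f phip phim (\val v) &
             Phi (hopf_quotient_class (hopf_class f v)) = punctured_class F y) &
          homeomorphic (hopf_quotient f) (circle R * sphere3 R)%type],
      (* (2) *)
      F @` [set y : R4 R | y.1 != 0 /\ y.2 = 0] = [set y : R4 R | y.1 != 0 /\ y.2 = 0] &
      exists F0 : R2 R -> R2 R,
      [/\ forall x : R2 R, F (x, 0) = (F0 x, 0),
          punctured_contraction F0,
          (exists2 Psi : fixed_locus f -> punctured_quotient F0,
             homeomorphism Psi &
             forall h : fixed_locus f,
             exists (x : punctured (R2 R)) (y : punctured (R4 R)),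
             [/\ Psi h = punctured_class F0 x,
                 \val y = (\val x, 0) &
                 Phi (hopf_quotient_class (\val h)) = punctured_class F y]) &
      (* (3) *)
      [/\ orientation_preserving 1 F0 <->
            0 < (diag_coefs f).1 * (diag_coefs f).2,
          (0 < (diag_coefs f).1 * (diag_coefs f).2 ->
             homeomorphic (punctured_quotient F0) (torus R)) &
          ((diag_coefs f).1 * (diag_coefs f).2 < 0 ->
             homeomorphic (punctured_quotient F0) (klein_bottle R))]]]].
Proof.
have [eta [eta_homeo eta0 eta_conj [[phi prod_gt0 f0E]|[prod_lt0 hr f0E]]]] :=
  normalization hf hreal.
- pose f0 (y : R4 R) : R4 R := (expR (- 1) *: rot phi y.1, expR (- 2^-1) *: rot phi y.2).
  have f0_inj : injective f0.
    case=> x u [x' u'] e; have /= /expR_scale_inj/rot_inj -> := congr1 fst e.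
    by have /= /expR_scale_inj/rot_inj -> := congr1 snd e.
  (* Squaring turns exp(-1/2) into exp(-1) and the rotation by [phi] into the rotation by
     [phi + phi]. *)
  have Phi1E y : flow4 phi 1 (square_snd y) = square_snd (f0 y).
    rewrite /square_snd /f0 /= sqr_mapZ expR_half2 sqr_map_rot.
    by rewrite /flow4 mul1r.
  have Phi1_plane x : flow4 phi 1 (x, 0) = (flow2 phi 1 x, 0).
    have -> : flow4 phi 1 (x, 0) = (flow2 phi 1 x,
      expR (- 1) *: rot (1 * phi + 1 * phi) 0) by [].
    by rewrite (_ : rot _ 0 = 0) ?scaler0// /rot !mulr0 subr0 addr0.
  have M0_homeo : homeomorphism (@flow2 R phi 1).
    have cM t : continuous (@flow2 R phi t).
      have c1 : continuous (fun x : R2 R => (t, x)).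
        by apply: continuous_pair; [exact: continuous_cst|move=> ?; exact: cvg_id].
      exact (continuous_compose c1 (@flow2_continuous R phi)).
    split => //; exists (@flow2 R phi (- 1)); split => // x.
      by rewrite -flow2D addNr flow20.
    by rewrite -flow2D subrr flow20.
  have [F [FI Fc [Phi [P1 P2 [F0 [F0E F0c F0fix [S0 [S0h S0e S0E]] F0p]]]]]] :=
    assembly hreal hphip hphim eta_homeo eta0 eta_conj f0_inj f0E Phi1E
      Phi1_plane M0_homeo (@flow4_continuous R phi) (@flow40 R phi)
      (@flow4D R phi) (@norm4sq_flow4 R phi).
  exists F; split => //; exists Phi; split => //; exists F0; split => //.
  split.
  + by split => // _; exact: (rotation_orientation_preserving S0h S0E).
  + by move=> _; exact: (rotation_torus S0h S0e S0E).
  + by move=> prod_lt0; have := lt_trans prod_gt0 prod_lt0; rewrite ltxx.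
- have m1 : (- 1 : R) ^+ 2 = 1 by rewrite sqrrN expr1n.
  pose f0 (y : R4 R) : R4 R :=
    (expR (- 1) *: sdiag 1 (- 1) y.1, expR (- 2^-1) *: sdiag 1 (- 1) y.2).
  have sd_inj : injective (@sdiag R 1 (- 1)).
    have [_ [g [_ K _]]] := @sdiag_homeomorphism R 1 (- 1) (expr1n _ _) m1.
    exact: can_inj K.
  have f0_inj : injective f0.
    case=> x u [x' u'] e; have /= /expR_scale_inj/sd_inj -> := congr1 fst e.
    by have /= /expR_scale_inj/sd_inj -> := congr1 snd e.
  (* Complex conjugation commutes with squaring, so the reflection of [V_-] survives as a reflection
     of the plane of squares. *)
  have sqr_sd (x : R2 R) : sqr_map (sdiag 1 (- 1) x) = sdiag 1 (- 1) (sqr_map x).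
    by rewrite /sqr_map /sdiag /=; congr pair; ring.
  have Phi1E y : twist_flow 1 (square_snd y) = square_snd (f0 y).
    rewrite /square_snd /f0 /= sqr_mapZ expR_half2 sqr_sd twist_flow1.
    by rewrite /sdiag !mul1r !mulN1r.
  have Phi1_plane (x : R2 R) : twist_flow 1 (x, 0) = (expR (- 1) *: sdiag 1 (- 1) x, 0).
    rewrite twist_flow1 /sdiag /= mul1r mulN1r.
    congr pair; have -> : (0, - 0) = 0 :> R2 R by rewrite oppr0.
    exact: scaler0.
  have M0_homeo : homeomorphism (fun x : R2 R => expR (- 1) *: sdiag 1 (- 1) x).
    have sdh := @sdiag_homeomorphism R 1 (- 1) (expr1n _ _) m1.
    have sch : homeomorphism (fun x : R2 R => expR (- 1) *: x).
      have cs (k : R) : continuous (fun x : R2 R => k *: x).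
        by apply: continuous_scale; [exact: continuous_cst|move=> ?; exact: cvg_id].
      split => //; exists (fun x => expR 1 *: x); split => // x.
        by rewrite scalerA -expRD subrr expR0 scale1r.
      by rewrite scalerA -expRD addNr expR0 scale1r.
    exact: homeomorphism_comp sdh sch.
  have [F [FI Fc [Phi [P1 P2 [F0 [F0E F0c F0fix [S0 [S0h S0e S0E]] F0p]]]]]] :=
    assembly hreal hphip hphim eta_homeo eta0 eta_conj f0_inj f0E Phi1E
      Phi1_plane M0_homeo (@twist_flow_continuous R) (@twist_flow0 R)
      (@twist_flowD R) (@norm4sq_twist_flow R).
  have not_op := real_form_not_orientation_preserving hf hr prod_lt0 hphip F0p.
  exists F; split => //; exists Phi; split => //; exists F0; split => //.
  split.
  + split => [op|prod_gt0]; first by case: (not_op op).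
    by have := lt_trans prod_gt0 prod_lt0; rewrite ltxx.
  + by move=> prod_gt0; have := lt_trans prod_gt0 prod_lt0; rewrite ltxx.
  + by move=> _; exact: (reflection_klein S0h S0e S0E).
Qed.
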